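(* Let $(X,\mathsf d)$ and $\mathsf E:X\to\mathbb R\cup\{+\infty\}$ satisfy the standing assumptions (A1)–(A3) and Assumption (S). For any fixed $x,y\in X$ and $\varepsilon>0$, the $\varepsilon$-Schrödinger problem $$\inf\big\{\mathcal A(\gamma)+\varepsilon^2\mathcal I(\gamma):\ \gamma\in C([0,1],X),\ \gamma_0=x,\ \gamma_1=y\big\}$$ is solvable if and only if $\mathsf E(x)<\infty$, $\mathsf E(y)<\infty$ and there exists $\gamma\in AC([0,1],X)$ such that $\gamma_0=x$ and $\gamma_1=y$.
   Context: Curves: for a metric space $(X,\mathsf d)$, $C([0,1],X)$ denotes the continuous curves $\gamma=(\gamma_t)_{t\in[0,1]}$, $AC([0,1],X)$ the absolutely continuous ones, and $|\dot\gamma_t|$ the metric speed. Slope: $D(\mathsf E)=\{x\in X:\mathsf E(x)<\infty\}$. The slope $|\partial\mathsf E|(x)$ is $+\infty$ if $x\notin D(\mathsf E)$, $0$ if $x$ is isolated, and $|\partial\mathsf E|(x)=\limsup_{z\to x}\frac{[\mathsf E(x)-\mathsf E(z)]^+}{\mathsf d(x,z)}$ otherwise. $\mathrm{EVI}_\lambda$-gradient flow of $\mathsf E$ ($\lambda\in\mathbb R$) starting from $x$: a curve $(\gamma_t)_{t>0}$ in $AC_{loc}((0,\infty),X)$ with $\gamma_t\to x$ as $t\downarrow0$ and $\frac12\frac{d}{dt}\mathsf d^2(\gamma_t,z)+\frac\lambda2\mathsf d^2(\gamma_t,z)+\mathsf E(\gamma_t)\le\mathsf E(z)$ for all $z\in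 X$ and a.e. $t>0$. Standing assumptions: (A1) $(X,\mathsf d)$ is a complete separable metric space. (A2) $\mathsf E$ is lower semicontinuous, $\overline{D(\mathsf E)}=X$, and for every $\mathsf d$-bounded $B\subset X$ there is $c_B\in\mathbb R$ with $\mathsf E\ge c_B$ on $B$. (A3) There is $\lambda\in\mathbb R$ such that for every $x\in X$ there exists an $\mathrm{EVI}_\lambda$-gradient flow of $\mathsf E$ starting from $x$. Assumption (S): there is a Hausdorff topology $\sigma$ on $X$ such that every $\mathsf d$-bounded sequence has a $\sigma$-converging subsequence, and $\mathsf d$ (jointly in its two variables) and $|\partial\mathsf E|$ are sequentially $\sigma$-lower semicontinuous. Functionals on $C([0,1],X)$: $\mathcal A(\gamma)=\frac12\int_0^1|\dot\gamma_t|^2dt$ (equal to $+\infty$ if $\gamma$ is not absolutely continuous), $\mathcal I(\gamma)=\frac12\int_0^1|\partial\mathsf E|^2(\gamma_t)dt$. ''Solvable'' means that the infimum is finite and attained by an admissible curve. *)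

(* Defs.v *)
From HB Require Import structures.
From mathcomp Require Import all_boot all_order all_algebra.
From mathcomp Require Import all_classical all_reals all_analysis.

Set Implicit Arguments.
Unset Strict Implicit.
Unset Printing Implicit Defensive.

Import Order.TTheory GRing.Theory Num.Theory.
Import numFieldNormedType.Exports.

Local Open Scope classical_set_scope.
Local Open Scope ring_scope.

Section metric_notions.
Context {R : realType} {X : metricType R}.
Implicit Types (B : set X) (c : R -> X) (s t : R).

Local Notation mu := (@lebesgue_measure R).

Definition metric_bounded B : Prop :=
  exists M : R, forall x y, B x -> B y -> mdist x y <= M.

Definition metric_complete : Prop :=
  forall u : nat -> X, cauchy (u @ \oo) -> exists l : X, u @ \oo --> l.

Definition metric_separable : Prop :=
  exists2 D : set X, countable D & dense D.

(* A curve is a total function on R of which only the values on the relevant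
   interval matter. *)

Definition ac_on (a b : R) c : Prop :=
  exists2 g : R -> R, mu.-integrable `[a, b] (EFin \o g) &
    forall s t, a <= s -> s <= t -> t <= b ->
      ((mdist (c s) (c t))%:E <= \int[mu]_(r in `[s, t]) (g r)%:E)%E.

Definition ac_loc_gt0 c : Prop :=
  forall a b : R, 0 < a -> a <= b -> ac_on a b c.

(* For a curve absolutely continuous on [a, b] this limit exists at almost every
   t in [a, b]; elsewhere [lim] returns a default value. *)
Definition metric_speed c t : \bar R :=
  lim ((mdist (c s) (c t) / `|s - t|)%:E @[s --> t^']).

Definition action c : \bar R :=
  if `[< ac_on 0 1 c >]
  then ((2^-1)%:E * \int[mu]_(t in `[0%R, 1%R]) (metric_speed c t ^+ 2))%E
  else +oo%E.

End metric_notions.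

Arguments metric_complete {R} X.
Arguments metric_separable {R} X.

Section energy.
Context {R : realType} {X : metricType R}.
Variable E : X -> \bar R.
Implicit Types (x y z : X) (c : R -> X) (eps : R).

Local Notation mu := (@lebesgue_measure R).

Definition edom : set X := [set x | (E x < +oo)%E].

Definition slope x : \bar R :=
  if `[< edom x >] then
    if `[< isolated setT x >] then 0%E
    else limf_esup
           (fun z => Order.max (E x - E z) 0 * ((mdist x z)^-1)%:E)%E x^'
  else +oo%E.

Definition evi_gradient_flow (lambda : R) x c : Prop :=
  [/\ ac_loc_gt0 c,
      c t @[t --> 0^'+] --> x &
      forall z, {ae mu, forall t : R, 0 < t ->
        derivable (fun s : R => mdist (c s) z ^+ 2) t 1 /\
        ((2^-1 * derive1 (fun s : R => mdist (c s) z ^+ 2) t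
          + lambda / 2 * mdist (c t) z ^+ 2)%:E + E (c t) <= E z)%E}].

Definition assumptionA1 : Prop := metric_complete X /\ metric_separable X.

Definition assumptionA2 : Prop :=
  [/\ lower_semicontinuous E,
      closure edom = setT &
      forall B : set X, metric_bounded B ->
        exists cB : R, forall x, B x -> (cB%:E <= E x)%E].

Definition assumptionA3 : Prop :=
  exists lambda : R, forall x, exists c, evi_gradient_flow lambda x c.

(* [Topological.axioms_ X] is the type of all topological structures on the
   carrier of X; [sigma] is unrelated to the metric topology of X. *)
Definition assumptionS : Prop :=
  exists sigma : Topological.axioms_ X,
    let Xs : topologicalType := Topological.Pack sigma in
    [/\ hausdorff_space Xs,
        (forall u : nat -> X, metric_bounded (range u) ->
          exists2 phi : nat -> nat, {homo phi : m n / (m < n)%N} &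
            exists l : Xs, (u \o phi : nat -> Xs) @ \oo --> l),
        (forall (u v : nat -> Xs) (l m : Xs),
          u @ \oo --> l -> v @ \oo --> m ->
          ((mdist (l : X) (m : X))%:E
            <= limn_einf (fun n => (mdist (u n : X) (v n : X))%:E))%E) &
        (forall (u : nat -> Xs) (l : Xs), u @ \oo --> l ->
          (slope l <= limn_einf (fun n => slope (u n)))%E)].

Definition slope_energy c : \bar R :=
  ((2^-1)%:E * \int[mu]_(t in `[0%R, 1%R]) (slope (c t) ^+ 2))%E.

Definition schrodinger_cost eps c : \bar R :=
  (action c + (eps ^+ 2)%:E * slope_energy c)%E.

Definition admissible x y : set (R -> X) :=
  [set c : R -> X | [/\ {within `[(0:R), 1], continuous c}, c 0 = x & c 1 = y]].

Definition schrodinger_solvable eps x y : Prop :=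
  let m := ereal_inf (schrodinger_cost eps @` admissible x y) in
  m \is a fin_num /\
  exists2 c, admissible x y c & schrodinger_cost eps c = m.

End energy.

Arguments assumptionA1 {R} X.

(* Main.v *)
Require Import Defs.
From HB Require Import structures.
From mathcomp Require Import all_boot all_order all_algebra.
From mathcomp Require Import all_classical all_reals all_analysis.
From mathcomp Require Import measurable_realfun.
From mathcomp Require Import ring lra.

(** Why the statement holds.

A curve c is studied through energy bounds: functions Phi with
d(c s, c t)^2 <= (t - s)(Phi t - Phi s) for s <= t in [0, 1] ([energy_on]).  A curve has
finite action if and only if it has an energy bound, and half the oscillation of Phi can be
taken equal to the action ([finite_action_energy], [energy_on_action]).  Unlike the metric
speed, an energy bound involves no differentiation, adds up under concatenation, and
survives pointwise limits of curves.

An EVI gradient flow is used through its integrated form ([evi_discrete]), which compares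
the flow at two times s < t with an arbitrary point of finite energy.  With k = |lambda| + 1
this form yields everything that is needed: distances between two flows grow at most like
exp(k t) ([evi_contraction]); the energy that a flow loses bounds its own displacement
([evi_energy]); the slope at c t is bounded by the left difference quotients of c
([slope_left_quotient]) and, at positive times, by the energy lost so far
([slope_regularized]); and the slope, a local quantity, controls E globally:
E x - E z <= 2 exp(k)^2 |dE|(x) d(x, z) + (k / 2) d(x, z)^2 ([slope_upper_gradient]).

Necessity of finite endpoint energies.  In each dyadic interval [2^-(n+1), 2^-n] pick a time
t_n at which the squared slope does not exceed its mean.  The global inequality at c(t_(n+1)),
tested with c(t_n), bounds the increase of E from t_n to t_(n+1) by slope times distance, and
Young's inequality bounds this product by the part of the action and of the slope energy that
is spent near that dyadic interval.  These parts are summable, so E(c t_n) stays bounded, and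
lower semicontinuity gives E(c 0) < +oo ([endpoint_energy]).  The other endpoint follows by
reversing time.

Sufficiency.  A competitor of finite cost starts with the flow from x during time 1/3, then
follows the time 1/3 flow image of a Lipschitz reparametrization of the given curve, and
ends with the flow from y run backwards ([bridge]): on the outer pieces the slope is at most
a constant times the speed, on the middle piece it is bounded by regularization.  The direct
method then applies ([cost_infimum_attained]).  Minimizing curves are equi-Hoelder of
exponent 1/2, so a diagonal argument over rational times produces a limit curve
([curves_compact]), and both parts of the cost are lower semicontinuous along it
([limit_energy], [limit_slope_energy]).

Most inequalities between a curve and an integral reduce to one device: a continuous D whose
increments are locally dominated to the right by those of a monotone Psi is globally dominated
by Psi ([growth_right]).  A null set of bad times costs arbitrarily little, because the
integral over a small open neighbourhood of it is small ([null_control], [ae_growth_right]). *)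

Import Order.TTheory GRing.Theory Num.Theory.
Import numFieldNormedType.Exports.

Set Implicit Arguments.
Unset Strict Implicit.

Local Open Scope classical_set_scope.
Local Open Scope ring_scope.

(** * One-sided growth conditions *)

Section growth.
Context {R : realType}.
Implicit Types (D Psi : R -> R) (a b s t : R).

(** Real induction: the set of t reached by the bound is closed because D is continuous
    and Psi monotone (Psi may jump, but only upwards), and no t < b can be its supremum. *)
Lemma growth_right D Psi a b : a <= b ->
  continuous D ->
  {homo Psi : s t / s <= t} ->
  (forall t, a <= t < b -> exists2 s, t < s <= b & D s - D t <= Psi s - Psi t) ->
  D b - D a <= Psi b - Psi a.
Proof.
move=> ab cD mPsi ext.
pose S := [set t | a <= t <= b /\ D t - D a <= Psi t - Psi a].
have Sa : S a by rewrite /S/= lexx ab; split => //; lra.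
have Sub : ubound S b by move=> t [/andP[]].
have hS : has_sup S by split; [exists a | exists b].
pose c := sup S.
have ac : a <= c by apply: ub_le_sup => //; exists b.
have cb : c <= b by apply: ge_sup => //; exists a.
have Sc : D c - D a <= Psi c - Psi a.
  rewrite leNgt; apply/negP => lt.
  pose e := (D c - D a - (Psi c - Psi a)) / 2.
  have e0 : 0 < e by rewrite /e; lra.
  have /cvgrPdist_lt /(_ _ e0) [d /= d0 Hd] := cD c.
  have [t St ct] := sup_adherent d0 hS.
  have tc : t <= c by apply: ub_le_sup => //; exists b.
  have := mPsi _ _ tc.
  have := Hd t; rewrite /ball_/= => /(_ _)/(le_lt_trans (ler_norm _)) H.
  have {}H : D c - D t < e.
    by apply: H; rewrite ger0_norm ?subr_ge0//; rewrite -/c in ct; lra.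
  by case: St => _; move: H; rewrite /e; lra.
have [cb'|bc] := ltP c b; last by have <- : c = b by apply/eqP; rewrite eq_le cb.
have [|s /andP[cs sb] H] := ext c; first by rewrite ac.
suff : s <= c by rewrite leNgt cs.
apply: ub_le_sup; first by exists b.
by split; [rewrite sb andbT; lra | lra].
Qed.

End growth.

(** * Primitives of integrable functions *)

Section primitive.
Context {R : realType}.
Local Notation mu := (@lebesgue_measure R).
Implicit Types (f g h : R -> R) (a b s t : R).

Definition prim f t : R := \int[mu]_(x in `]-oo, t]) f x.

Definition summable_fun f := mu.-integrable setT (EFin \o f).

Lemma summable_funS f (A : set R) : measurable A -> summable_fun f ->
  mu.-integrable A (EFin \o f).
Proof. by move=> mA; apply: integrableS. Qed.

Lemma prim_sub f s t : summable_fun f -> s <= t ->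
  prim f t - prim f s = \int[mu]_(x in `]s, t]) f x.
Proof.
move=> sf st; rewrite /prim Rintegral_itvB ?bnd_simp//.
exact: summable_funS.
Qed.

Lemma prim_subE f s t : summable_fun f -> s <= t ->
  (prim f t - prim f s)%:E = (\int[mu]_(x in `[s, t]) (f x)%:E)%E.
Proof.
move=> sf st; rewrite prim_sub// Rintegral_itv_obnd_cbnd; last exact: summable_funS.
rewrite /Rintegral fineK//; apply: integrable_fin_num => //.
exact: summable_funS.
Qed.

Lemma prim_le f g s t : summable_fun f -> summable_fun g -> s <= t ->
  (forall x, s < x <= t -> f x <= g x) -> prim f t - prim f s <= prim g t - prim g s.
Proof.
move=> sf sg st fg; rewrite !prim_sub//; apply: le_Rintegral => //.
- exact: summable_funS.
- exact: summable_funS.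
Qed.

Lemma summable_lin (a b : R) f g : summable_fun f -> summable_fun g ->
  summable_fun (fun x => a * f x + b * g x).
Proof.
move=> sf sg.
have := integrableD measurableT (integrableZl measurableT a sf) (integrableZl measurableT b sg).
exact.
Qed.

Lemma prim_lin (a b : R) f g t : summable_fun f -> summable_fun g ->
  prim (fun x => a * f x + b * g x) t = a * prim f t + b * prim g t.
Proof.
move=> sf sg; rewrite /prim.
have sS h : summable_fun h -> mu.-integrable `]-oo, t] (EFin \o h) by exact: summable_funS.
have sZ (r : R) h : summable_fun h -> mu.-integrable `]-oo, t] (EFin \o (fun x => r * h x)).
  move=> sh; have := summable_lin r 0 sh sh => H; apply: summable_funS => //.
  by move: H; rewrite /summable_fun; under eq_fun do rewrite mul0r addr0.
by rewrite RintegralD ?RintegralZl//; [exact: sS|exact: sS|exact: sZ|exact: sZ].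
Qed.

Lemma summable0 : summable_fun (cst 0).
Proof. exact: integrable0. Qed.

Lemma prim0 t : prim (cst 0) t = 0.
Proof. by rewrite /prim /Rintegral integral0. Qed.

Lemma prim_nd f : summable_fun f -> (forall x, 0 <= f x) ->
  {homo prim f : s t / s <= t}.
Proof.
move=> sf f0 s t st; rewrite -subr_ge0.
by have := prim_le summable0 sf st (fun x _ => f0 x); rewrite !prim0 subrr.
Qed.

Lemma prim_cont f : summable_fun f -> continuous (prim f).
Proof.
move=> sf t; apply/cvgrPdist_lt => e e0.
have [d [d0 Hd]] := integral_normr_continuous sf e0.
suff H s u : s <= u -> u - s < d -> `|prim f u - prim f s| < e.
  near=> s; have [st|/ltW ts] := leP s t.
    apply: H => //; near: s; exists d => //= s /=.
    by move=> /(le_lt_trans (ler_norm _)).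
  rewrite distrC; apply: H => //; near: s; exists d => //= s /=.
  by rewrite distrC => /(le_lt_trans (ler_norm _)).
move=> su sud; rewrite prim_sub//.
apply: (@le_lt_trans _ _ (\int[mu]_(x in `]s, u]) `|f x|)).
  by apply: le_normr_Rintegral => //; exact: summable_funS.
apply: Hd; first exact: measurable_itv.
rewrite /= lebesgue_measure_itv/= lte_fin; case: ifPn => _; last by rewrite lte_fin.
by rewrite -EFinD lte_fin.
Unshelve. all: by end_near. Qed.

(** Differentiability of F at t with derivative l, as an explicit two-sided estimate that
    can be evaluated at any nearby point. *)
Definition expands (F : R -> R) t l := forall e : R, 0 < e ->
  \forall s \near t, `|F s - F t - l * (s - t)| <= e * `|s - t|.

Lemma derivable_expands (F : R -> R) t : derivable F t 1 -> expands F t (derive1 F t).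
Proof.
move=> dF e e0.
pose q (h : R) : R := h^-1 * (F (t + h) - F t).
have E : (fun h : R => h^-1 *: ((F \o shift t) (h *: (1 : R)) - F t) : R^o) = q.
  by apply/funext => h; rewrite /q /GRing.scale /= mulr1 [h + t]addrC.
have E' : (fun h : R => h^-1 *: (F (h + t) - F t) : R^o) = q.
  by apply/funext => h; rewrite /q /GRing.scale /= [h + t]addrC.
have : q h @[h --> 0^'] --> derive1 F t.
  by move: dF; rewrite /derivable E /derive1 E'.
move: (derive1 F t) => l /cvgrPdist_le dt.
have [d /= d0 Hd] := dt e e0.
exists d => //= s /= ts.
have [->|st] := eqVneq s t; first by rewrite !subrr mulr0 subrr !normr0 mulr0.
have := Hd (s - t); rewrite /= sub0r normrN distrC /q subrKC subr_eq0 => /(_ ts st).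
rewrite -(ler_pM2r (_ : 0 < `|s - t|)) ?normr_gt0 ?subr_eq0//.
rewrite -normrM distrC mulrBl mulrAC mulVf ?mul1r// ?subr_eq0//.
by rewrite [X in X <= _ -> _]distrC.
Qed.

(** Lebesgue differentiation. *)
Lemma prim_expands f : summable_fun f -> {ae mu, forall t, expands (prim f) t (f t)}.
Proof.
move=> sf.
have := @FTC1Ny R f (fun y => summable_funS (measurable_itv _) sf)
   (open_integrable_locally openT sf).
apply: filterS; first exact: (ae_filter_ringOfSetsType mu).
by move=> t [df dE] e e0; have := derivable_expands df e0; rewrite dE.
Qed.

End primitive.

(** * Growth conditions up to a null set *)

Section null_control.
Context {R : realType}.
Local Notation mu := (@lebesgue_measure R).
Implicit Types (f g h D Phi Psi : R -> R) (a b s t : R) (N : set R).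

(** Take an open set U of small measure that contains N: near each point of N the
    primitives of f and of f restricted to U have the same increments, and the total
    increase of the second one is small by absolute continuity of the integral. *)
Lemma null_control N f e : mu.-negligible N -> summable_fun f ->
  (forall x, 0 <= f x) -> 0 < e ->
  exists Psi, [/\ {homo Psi : s t / s <= t},
    forall s t, s <= t -> Psi t - Psi s <= e &
    forall x, N x -> \forall y \near x,
      (x <= y -> prim f y - prim f x <= Psi y - Psi x) /\
      (y <= x -> prim f x - prim f y <= Psi x - Psi y)].
Proof.
move=> [A [mA A0 NA]] sf f0 e0.
have [d [d0 Hd]] := integral_normr_continuous sf e0.
have [|U [oU AU UA]] := @lebesgue_regularity_outer R A d mA _ d0.
  by rewrite [ltLHS]A0.
have mU : measurable U by exact: open_measurable.
have muU : (mu U < d%:E)%E.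
  have -> : U = (U `\` A) `|` A by rewrite setUC setDUK.
  apply: le_lt_trans UA; apply: le_trans (measureU2 _ _ _) _ => //.
    exact: measurableD.
  by rewrite [X in (_ + X)%E]A0 adde0.
have sU : summable_fun (f \_ U).
  rewrite /summable_fun -restrict_EFin; apply/(@integrable_mkcond _ _ _ mu U (EFin \o f) mU).
  exact: summable_funS.
have fU0 x : 0 <= (f \_ U) x by rewrite patchE; case: ifP.
exists (prim (f \_ U)); split; first exact: prim_nd.
  move=> s t st; rewrite prim_sub// -Rintegral_mkcondr.
  apply: (@le_trans _ _ (\int[mu]_(x in U) `|f x|)); last exact/ltW/Hd.
  rewrite -lee_fin /Rintegral !fineK.
  - rewrite (_ : (fun x => (f x)%:E) = (fun x => (`|f x|%:E))); last first.
      by apply/funext => x; rewrite ger0_norm.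
    apply: ge0_subset_integral => //; first exact: measurableI.
    apply: (measurable_funS measurableT) => //.
    by have /integrable_norm/measurable_int := sf.
  - apply: integrable_fin_num => //.
    by apply: summable_funS => //; have := integrable_norm sf.
  - by apply: integrable_fin_num; [exact: measurableI|apply: summable_funS => //; exact: measurableI].
move=> x Nx.
have Ux : U x by apply/AU/NA.
have := oU; rewrite openE => /(_ _ Ux) [r /= r0 Hr].
have key s t : s <= t -> x - r < s -> t < x + r ->
  prim f t - prim f s <= prim (f \_ U) t - prim (f \_ U) s.
  move=> st xs tx; rewrite !prim_sub//.
  suff -> : \int[mu]_(z in `]s, t]) f z = \int[mu]_(z in `]s, t]) (f \_ U) z by [].
  apply: eq_Rintegral => z; rewrite inE/= in_itv/= => /andP[sz zt].
  by rewrite patchE ifT// inE; apply: Hr => /=; rewrite ltr_norml; apply/andP; split; lra.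
exists r => //= y /=; rewrite ltr_norml => /andP[H1 H2].
by split => xy; apply: key => //; lra.
Qed.

(** At good times the inequality may fail by e (s - t), at the bad times in N it may
    fail by an increment of a monotone function of total variation at most e; both errors
    are absorbed in the monotone function of [growth_right]. *)
Lemma ae_growth_right D Phi a b N : a <= b -> continuous D ->
  {homo Phi : s t / s <= t} ->
  (forall t, a <= t < b -> ~ N t -> forall e, 0 < e ->
     exists2 s, t < s <= b & D s - D t <= Phi s - Phi t + e * (s - t)) ->
  (forall e, 0 < e -> exists Psi, [/\ {homo Psi : s t / s <= t}, Psi b - Psi a <= e &
     forall t, a <= t < b -> N t ->
     exists2 s, t < s <= b & D s - D t <= Phi s - Phi t + (Psi s - Psi t)]) ->
  D b - D a <= Phi b - Phi a.
Proof.
move=> ab cD mPhi good bad; apply/ler_addgt0Pr => e e0.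
have e20 : 0 < e / 2 by lra.
have eb0 : 0 < e / 2 / (b - a + 1) by rewrite divr_gt0//; lra.
have [Psi [mPsi Psie Psib]] := bad _ e20.
pose k := e / 2 / (b - a + 1); rewrite -/k in eb0.
have kb : k * (b - a) <= e / 2.
  by rewrite /k mulrAC ler_pdivrMr; [apply: ler_wpM2l; lra|lra].
have mP : {homo (fun t => Phi t + Psi t + k * t) : s t / s <= t}.
  by move=> s t st; rewrite !lerD ?mPhi ?mPsi// ler_wpM2l// ltW.
have := growth_right ab cD mP => /(_ _)/wrap[].
  move=> t tab; have [Nt|Nt] := pselect (N t).
    have [s /andP[ts sb] H] := Psib t tab Nt; exists s; first by rewrite ts.
    by have : 0 <= k * (s - t) by [rewrite mulr_ge0//; lra]; lra.
  have [s /andP[ts sb] H] := good t tab Nt k eb0; exists s; first by rewrite ts.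
  by have := mPsi _ _ (ltW ts); lra.
lra.
Qed.

Lemma ae_growth_left D Phi a b N : a <= b -> continuous D ->
  {homo Phi : s t / s <= t} ->
  (forall t, a < t <= b -> ~ N t -> forall e, 0 < e ->
     exists2 s, a <= s < t & D t - D s <= Phi t - Phi s + e * (t - s)) ->
  (forall e, 0 < e -> exists Psi, [/\ {homo Psi : s t / s <= t}, Psi b - Psi a <= e &
     forall t, a < t <= b -> N t ->
     exists2 s, a <= s < t & D t - D s <= Phi t - Phi s + (Psi t - Psi s)]) ->
  D b - D a <= Phi b - Phi a.
Proof.
move=> ab cD mPhi good bad.
suff: - D (- - a) - - D (- - b) <= - Phi (- - a) - - Phi (- - b).
  by rewrite !opprK; lra.
apply: (@ae_growth_right (fun t => - D (- t)) (fun t => - Phi (- t)) _ _ [set t | N (- t)]).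
- lra.
- by move=> t; apply: cvgN; apply: continuous_comp; [exact: opp_continuous|exact: cD].
- by move=> s t st; rewrite lerN2; apply: mPhi; lra.
- move=> t /andP[bt ta] Nt e e0; have [||s /andP[as_ st] H] := good (- t) _ _ e e0.
  + by apply/andP; split; lra.
  + exact: Nt.
  exists (- s); first by apply/andP; split; lra.
  by rewrite !opprK; lra.
- move=> e /bad[Psi [mPsi Psie H]]; exists (fun t => - Psi (- t)); split.
  + by move=> s t st; rewrite lerN2; apply: mPsi; lra.
  + by rewrite !opprK; lra.
  + move=> t /andP[bt ta] Nt; have [||s /andP[as_ st] {}H] := H (- t).
    * by apply/andP; split; lra.
    * exact: Nt.
    exists (- s); first by apply/andP; split; lra.
    by rewrite !opprK; lra.
Qed.

End null_control.

(** * Lower limits of sequences *)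

Section liminf.
Context {R : realType}.
Implicit Types (u v : nat -> \bar R).
Local Open Scope ereal_scope.

Lemma limn_einfE u : limn_einf u = ereal_sup (range (einfs u)).
Proof. by rewrite limn_einf_lim; apply/cvg_lim => //; exact: cvg_einfs_sup. Qed.

Lemma limn_einf_gt u a : a < limn_einf u -> \forall n \near \oo, a < u n.
Proof.
rewrite limn_einfE => /ereal_sup_gt[_ [n _ <-]] an.
exists n => // k /= nk; apply: lt_le_trans an _.
by apply: ereal_inf_lbound; exists k.
Qed.

Lemma limn_einf_ge u a : (\forall n \near \oo, a <= u n) -> a <= limn_einf u.
Proof.
move=> [n _ Hn]; rewrite limn_einfE; apply: le_trans (ereal_sup_ubound _); last first.
  by exists n.
by apply: le_ereal_inf_tmp => _ [k /= nk <-]; exact: Hn.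
Qed.

Lemma limn_einf_le_freq u a :
  (forall n, exists2 k, (n <= k)%N & u k <= a) -> limn_einf u <= a.
Proof.
move=> H; rewrite leNgt; apply/negP => /limn_einf_gt[n _ Hn].
have [k nk] := H n.
by rewrite leNgt (Hn k nk).
Qed.

Lemma limn_einf_freq u a : limn_einf u < a ->
  forall n, exists2 k, (n <= k)%N & u k < a.
Proof.
move=> ua n; apply: contrapT => /forall2NP H.
move: ua; rewrite ltNge => /negP; apply; apply: limn_einf_ge.
by exists n => // k /= nk; have [//|/negP] := H k; rewrite -leNgt.
Qed.

Lemma measurable_fun_limn_einf d (T : measurableType d) (D : set T)
    (f : (T -> \bar R)^nat) : (forall n, measurable_fun D (f n)) ->
  measurable_fun D (fun x => limn_einf (f ^~ x)).
Proof.
move=> mf; apply: measurableT_comp => //.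
by apply: measurable_fun_limn_esup => n; apply: measurableT_comp.
Qed.

End liminf.

(** * Lower speeds of a curve *)

Section lower_speed.
Context {R : realType} {X : metricType R}.
Implicit Types (c : R -> X) (G g m : R -> R) (a b s t : R).

Lemma mdist_le_trans (z x y : X) r s : mdist x z <= r -> mdist z y <= s ->
  mdist x y <= r + s.
Proof. by move=> h1 h2; apply: le_trans (metric_triangle x z y) _; rewrite lerD. Qed.

Lemma mdist_lip (x y z : X) : `|mdist x z - mdist y z| <= mdist x y.
Proof.
have := metric_triangle x y z; have := metric_triangle y x z.
by rewrite (metric_sym y x) ler_norml => h1 h2; apply/andP; split; lra.
Qed.

Lemma mdist_lip2 (x y x' y' : X) :
  `|mdist x y - mdist x' y'| <= mdist x x' + mdist y y'.
Proof.
rewrite -[leLHS](_ : `|(mdist x y - mdist x' y) + (mdist y x' - mdist y' x')| = _).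
  by apply: le_trans (ler_normD _ _) _; rewrite lerD// mdist_lip.
by rewrite (metric_sym y x') (metric_sym y' x') addrA subrK.
Qed.

(** Absolute continuity in the form that composes best: the distance is bounded by the
    increments of one real function, in practice a primitive. *)
Definition dominated c G := forall s t, s <= t -> mdist (c s) (c t) <= G t - G s.

Lemma dom_cont c G : continuous G -> dominated c G -> continuous c.
Proof.
move=> cG dcG t; apply/metricType_numDomainType.cvgrPdist_lt => e e0.
have /cvgrPdist_lt/(_ _ e0) := cG t; apply: filterS => s.
have [/dcG ts|/ltW /dcG st] := leP t s.
  by rewrite distrC => /(le_lt_trans (ler_norm _)); apply: le_lt_trans.
by rewrite metric_sym => /(le_lt_trans (ler_norm _)); apply: le_lt_trans.
Qed.

Lemma mdist_cont c (z : X) : continuous c -> continuous (fun t => mdist z (c t)).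
Proof.
move=> cc t; apply/cvgrPdist_lt => e e0.
have /metricType_numDomainType.cvgrPdist_lt/(_ _ e0) := cc t.
apply: filterS => s; apply: le_lt_trans.
by rewrite !(metric_sym z) mdist_lip.
Qed.

(** Difference quotients with steps 1 / (n + 1), to the right for sg = 1 and to the left
    for sg = -1.  Discrete steps make the lower limit [lowspeed] measurable. *)
Definition dquot c (sg : R) n t : R :=
  n.+1%:R * mdist (c t) (c (t + sg * n.+1%:R^-1)).

Definition lowspeed c sg t : \bar R := limn_einf (fun n => (dquot c sg n t)%:E).

Lemma dquot_ge0 c sg n t : 0 <= dquot c sg n t.
Proof. by rewrite mulr_ge0 ?mdist_ge0. Qed.

Lemma lowspeed_ge0 c sg t : (0 <= lowspeed c sg t)%E.
Proof. by apply: limn_einf_ge; apply: nearW => n; rewrite lee_fin dquot_ge0. Qed.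

Lemma mdist2_cont c b : continuous c -> continuous (fun t => mdist (c t) (c (t + b))).
Proof.
move=> cc t; apply/cvgrPdist_lt => e e0.
have e20 : 0 < e / 2 by lra.
have /metricType_numDomainType.cvgrPdist_lt/(_ _ e20) H1 := cc t.
have cc' : continuous (fun t => c (t + b)).
  move=> s; apply: (@continuous_comp _ _ _ (fun t => t + b) c); last exact: cc.
  by apply: cvgD; [exact: cvg_id|exact: cvg_cst].
have /metricType_numDomainType.cvgrPdist_lt/(_ _ e20) H2 := cc' t.
near=> s.
have h1 : mdist (c t) (c s) < e / 2 by near: s.
have h2 : mdist (c (t + b)) (c (s + b)) < e / 2 by near: s.
apply: le_lt_trans (mdist_lip2 _ _ _ _) _; lra.
Unshelve. all: by end_near. Qed.

Lemma measurable_lowspeed c sg : continuous c -> measurable_fun setT (lowspeed c sg).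
Proof.
move=> cc; apply: measurable_fun_limn_einf => n; apply/measurable_EFinP.
apply: measurable_funM => //; apply: continuous_measurable_fun.
exact: mdist2_cont.
Qed.

Lemma sign_cases (sg : R) : `|sg| = 1 -> sg = 1 \/ sg = -1.
Proof.
have [h|h] := leP 0 sg; first by rewrite ger0_norm//; left.
by rewrite ltr0_norm// => h1; right; lra.
Qed.

Lemma near_step (sg t : R) (P : R -> Prop) : `|sg| = 1 ->
  (\forall s \near t, P s) -> \forall n \near \oo, P (t + sg * n.+1%:R^-1).
Proof.
move=> sg1 [d /= d0 Hd].
have := near_infty_natSinv_lt (PosNum d0); apply: filterS => n /= nd.
by apply: Hd; rewrite /= opprD addNKr normrN normrM sg1 mul1r ger0_norm.
Qed.

Lemma lowspeed_seq c sg t l (P : R -> Prop) e : `|sg| = 1 ->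
  (lowspeed c sg t <= l%:E)%E -> 0 < e -> (\forall s \near t, P s) ->
  exists s, [/\ P s, 0 < sg * (s - t) & mdist (c t) (c s) <= (l + e) * `|s - t|].
Proof.
move=> sg1 lt e0 /(near_step sg1)[n _ Hn].
have [|k nk] := @limn_einf_freq _ (fun n => (dquot c sg n t)%:E) (l + e)%:E _ n.
  by apply: le_lt_trans lt _; rewrite lte_fin ltrDl.
rewrite lte_fin /dquot => H.
exists (t + sg * k.+1%:R^-1).
rewrite addrAC subrr add0r normrM sg1 mul1r ger0_norm// mulrA.
have -> : sg * sg = 1 by case: (sign_cases sg1) => ->; lra.
rewrite mul1r invr_gt0 ltr0n; split => //; first exact: Hn.
by rewrite ler_pdivlMr// mulrC ltW.
Qed.

Lemma lowspeed_le c sg G t l : `|sg| = 1 -> {homo G : s t / s <= t} ->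
  dominated c G -> expands G t l -> (lowspeed c sg t <= l%:E)%E.
Proof.
move=> sg1 mG dcG eG; apply/lee_addgt0Pr => e e0.
have [n _ Hn] := near_step sg1 (eG _ e0).
apply: limn_einf_le_freq => k; exists (maxn k n); first exact: leq_maxl.
have := Hn _ (leq_maxr k n); move: (maxn k n) => p /=.
have -> : t + sg * p.+1%:R^-1 - t = sg * p.+1%:R^-1 by ring.
rewrite lee_fin /dquot normrM sg1 mul1r ger0_norm// => H.
rewrite -ler_pdivlMl// [leRHS]mulrC.
set q := p.+1%:R^-1 in H *.
have q0 : 0 < q by rewrite invr_gt0.
move: H; rewrite ler_norml => /andP[h1 h2].
case: (sign_cases sg1) h1 h2 => -> h1 h2.
- apply: le_trans (dcG _ _ _) _; lra.
- rewrite metric_sym; apply: le_trans (dcG _ _ _) _; lra.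
Qed.

End lower_speed.

(** * Existence of the metric derivative *)

Section metric_derivative.
Context {R : realType} {X : metricType R}.
Local Notation mu := (@lebesgue_measure R).
Implicit Types (c : R -> X) (G g m : R -> R) (a b s t : R) (N : set R).

(** The only consequence of absolute continuity that the growth argument requires at
    exceptional times.  It also follows from an energy bound, before the absolute continuity
    of the curve is known; see [energy_null_controlled]. *)
Definition null_controlled c a b := forall N e, mu.-negligible N -> 0 < e ->
  exists Psi : R -> R, [/\ {homo Psi : s t / s <= t}, Psi b - Psi a <= e &
    forall x, N x -> a <= x <= b -> \forall y \near x, a <= y <= b ->
      mdist (c x) (c y) <= `|Psi y - Psi x|].

Lemma dom_null_controlled c g a b : a <= b -> summable_fun g -> (forall x, 0 <= g x) ->
  dominated c (prim g) -> null_controlled c a b.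
Proof.
move=> ab sg g0 dcg N e nN e0.
have [Psi [mPsi Psie PsiN]] := null_control nN sg g0 e0.
exists Psi; split => //; first exact: Psie.
move=> x Nx _; apply: filterS (PsiN x Nx) => y [h1 h2] _.
have [xy|/ltW yx] := leP x y.
  by rewrite ger0_norm ?subr_ge0 ?mPsi//; apply: le_trans (h1 xy); exact: dcg.
rewrite metric_sym distrC ger0_norm ?subr_ge0 ?mPsi//.
by apply: le_trans (h2 yx); exact: dcg.
Qed.

(** Used to reach explicit points that depend on the radius, which the filter
    notation hides. *)
Lemma near_ball (P : R -> Prop) t : (\forall s \near t, P s) ->
  exists2 d : R, 0 < d & forall s, `|s - t| < d -> P s.
Proof. by move=> [d /= d0 H]; exists d => // s; rewrite distrC; exact: H. Qed.

(** The lower limit of the quotients suffices, since [ae_growth_right] asks for a single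
    nearby point at each time. *)
Lemma lowspeed_dom c m sg a b N : `|sg| = 1 -> a <= b ->
  continuous c -> null_controlled c a b -> summable_fun m -> (forall x, 0 <= m x) ->
  mu.-negligible N ->
  (forall t, a <= t <= b -> ~ N t -> (lowspeed c sg t <= (m t)%:E)%E) ->
  mdist (c a) (c b) <= prim m b - prim m a.
Proof.
move=> sg1 ab cc NC sm m0 nN lm.
have [M [mM M0 NM]] : mu.-negligible (N `|` ~` [set t | expands (prim m) t (m t)]).
  by have := negligibleU nN (prim_expands sm).
have nM : mu.-negligible M by exists M; split.
have mP := prim_nd sm m0.
have cD : continuous (fun s => mdist (c a) (c s)) by exact: mdist_cont.
(* The discrete step realizing the lower speed is turned into an increment of the primitive of m. *)
have core t e (P : R -> Prop) : a <= t <= b -> ~ M t -> 0 < e -> (\forall s \near t, P s) ->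
   exists s, [/\ P s, 0 < sg * (s - t) &
   mdist (c t) (c s) <= `|prim m s - prim m t| + e * `|s - t|].
  move=> tab Mt e0 Pt; have e20 : 0 < e / 2 by lra.
  have Nt : ~ N t by move=> Nt; apply: Mt; apply: NM; left.
  have Et : expands (prim m) t (m t).
    by apply: contrapT => Et; apply: Mt; apply: NM; right.
  have [s [[Ps Es] ts ds]] := lowspeed_seq sg1 (lm t tab Nt) e20
    (filterI Pt (Et _ e20)).
  exists s; split => //; apply: le_trans ds _.
  have := ler_normB (m t * (s - t)) (- (prim m s - prim m t - m t * (s - t))).
  rewrite opprK subrKC normrM (ger0_norm (m0 t)); have := normr_ge0 (s - t); move: Es.
  set A := `|s - t|; set B := `|_ - _ - _|; set C := `|_ - _| => h1 h2 h3.
  have := ler_normB (prim m s - prim m t) (prim m s - prim m t - m t * (s - t)).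
  rewrite opprB subrKC normrM (ger0_norm (m0 t)) -/A -/B -/C => h4.
  by rewrite mulrDl; lra.
rewrite -[leLHS]subr0 -(mdistxx (c a)).
have tri (u v : X) := metric_triangle (c a) u v.
case: (sign_cases sg1) => sgE.
- apply: (@ae_growth_right _ (fun s => mdist (c a) (c s)) (prim m) a b M ab cD mP).
  + move=> t /andP[at_ tb] Mt e e0.
    have [||s [sb]] := @core t e (fun s => s < b) _ Mt e0 _.
    * by rewrite at_ ltW.
    * exact: lt_nbhsl.
    rewrite sgE mul1r => ts H; exists s; first by rewrite -subr_gt0 ts ltW.
    have := tri (c t) (c s).
    move: H; rewrite !ger0_norm ?subr_ge0 ?mP//; lra.
  + move=> e e0; have [Psi [mPsi Psie PsiM]] := NC M e nM e0.
    exists Psi; split => // t /andP[at_ tb] Mt.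
    have [|d d0 Hd] := near_ball (PsiM t Mt _); first by rewrite at_ ltW.
    pose s := Num.min b (t + d / 2).
    have ts : t < s by rewrite lt_min tb /=; lra.
    have sb : s <= b by rewrite ge_min lexx.
    have sd : s <= t + d / 2 by rewrite ge_min lexx orbT.
    exists s; first by rewrite ts.
    have : mdist (c t) (c s) <= `|Psi s - Psi t|.
      apply: Hd; last by apply/andP; split; lra.
      by rewrite ger0_norm; lra.
    rewrite ger0_norm ?subr_ge0 ?mPsi// ?(ltW ts)// => H.
    have := tri (c t) (c s); have := mP _ _ (ltW ts); lra.
- apply: (@ae_growth_left _ (fun s => mdist (c a) (c s)) (prim m) a b M ab cD mP).
  + move=> t /andP[at_ tb] Mt e e0.
    have [||s [sb]] := @core t e (fun s => a < s) _ Mt e0 _.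
    * by rewrite tb ltW.
    * exact: lt_nbhsr.
    rewrite sgE mulN1r oppr_gt0 => ts H; exists s; first by rewrite (ltW sb) -subr_lt0.
    have := tri (c s) (c t).
    move: H; rewrite (metric_sym (c t)) [`|prim _ _ - _|]distrC [`|s - t|]distrC.
    by rewrite !ger0_norm ?subr_ge0 ?mP//; lra.
  + move=> e e0; have [Psi [mPsi Psie PsiM]] := NC M e nM e0.
    exists Psi; split => // t /andP[at_ tb] Mt.
    have [|d d0 Hd] := near_ball (PsiM t Mt _); first by rewrite tb ltW.
    pose s := Num.max a (t - d / 2).
    have ts : s < t by rewrite gt_max at_ /=; lra.
    have sb : a <= s by rewrite le_max lexx.
    have sd : t - d / 2 <= s by rewrite le_max lexx orbT.
    exists s; first by rewrite sb.
    have : mdist (c t) (c s) <= `|Psi s - Psi t|.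
      apply: Hd; last by apply/andP; split; lra.
      by rewrite distrC ger0_norm; lra.
    rewrite distrC ger0_norm ?subr_ge0 ?mPsi// ?(ltW ts)// => H.
    have := tri (c s) (c t); rewrite (metric_sym (c s)); have := mP _ _ (ltW ts); lra.
Qed.

(** The lower speed controls the curve from below only along the steps
    1 / (n + 1); the upper bound by G holds at all scales.  A point s at distance h is
    compared with the smallest step k = 1 / (p + 1) that is at least h: G bounds the distance
    from c s to the point at step k by about l (k - h), so the triangle inequality turns the
    lower bound l k at step k into the lower bound l h at s. *)
Lemma one_sided_speed c G sg t l e : `|sg| = 1 -> 0 < e -> 0 <= l ->
  {homo G : s t / s <= t} -> dominated c G -> expands G t l ->
  lowspeed c sg t = l%:E ->
  \forall s \near t, 0 <= sg * (s - t) ->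
    `|mdist (c t) (c s) - l * `|s - t| | <= e * `|s - t|.
Proof.
move=> sg1 e0 l0 mG dcG eG lE.
have e50 : 0 < e / 5 by lra.
have [d d0 Hd] := near_ball (eG _ e50).
have [n0 _ Hn] : \forall n \near \oo, ((l - e / 5)%:E < (dquot c sg n t)%:E)%E.
  by apply: limn_einf_gt; rewrite -/(lowspeed c sg t) lE lte_fin; lra.
have dG s u : mdist (c s) (c u) <= `|G u - G s|.
  have [su|/ltW us] := leP s u; first by rewrite ger0_norm ?subr_ge0 ?mG//; exact: dcG.
  by rewrite metric_sym distrC ger0_norm ?subr_ge0 ?mG//; exact: dcG.
have q0 : 0 < n0.+1%:R^-1 :> R by rewrite invr_gt0.
have d20 : 0 < d / 2 by lra.
near=> s => sts.
have [->|st] := eqVneq s t; first by rewrite mdistxx subrr normr0 !mulr0 subrr normr0.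
set h := `|s - t|.
have h0 : 0 < h by rewrite normr_gt0 subr_eq0.
have sE : s = t + sg * h.
  have -> : h = sg * (s - t).
    by rewrite -[RHS]ger0_norm// normrM sg1 mul1r.
  by rewrite mulrA; case: (sign_cases sg1) => ->; lra.
have hd : h < d / 2.
  by rewrite /h distrC; near: s; exists (d / 2).
have hn : h < n0.+1%:R^-1.
  by rewrite /h distrC; near: s; exists n0.+1%:R^-1.
have sgh r : 0 <= r -> `|sg * r| = r by move=> r0; rewrite normrM sg1 mul1r ger0_norm.
have Gs : `|G s - G t - l * (sg * h)| <= e / 5 * h.
  have := Hd s; rewrite -/h => /(_ _); rewrite sE [t + _ - t]addrC addKr => H.
  by apply: H; lra.
have Gs' : `|G s - G t| <= l * h + e / 5 * h.
  have := ler_normD (G s - G t - l * (sg * h)) (l * (sg * h)); rewrite subrK.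
  by rewrite [`|l * _|]normrM sgh ?(ltW h0)// (ger0_norm l0); lra.
have := dG t s; set A := mdist _ _ => As.
pose N := Num.truncn h^-1.
have hV0 : 0 <= h^-1 by rewrite invr_ge0 ltW.
have /andP[N1 N2] : N%:R <= h^-1 < N.+1%:R by exact: truncn_itv.
have Nn : (n0 < N)%N.
  rewrite truncn_ge_nat// -(invrK n0.+1%:R) lef_pV2 ?posrE//; exact: ltW.
have [p pn pE] : exists2 p, (n0 <= p)%N & N = p.+1 by case: (N) Nn => // p pn; exists p.
rewrite pE in N1 N2.
pose a : R := p.+1%:R; pose k := a^-1.
have a1 : 1 <= a by rewrite ler1n.
have ah : a * h <= 1 by rewrite -ler_pdivlMr// mul1r.
have ah2 : 1 < (a + 1) * h.
  by rewrite -ltr_pdivrMr// mul1r; move: N2; rewrite -natr1.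
have a0 : 0 < a by exact: lt_le_trans ltr01 a1.
have k0 : 0 < k by rewrite /k invr_gt0.
have ak : a * k = 1 by rewrite mulfV// gt_eqF.
have hk : h <= k by rewrite -[k]mul1r ler_pdivlMr// mulrC.
have k2h : k <= 2 * h.
  rewrite -[k]mul1r ler_pdivrMr//.
  by have : h <= a * h by [rewrite ler_peMl// ltW|]; lra.
have Gk : `|G (t + sg * k) - G t - l * (sg * k)| <= e / 5 * k.
  have := Hd (t + sg * k); rewrite [t + _ - t]addrC addKr sgh ?(ltW k0)// => H.
  by apply: H; lra.
have Gsk : `|G (t + sg * k) - G s| <= l * (k - h) + e / 5 * (k + h).
  have -> : G (t + sg * k) - G s = (G (t + sg * k) - G t - l * (sg * k))
     - (G s - G t - l * (sg * h)) + l * (sg * (k - h)) by ring.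
  apply: le_trans (ler_normD _ _) _; apply: le_trans (lerD (ler_normB _ _) (lexx _)) _.
  by rewrite [`|l * _|]normrM sgh ?subr_ge0// (ger0_norm l0); lra.
have := Hn p pn; rewrite lte_fin /dquot -/a -/k => Dk.
have {}Dk : (l - e / 5) * k <= mdist (c t) (c (t + sg * k)).
  by rewrite ler_pdivrMr// [leRHS]mulrC ltW.
have := metric_triangle (c t) (c s) (c (t + sg * k)).
have := dG s (t + sg * k).
rewrite -/A => B1 B2.
have : e / 5 * k <= e / 5 * (2 * h) by rewrite ler_pM2l.
rewrite ler_norml => B3; apply/andP; split; lra.
Unshelve. all: by end_near. Qed.

(** Both lower speeds, truncated by the given density g, dominate c; each is
    therefore an upper bound for the other at almost every time.  Once the two agree,
    [one_sided_speed] gives a full derivative. *)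
Theorem ac_metric_derivative c g : summable_fun g -> (forall x, 0 <= g x) ->
  dominated c (prim g) ->
  exists m, [/\ summable_fun m, (forall x, 0 <= m x), dominated c (prim m) &
    {ae mu, forall t, forall e, 0 < e -> \forall s \near t,
       `|mdist (c t) (c s) - m t * `|s - t| | <= e * `|s - t|}].
Proof.
move=> sg g0 dcg.
have cc : continuous c by apply: dom_cont dcg; exact: prim_cont.
pose mm sg t := fine (Order.min (lowspeed c sg t) (g t)%:E).
have mmg sg' t : 0 <= mm sg' t <= g t.
  rewrite /mm; case E : (lowspeed c sg' t) => [r| |].
  - have := lowspeed_ge0 c sg' t; rewrite E lee_fin => r0.
    by rewrite -EFin_min /= le_min r0 g0 ge_min lexx orbT.
  - by rewrite min_r ?leey//= g0 lexx.
  - by have := lowspeed_ge0 c sg' t; rewrite E.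
have mm0 sg' t : 0 <= mm sg' t by have /andP[] := mmg sg' t.
have smm sg' : summable_fun (mm sg').
  apply: (@le_integrable _ _ _ mu setT measurableT _ (EFin \o g)) => //.
    apply/measurable_EFinP; apply: measurableT_comp => //.
    apply: measurable_mine; first exact: measurable_lowspeed.
    exact: measurable_int sg.
  move=> x _ /=; rewrite lee_fin !ger0_norm ?g0//.
  by have /andP[] := mmg sg' x.
have E1 : `|1 : R| = 1 by rewrite normr1.
have E2 : `|-1 : R| = 1 by rewrite normrN1.
have [N [mN N0 HN]] := prim_expands sg.
have nN : mu.-negligible N by exists N; split.
have lg sg' t : `|sg'| = 1 -> ~ N t -> (lowspeed c sg' t = (mm sg' t)%:E).
  move=> s1 Nt; have Et : expands (prim g) t (g t) by apply: contrapT => h; apply/Nt/HN.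
  have := lowspeed_le s1 (prim_nd sg g0) dcg Et => H.
  rewrite /mm min_l// fineK// ge0_fin_numE ?lowspeed_ge0//.
  by apply: le_lt_trans H _; rewrite ltry.
have dm sg' : `|sg'| = 1 -> dominated c (prim (mm sg')).
  move=> s1 s t st; apply: (lowspeed_dom s1 st cc _ _ _ nN) => //.
    exact: dom_null_controlled dcg.
  by move=> r _ Nr; rewrite lg.
exists (mm 1); split => //; first exact: dm.
have aeN : {ae mu, forall t, ~ N t}.
  by exists N; split => // t /=; rewrite not_notE.
move: aeN (prim_expands (smm 1)) (prim_expands (smm (-1))).
apply: filterS3; first exact: (ae_filter_ringOfSetsType mu).
move=> t /= Nt Ep Em.
have mE : mm 1 t = mm (-1) t.
  apply/eqP; rewrite eq_le -!lee_fin; apply/andP; split.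
    rewrite -[in leLHS]lg//.
    exact: lowspeed_le E1 (prim_nd (smm _) (mm0 _)) (dm _ E2) Em.
  rewrite -[in leLHS]lg//.
  exact: lowspeed_le E2 (prim_nd (smm _) (mm0 _)) (dm _ E1) Ep.
have l0 : 0 <= mm 1 t by [].
move=> e e0.
have nearp : \forall s \near t, 0 <= 1 * (s - t) ->
    `|mdist (c t) (c s) - mm 1 t * `|s - t| | <= e * `|s - t|.
  exact: (one_sided_speed E1 e0 l0 (prim_nd (smm 1) (mm0 1)) (dm 1 E1) Ep (lg 1 t E1 Nt)).
have nearm : \forall s \near t, 0 <= -1 * (s - t) ->
    `|mdist (c t) (c s) - mm 1 t * `|s - t| | <= e * `|s - t|.
  rewrite mE.
  exact: (one_sided_speed E2 e0 (mm0 _ _) (prim_nd (smm (-1)) (mm0 (-1))) (dm (-1) E2)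
    Em (lg (-1) t E2 Nt)).
near=> s.
have [ts|/ltW st] := leP t s.
  have : 0 <= 1 * (s - t) by lra.
  by near: s.
have : 0 <= -1 * (s - t) by lra.
by near: s.
Unshelve. all: by end_near. Qed.

End metric_derivative.

(** * Energy bounds for curves on the unit interval *)

Section energy_density.
Context {R : realType} {X : metricType R}.
Local Notation mu := (@lebesgue_measure R).
Implicit Types (c : R -> X) (Phi m w : R -> R) (a b s t : R) (N : set R).

Definition clampI (a b t : R) : R := Num.max a (Num.min b t).

Lemma clampI_in a b t : a <= b -> a <= clampI a b t <= b.
Proof. by move=> ab; rewrite /clampI le_max lexx ge_max ab ge_min lexx. Qed.

Lemma clampI_id a b t : a <= t <= b -> clampI a b t = t.
Proof. by move=> /andP[t0 t1]; rewrite /clampI min_r// max_r. Qed.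

Lemma clampI_cases a b t : a <= b -> [\/ t < a /\ clampI a b t = a,
  a <= t <= b /\ clampI a b t = t | b < t /\ clampI a b t = b].
Proof.
move=> ab; have [t0|t0] := ltP t a.
  by apply: Or31; split => //; rewrite /clampI min_r ?max_l//; lra.
have [t1|t1] := leP t b.
  have t01 : a <= t <= b by rewrite t1 t0.
  by apply: Or32; split; [rewrite andbT|exact: clampI_id].
by apply: Or33; split; [lra|rewrite /clampI min_l ?max_r//; lra].
Qed.

Lemma clampI_nd a b : a <= b -> {homo clampI a b : s t / s <= t}.
Proof.
move=> ab s t st; case: (clampI_cases s ab) => -[hs ->]; case: (clampI_cases t ab) => -[ht ->]; lra.
Qed.

Lemma clampI_lip a b s t : a <= b -> s <= t -> clampI a b t - clampI a b s <= t - s.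
Proof.
move=> ab st; case: (clampI_cases s ab) => -[hs ->]; case: (clampI_cases t ab) => -[ht ->]; lra.
Qed.

Lemma nd_clampI a b (G : R -> R) s t : a <= b -> {homo G : s t / s <= t} -> s <= t ->
  G (clampI a b t) - G (clampI a b s) <= G t - G s.
Proof.
move=> ab nd st.
case: (clampI_cases s ab) => -[hs ->]; case: (clampI_cases t ab) => -[ht ->]; try lra.
- by have := nd _ _ st; lra.
- by have := nd s a; lra.
- by have := nd s a; have := nd b t; lra.
- by have := nd b t; lra.
- by have := nd _ _ st; lra.
Qed.

Definition clamp : R -> R := clampI 0 1.

Lemma clamp_in t : 0 <= clamp t <= 1.
Proof. exact: clampI_in. Qed.

Lemma clamp_id t : 0 <= t <= 1 -> clamp t = t.
Proof. exact: clampI_id. Qed.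

Lemma clamp_nd : {homo clamp : s t / s <= t}.
Proof. exact: clampI_nd ler01. Qed.

Lemma clamp_lip s t : s <= t -> clamp t - clamp s <= t - s.
Proof. exact: clampI_lip. Qed.

Lemma nd_clamp (G : R -> R) s t : {homo G : s t / s <= t} -> s <= t ->
  G (clamp t) - G (clamp s) <= G t - G s.
Proof. exact: nd_clampI. Qed.

(** By the Cauchy-Schwarz inequality a primitive of the squared metric speed is such a
    function Phi. *)
Definition energy_on (a b : R) c Phi := forall s t, a <= s -> s <= t -> t <= b ->
  mdist (c s) (c t) ^+ 2 <= (t - s) * (Phi t - Phi s).

Lemma energy_on_nd a b c Phi s t : energy_on a b c Phi -> a <= s -> s <= t -> t <= b ->
  Phi s <= Phi t.
Proof.
move=> eb s0 st t1; have [->//|nst] := eqVneq s t.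
have {}st : s < t by rewrite lt_neqAle nst.
have := le_trans (sqr_ge0 _) (eb _ _ s0 (ltW st) t1).
by rewrite pmulr_rge0 ?subr_ge0// subr_gt0.
Qed.

Lemma energy_on_clamp c Phi : energy_on 0 1 c Phi ->
  {homo Phi \o clamp : s t / s <= t} /\
  forall s t, s <= t -> mdist (c (clamp s)) (c (clamp t)) ^+ 2 <=
    (t - s) * (Phi (clamp t) - Phi (clamp s)).
Proof.
move=> eb.
have nd : {homo Phi \o clamp : s t / s <= t}.
  move=> s t st; have /andP[s0 _] := clamp_in s; have /andP[_ t1] := clamp_in t.
  by apply: (energy_on_nd eb) => //; exact: clamp_nd.
split => // s t st; have /andP[s0 _] := clamp_in s; have /andP[_ t1] := clamp_in t.
apply: le_trans (eb _ _ s0 (clamp_nd st) t1) _.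
by apply: ler_wpM2r; [rewrite subr_ge0; exact: nd | exact: clamp_lip].
Qed.

(** Linearizes products; a suitable h recovers the product exactly. *)
Lemma young_sqr (d u v h : R) : 0 <= u -> 0 <= v -> 0 < h ->
  d ^+ 2 <= u * v -> d <= (h * v + u / h) / 2.
Proof.
move=> u0 v0 h0 duv; apply: le_trans (ler_norm _) _.
have uh : 0 <= u / h by rewrite divr_ge0// ltW.
have hv : 0 <= h * v by rewrite mulr_ge0// ltW.
rewrite -ler_sqr ?nnegrE//; last lra.
rewrite real_normK ?num_real//; apply: le_trans duv _.
have -> : u * v = (h * v) * (u / h) by field; rewrite gt_eqF.
by have := sqr_ge0 (h * v - u / h); rewrite !expr2; lra.
Qed.

(** Indicator of [a, b].  Its primitive is t up to a constant on [a, b], yet it is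
    integrable on the whole line. *)
Definition indI (a b : R) : R -> R := \1_(`[a, b]%classic : set R).

Lemma indIE a b t : indI a b t = ((a <= t <= b)%R : bool)%:R.
Proof. by rewrite /indI indicE mem_setE in_itv/=. Qed.

Lemma summable_indI a b : summable_fun (indI a b).
Proof. exact: integrable_indic_itv. Qed.

Lemma indI_ge0 a b t : 0 <= indI a b t.
Proof. by rewrite indIE. Qed.

Lemma prim_indI a b s t : a <= s -> s <= t -> t <= b ->
  prim (indI a b) t - prim (indI a b) s = t - s.
Proof.
move=> s0 st t1; apply: EFin_inj; rewrite prim_subE//; last exact: summable_indI.
rewrite (eq_integral (cst 1%:E)); last first.
  move=> x; rewrite inE/= in_itv/= => /andP[sx xt].
  by rewrite indIE (le_trans s0 sx) (le_trans xt t1).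
rewrite integral_cst// mul1e /= lebesgue_measure_itv/= lte_fin.
by case: ltP => [_|ts]; [rewrite EFinB|have -> : t = s; [lra|rewrite subrr]].
Qed.

Lemma summable_restrict (f : R -> R) (D : set R) : measurable D ->
  mu.-integrable D (EFin \o f) -> summable_fun (f \_ D).
Proof.
by move=> mD fD; rewrite /summable_fun -restrict_EFin; apply/(@integrable_mkcond _ _ _ mu _ _ mD).
Qed.

(** Adding the indicator of [a, b] to the density makes its primitive grow at least as
    fast as t, so that one null-set estimate covers c and smooth functions of time
    together. *)
Lemma ac_on_domI c a b : a <= b -> ac_on a b c -> exists g,
  [/\ summable_fun g, (forall x, 0 <= g x), dominated (c \o clampI a b) (prim g) &
   forall s t, a <= s -> s <= t -> t <= b -> t - s <= prim g t - prim g s].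
Proof.
move=> ab [g ig dg].
pose g' := (fun x => `|g x|) \_ (`[a, b]%classic : set R).
have sg : summable_fun g' by apply: summable_restrict => //; exact: integrable_norm ig.
have g0 x : 0 <= g' x by rewrite /g' patchE; case: ifP => //=.
pose G x := 1 * g' x + 1 * indI a b x.
have sG : summable_fun G by apply: summable_lin => //; exact: summable_indI.
have GE t : prim G t = prim g' t + prim (indI a b) t.
  by rewrite prim_lin ?mul1r//; exact: summable_indI.
have ndg := prim_nd sg g0; have ndi := prim_nd (@summable_indI a b) (@indI_ge0 a b).
exists G; split => //.
- by move=> x; rewrite /G !mul1r addr_ge0 ?indI_ge0.
- move=> s t st.
  have /andP[s0 _] := clampI_in s ab; have /andP[_ t1] := clampI_in t ab.
  have -> : prim G t - prim G s = prim g' t - prim g' s +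
    (prim (indI a b) t - prim (indI a b) s) by rewrite !GE; ring.
  apply: ler_wpDr; first by rewrite subr_ge0 ndi.
  apply: le_trans (nd_clampI ab ndg st).
  have cst := clampI_nd ab st.
  rewrite -lee_fin; apply: le_trans (dg _ _ s0 cst t1) _.
  rewrite prim_subE//.
  have sub : `[clampI a b s, clampI a b t]%classic `<=` (`[a, b]%classic : set R).
    by move=> x /=; rewrite !in_itv/= => /andP[h1 h2]; apply/andP; split; lra.
  apply: le_integral => //.
  + exact: integrableS ig.
  + exact: summable_funS.
  move=> x /set_mem xst; rewrite lee_fin /g' patchE ifT ?mem_set//; last exact: sub.
  exact: ler_norm.
move=> s t as_ st tb; have := prim_indI as_ st tb; have := ndg _ _ st; rewrite !GE; lra.
Qed.

Lemma dom_ac_onI c a b w : summable_fun w -> dominated (c \o clampI a b) (prim w) -> ac_on a b c.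
Proof.
move=> sw dw; exists w; first exact: summable_funS.
move=> s t s0 st t1; rewrite -prim_subE// lee_fin.
by have := dw _ _ st; rewrite /= !clampI_id//; apply/andP; split; lra.
Qed.

(** By Young's inequality the distance is at most (h dPhi + dt / h) / 2.  The first
    term is small for small h, and near a null set dt can be replaced by the increments of
    a function of total variation h e. *)
Lemma energy_null_controlled c Phi a b : energy_on 0 1 c Phi -> 0 <= a -> a <= b -> b <= 1 ->
  null_controlled (c \o clamp) a b.
Proof.
move=> eb a0 ab b1 N e nN e0.
have [nd cE] := energy_on_clamp eb.
pose K := Phi 1 - Phi 0.
have K0 : 0 <= K by rewrite subr_ge0; exact: (energy_on_nd eb).
pose h := e / (K + 1).
have h0 : 0 < h by rewrite divr_gt0//; lra.
have hK : h * K <= e.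
  by rewrite /h mulrAC ler_pdivrMr; [apply: ler_wpM2l; lra|lra].
have he0 : 0 < h * e by rewrite mulr_gt0.
have [Psi [mPsi Psie PsiN]] := null_control nN (@summable_indI 0 1) (@indI_ge0 0 1) he0.
exists (fun t => (h * Phi (clamp t) + Psi t / h) / 2); split.
- move=> s t st; rewrite ler_pM2r ?invr_gt0// lerD// ?ler_pM2l ?ler_pM2r ?invr_gt0//.
    exact: nd.
  exact: mPsi.
- have h1 : (Psi b - Psi a) / h <= e by rewrite ler_pdivrMr// mulrC; exact: Psie.
  have h2 : h * (Phi (clamp b) - Phi (clamp a)) <= h * K.
    rewrite ler_pM2l//; apply: lerB.
      have /andP[h2 h3] := clamp_in b; exact: (energy_on_nd eb).
    have /andP[h2 h3] := clamp_in a; exact: (energy_on_nd eb).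
  by rewrite mulrBl in h1; lra.
move=> x Nx /andP[ax xb]; apply: filterS (PsiN x Nx) => y [H1 H2] /andP[ay yb].
have core s t : 0 <= s -> s <= t -> t <= 1 ->
    prim (indI 0 1) t - prim (indI 0 1) s <= Psi t - Psi s ->
    mdist (c (clamp s)) (c (clamp t)) <= `|(h * Phi (clamp t) + Psi t / h) / 2 -
      (h * Phi (clamp s) + Psi s / h) / 2|.
  move=> s0 st t1; rewrite prim_indI// => H.
  apply: le_trans (ler_norm _).
  have u0 : 0 <= t - s by rewrite subr_ge0.
  have v0 : 0 <= Phi (clamp t) - Phi (clamp s) by rewrite subr_ge0; exact: nd.
  apply: le_trans (young_sqr u0 v0 h0 (cE _ _ st)) _.
  have : (t - s) / h <= (Psi t - Psi s) / h by rewrite ler_pM2r ?invr_gt0.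
  by rewrite [_ / h in X in _ <= X]mulrBl; lra.
have [xy|/ltW yx] := leP x y.
  by apply: core; [lra|lra|lra|exact: H1].
rewrite /= metric_sym distrC.
by apply: core; [lra|lra|lra|exact: H2].
Qed.

End energy_density.

Section energy_density_thm.
Context {R : realType} {X : metricType R}.
Local Notation mu := (@lebesgue_measure R).
Implicit Types (c : R -> X) (Phi m w : R -> R) (a b s t : R) (N : set R).

Definition trunc_speed c (n : nat) t : R :=
  fine (Order.min (lowspeed c 1 t) n%:R%:E).

Lemma trunc_speed_bound c n t : 0 <= trunc_speed c n t <= n%:R.
Proof.
rewrite /trunc_speed; case E : (lowspeed c 1 t) => [r| |].
- have := lowspeed_ge0 c 1 t; rewrite E lee_fin => r0.
  by rewrite -EFin_min /= le_min r0 ler0n ge_min lexx orbT.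
- by rewrite min_r ?leey//= lexx ler0n.
- by have := lowspeed_ge0 c 1 t; rewrite E.
Qed.

Lemma trunc_speed_le c n t : ((trunc_speed c n t)%:E <= lowspeed c 1 t)%E.
Proof.
rewrite /trunc_speed; case E : (lowspeed c 1 t) => [r| |].
- by rewrite -EFin_min /= lee_fin ge_min lexx.
- by rewrite leey.
- by have := lowspeed_ge0 c 1 t; rewrite E.
Qed.

(** Truncation makes the primitive available before integrability of the squared speed is
    known. *)
Definition trunc_sq c n t : R := trunc_speed c n t ^+ 2 * (indI 0 1) t.

Lemma trunc_sq_ge0 c n t : 0 <= trunc_sq c n t.
Proof. by rewrite mulr_ge0 ?sqr_ge0 ?indI_ge0. Qed.

Lemma measurable_trunc_sq c n : continuous c -> measurable_fun setT (trunc_sq c n).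
Proof.
move=> cc; apply: measurable_funM; last exact: measurable_indic.
apply: measurable_funX; apply: measurableT_comp => //.
by apply: measurable_mine => //; exact: measurable_lowspeed.
Qed.

Lemma summable_trunc_sq c n : continuous c -> summable_fun (trunc_sq c n).
Proof.
move=> cc.
have si : summable_fun (fun t => n%:R ^+ 2 * (indI 0 1) t).
  have := @integrableZl _ _ _ mu setT measurableT (n%:R ^+ 2) _ (@summable_indI R 0 1).
  exact.
apply: (@le_integrable _ _ _ mu setT measurableT _ _ _ _ si).
  by apply/measurable_EFinP; exact: measurable_trunc_sq.
move=> t _ /=; rewrite lee_fin !ger0_norm ?trunc_sq_ge0//; last first.
  by rewrite mulr_ge0 ?sqr_ge0 ?indI_ge0.
have /andP[h1 h2] := trunc_speed_bound c n t.
by rewrite ler_wpM2r ?indI_ge0// lerXn2r ?nnegrE.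
Qed.

(** At a differentiability time the bound d^2 <= dt dPhi divided by dt compares the
    squared lower speed with the quotient of Phi, at steps on which both estimates hold. *)
Lemma trunc_sq_energy c Phi n : continuous c -> {homo Phi : s t / s <= t} ->
  (forall s t, s <= t -> mdist (c s) (c t) ^+ 2 <= (t - s) * (Phi t - Phi s)) ->
  prim (trunc_sq c n) 1 - prim (trunc_sq c n) 0 <= Phi 1 - Phi 0.
Proof.
move=> cc nd cE.
have sf := summable_trunc_sq n cc.
have [N [mN N0 HN]] := prim_expands sf.
have nN : mu.-negligible N by exists N; split.
apply: (@ae_growth_right _ _ Phi 0 1 N) => //; first exact: prim_cont.
- move=> t /andP[t0 t1] Nt e e0.
  have Et : expands (prim (trunc_sq c n)) t (trunc_sq c n t).
    by apply: contrapT => h; apply/Nt/HN.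
  have e20 : 0 < e / 2 by lra.
  have /andP[v0 vn] := trunc_speed_bound c n t.
  set v := trunc_speed c n t in v0 vn.
  pose eta := e / 4 / (v + 1).
  have eta0 : 0 < eta by rewrite /eta divr_gt0//; lra.
  have etav : v * eta <= e / 4.
    by rewrite /eta mulrCA ler_piMr//; [lra|rewrite ler_pdivrMr; lra].
  have : ((v - eta)%:E < lowspeed c 1 t)%E.
    by apply: lt_le_trans (trunc_speed_le c n t); rewrite lte_fin -/v; lra.
  move=> /limn_einf_gt H1.
  have H2 := near_step (normr1 R) (Et _ e20).
  have H3 := near_step (normr1 R) (lt_nbhsl t1).
  have [k _ /(_ k (leqnn k)) [h1 [/= h2 h3]]] := filterI H1 (filterI H2 H3).
  pose q : R := k.+1%:R^-1.
  have q0 : 0 < q by rewrite /q invr_gt0.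
  move: h1 h2 h3; rewrite mul1r -/q [t + q - t]addrAC subrr add0r => h1 h2 h3.
  exists (t + q); first by rewrite ltrDl q0 ltW.
  rewrite [t + q - t]addrAC subrr add0r.
  move: h1; rewrite lte_fin /dquot mul1r -/q; set x := _ * _ => h1.
  have xE : mdist (c t) (c (t + q)) = x * q.
    by rewrite /x mulrAC /q mulfV ?mul1r// gt_eqF.
  have := cE t (t + q) _; rewrite [t + q - t]addrAC subrr add0r xE lerDl => /(_ (ltW q0)).
  rewrite exprMn [q ^+ 2]expr2 mulrA [leLHS]mulrC ler_pM2l// => h4.
  have f1 : trunc_sq c n t = v ^+ 2.
    by rewrite /trunc_sq indIE t0 (ltW t1) mulr1.
  move: h2; rewrite f1 (ger0_norm (ltW q0)) ler_norml => /andP[_ h2].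
  have h5 : v ^+ 2 - e / 2 <= x ^+ 2.
    have := sqr_ge0 (x - v); rewrite !expr2 => h6.
    have : v * (v - eta) <= v * x by apply: ler_wpM2l => //; exact: ltW.
    lra.
  have : (v ^+ 2 - e / 2) * q <= x ^+ 2 * q by rewrite ler_pM2r.
  lra.
- move=> e e0; have [Psi [mPsi Psie PsiM]] := null_control nN sf (trunc_sq_ge0 c n) e0.
  exists Psi; split => //; first exact: Psie.
  move=> t /andP[t0 t1] Nt.
  have [d d0 Hd] := near_ball (PsiM t Nt).
  pose s := Num.min 1 (t + d / 2).
  have ts : t < s by rewrite lt_min t1 /=; lra.
  have s1 : s <= 1 by rewrite ge_min lexx.
  have sd : s <= t + d / 2 by rewrite ge_min lexx orbT.
  exists s; first by rewrite ts.
  have [|/(_ (ltW ts)) H _] := Hd s; first by rewrite ger0_norm; lra.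
  by have := nd _ _ (ltW ts); lra.
Qed.

End energy_density_thm.

Section energy_density_exists.
Context {R : realType} {X : metricType R}.
Local Notation mu := (@lebesgue_measure R).
Implicit Types (c : R -> X) (Phi m w : R -> R) (a b s t : R) (N : set R).

Lemma energy_on_cont c Phi : energy_on 0 1 c Phi -> continuous (c \o clamp).
Proof.
move=> eb; have [nd cE] := energy_on_clamp eb.
pose K := Phi 1 - Phi 0.
have K0 : 0 <= K by rewrite subr_ge0; exact: (energy_on_nd eb).
have dK s t : s <= t -> mdist (c (clamp s)) (c (clamp t)) ^+ 2 <= (t - s) * K.
  move=> st; apply: le_trans (cE _ _ st) _; apply: ler_wpM2l; first by rewrite subr_ge0.
  have /andP[s0 s1] := clamp_in s; have /andP[t0 t1] := clamp_in t.
  by apply: lerB; apply: (energy_on_nd eb).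
have dK' s t : mdist (c (clamp s)) (c (clamp t)) ^+ 2 <= `|t - s| * K.
  have [/dK st|/ltW ts] := leP s t; last first.
    by rewrite metric_sym distrC ger0_norm ?subr_ge0//; exact: dK.
  by apply: le_trans st _; apply: ler_wpM2r => //; exact: ler_norm.
move=> t; apply/metricType_numDomainType.cvgrPdist_lt => e e0.
exists (e ^+ 2 / (K + 1)); first by rewrite /= divr_gt0 ?exprn_gt0//; lra.
move=> s /=; rewrite ltr_pdivlMr; last lra.
rewrite distrC => H; rewrite -(ltr_pXn2r (_ : (0 < 2)%N)) ?nnegrE ?mdist_ge0 ?(ltW e0)//.
apply: le_lt_trans (dK' _ _) _; apply: le_lt_trans H.
by rewrite ler_wpM2l// lerDl.
Qed.

Lemma sqr_liminf c t : 0 <= t <= 1 -> forall r, lowspeed c 1 t = r%:E ->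
  \forall n \near \oo, trunc_sq c n t = r ^+ 2.
Proof.
move=> t01 r rE; have r0 : 0 <= r by rewrite -lee_fin -rE lowspeed_ge0.
have := nbhs_infty_ger r; apply: filterS => n nr.
rewrite /trunc_sq /trunc_speed rE min_l ?lee_fin//.
by rewrite indIE t01 mulr1.
Qed.

(** Fatou's lemma removes the truncation from [trunc_sq_energy], and [lowspeed_dom] shows
    that the resulting square-integrable speed dominates the curve. *)
Theorem energy_density c Phi : energy_on 0 1 c Phi -> exists w,
  [/\ summable_fun w, (forall x, 0 <= w x), dominated (c \o clamp) (prim w),
     summable_fun (fun x => w x ^+ 2) &
     prim (fun x => w x ^+ 2) 1 - prim (fun x => w x ^+ 2) 0 <= Phi 1 - Phi 0].
Proof.
move=> eb; have [nd cE] := energy_on_clamp eb.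
have cc := energy_on_cont eb.
pose C := c \o clamp.
pose L t := limn_einf (fun n => (trunc_sq C n t)%:E).
have mL : measurable_fun setT L.
  by apply: measurable_fun_limn_einf => n; apply/measurable_EFinP; exact: measurable_trunc_sq.
have L0 t : (0 <= L t)%E.
  by apply: limn_einf_ge; apply: nearW => n; rewrite lee_fin trunc_sq_ge0.
have bnd n : (\int[mu]_x (trunc_sq C n x)%:E <= (Phi 1 - Phi 0)%:E)%E.
  rewrite (_ : \int[mu]_x _ = \int[mu]_(x in `[0%R, 1%R]) (trunc_sq C n x)%:E)%E; last first.
    rewrite [RHS]integral_mkcond; apply: eq_integral => x _; rewrite patchE.
    rewrite /trunc_sq indIE mem_setE in_itv/=.
    by case: (0 <= x <= 1)%R; rewrite ?mulr0.
  rewrite -prim_subE//; last exact: summable_trunc_sq.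
  rewrite lee_fin; have := trunc_sq_energy n cc nd cE.
  by rewrite /= !clamp_id// ?lexx ?ler01.
have LK : (\int[mu]_x L x <= (Phi 1 - Phi 0)%:E)%E.
  apply: le_trans (fatou mu measurableT _ _) _.
  - by move=> n; apply/measurable_EFinP; exact: measurable_trunc_sq.
  - by move=> n x _; rewrite lee_fin trunc_sq_ge0.
  by apply: limn_einf_le_freq => n; exists n.
have iL : mu.-integrable setT L.
  apply/integrableP; split => //; apply: (@le_lt_trans _ _ (\int[mu]_x L x)%E).
    by apply: ge0_le_integral => // [|x _]; [exact: measurableT_comp|rewrite gee0_abs].
  by apply: le_lt_trans LK _; rewrite ltry.
pose w t := fine (lowspeed C 1 t) * (indI 0 1) t.
have w0 t : 0 <= w t by rewrite mulr_ge0 ?indI_ge0// fine_ge0 ?lowspeed_ge0.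
have mw : measurable_fun setT w.
  apply: measurable_funM; last exact: measurable_indic.
  by apply: measurableT_comp => //; exact: measurable_lowspeed.
have wL t : ((w t ^+ 2)%:E <= L t)%E.
  have [t01|t01] := boolP ((0 <= t <= 1)%R : bool); last first.
    by rewrite /w indIE (negbTE t01) mulr0 expr0n/= L0.
  case E : (lowspeed C 1 t) => [r| |].
  - apply: limn_einf_ge; have := sqr_liminf t01 E; apply: filterS => n ->.
    by rewrite /w E indIE t01 mulr1.
  - by rewrite /w E /= mul0r expr0n/= L0.
  - by rewrite /w E /= mul0r expr0n/= L0.
have sw2 : summable_fun (fun x => w x ^+ 2).
  apply: (@le_integrable _ _ _ mu setT measurableT _ L) => //.
    by apply/measurable_EFinP; exact: measurable_funX.
  by move=> t _ /=; rewrite ger0_norm ?sqr_ge0// gee0_abs.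
have sw : summable_fun w.
  have := integrableD measurableT (@summable_indI R 0 1) sw2.
  apply: (@le_integrable _ _ _ mu setT measurableT) => //.
    exact/measurable_EFinP.
  move=> t _ /=; rewrite lee_fin !ger0_norm ?addr_ge0 ?indI_ge0 ?sqr_ge0//.
  rewrite /w indIE; case: (0 <= t <= 1)%R; last by rewrite mulr0 expr0n/= addr0.
  rewrite mulr1; set x := fine _; have := sqr_ge0 (x - 1 / 2); rewrite !expr2 /=; lra.
exists w; split => //; last first.
  rewrite -lee_fin prim_subE//; apply: le_trans LK.
  apply: (@le_trans _ _ (\int[mu]_(x in `[0%R, 1%R]) L x)%E).
    apply: ge0_le_integral => //.
    - by move=> x _; rewrite lee_fin sqr_ge0.
    - by apply: measurable_funTS; apply/measurable_EFinP; exact: measurable_funX.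
    - exact: measurable_funTS.
  by apply: ge0_subset_integral.
have [N [mN N0 HN]] := integrable_ae measurableT iL.
have nN : mu.-negligible N by exists N; split.
have dw a b : 0 <= a -> a <= b -> b <= 1 -> mdist (C a) (C b) <= prim w b - prim w a.
  move=> a0 ab b1; apply: (lowspeed_dom (normr1 R) ab cc _ sw w0 nN).
    exact: energy_null_controlled eb _ _ _.
  move=> t /andP[at_ tb] Nt.
  have t01 : 0 <= t <= 1 by apply/andP; split; lra.
  have Lf : L t \is a fin_num.
    by apply: contrapT => h; apply/Nt/HN => /= /(_ Logic.I).
  rewrite -/C; case E : (lowspeed C 1 t) => [r| |].
  - by rewrite /w E indIE t01 mulr1.
  - suff : L t = +oo%E by move=> h; rewrite h in Lf.
    apply: eq_infty => r.
    apply: limn_einf_ge; have := nbhs_infty_ger (`|r| + 1); apply: filterS => n nr.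
    rewrite lee_fin /trunc_sq /trunc_speed E min_r ?leey//= indIE t01 mulr1.
    have := ler_norm r; have := normr_ge0 r => h1 h2.
    by apply: le_trans (_ : n%:R <= _); [lra|rewrite expr2 ler_peMl//; lra].
  - by have := lowspeed_ge0 C 1 t; rewrite E.
have ndw := prim_nd sw w0.
move=> s t st.
have /andP[s0 _] := clamp_in s; have /andP[_ t1] := clamp_in t.
have idc u : C (clamp u) = C u by rewrite /C /= clamp_id ?clamp_in.
have := dw _ _ s0 (clamp_nd st) t1; rewrite !idc => /le_trans; apply.
exact: nd_clamp.
Qed.

End energy_density_exists.

(** * Integrals of functions that may fail to be measurable *)

Section lower_integral.
Context d (T : measurableType d) {R : realType} (mu : {measure set T -> \bar R}).
Local Open Scope ereal_scope.
Implicit Types (D N : set T) (f g : T -> \bar R).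

Import HBNNSimple.

(** The integral of a nonnegative function is a supremum over simple functions below it,
    so it can be compared with a measurable majorant directly.  This matters for the metric
    speed, a limit at almost every time only, and for the slope along a limit of curves. *)
Lemma integral_le_measurable D N f g : measurable D -> measurable N -> mu N = 0 ->
  (forall x, D x -> 0 <= f x) -> (forall x, D x -> 0 <= g x) -> measurable_fun D g ->
  (forall x, D x -> ~ N x -> f x <= g x) ->
  \int[mu]_(x in D) f x <= \int[mu]_(x in D) g x.
Proof.
move=> mD mN N0 f0 g0 mg fg.
have mgD : measurable_fun setT (g \_ D) by exact/(measurable_restrictT _ _).1.
have gD0 x : 0 <= (g \_ D) x by apply: erestrict_ge0.
rewrite (ge0_integralE mu f0) [leRHS]integral_mkcond.
apply: ge_ereal_sup => _ [h /= hf <-].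
rewrite -integralT_nnsfun.
have mh : measurable_fun setT (EFin \o h) by exact/measurable_EFinP.
rewrite (ge0_negligible_integral mN _ _ _ N0)//; last by move=> x _; rewrite lee_fin.
rewrite [leRHS](ge0_negligible_integral mN _ _ _ N0)//.
apply: ge0_le_integral => //.
- exact: measurableD.
- by move=> x _; rewrite lee_fin.
- exact: measurable_funTS.
- exact: measurable_funTS.
move=> x [_ Nx]; apply: le_trans (hf x) _; rewrite !patchE; case: ifPn => // /set_mem Dx.
exact: fg.
Qed.

Lemma integral_ge_measurable D N f g : measurable D -> measurable N -> mu N = 0 ->
  (forall x, D x -> 0 <= f x) -> (forall x, D x -> 0 <= g x) -> measurable_fun D g ->
  (forall x, D x -> ~ N x -> g x <= f x) ->
  \int[mu]_(x in D) g x <= \int[mu]_(x in D) f x.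
Proof.
move=> mD mN N0 f0 g0 mg gf.
rewrite (ge0_negligible_integral mN mD mg g0 N0) (ge0_integralE mu f0).
rewrite (ge0_integralE mu); last by move=> x [Dx _]; exact: g0.
apply: ereal_sup_le => _ [h /= hg <-]; exists h => // x.
apply: le_trans (hg x) _; rewrite !patchE.
case: ifPn => [/set_mem[Dx Nx]|_]; first by rewrite mem_set//; exact: gf.
by case: ifPn => // /set_mem Dx; exact: f0.
Qed.

End lower_integral.

(** * The action as an energy bound *)

Section action_energy.
Context {R : realType} {X : metricType R}.
Local Notation mu := (@lebesgue_measure R).
Implicit Types (c : R -> X) (Phi m w : R -> R) (a b s t : R) (N : set R).

Lemma near_clamp t : 0 < t < 1 -> \forall s \near t, clamp s = s.
Proof.
move=> /andP[t0 t1]; move: (lt_nbhsr t0) (lt_nbhsl t1).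
apply: filterS2 => s s0 s1; apply: clamp_id.
by rewrite (ltW s0) (ltW s1).
Qed.

Lemma metric_speedE c t l : 0 < t < 1 ->
  (forall e, 0 < e -> \forall s \near t,
    `|mdist (c (clamp t)) (c (clamp s)) - l * `|s - t| | <= e * `|s - t|) ->
  metric_speed c t = l%:E.
Proof.
move=> t01 H; apply/cvg_lim => //; apply: cvg_EFin; first exact: nearW.
apply/cvgrPdist_le => e e0 /=.
have tin : 0 <= t <= 1 by case/andP: t01 => h1 h2; rewrite !ltW.
move: (H e e0) (near_clamp t01); apply: filterS2 => s /= + sE st.
rewrite sE (clamp_id tin) metric_sym.
have st0 : 0 < `|s - t| by rewrite normr_gt0 subr_eq0.
set n := `|s - t| in st0 *; set x := mdist _ _ => h.
have -> : l - x / n = - ((x - l * n) / n).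
  by rewrite mulrBl mulfK ?gt_eqF// opprB.
by rewrite normrN normrM normfV (ger0_norm (ltW st0)) ler_pdivrMr.
Unshelve. all: by end_near. Qed.

Lemma metric_speed_ae c m :
  {ae mu, forall t, forall e, 0 < e -> \forall s \near t,
    `|mdist (c (clamp t)) (c (clamp s)) - m t * `|s - t| | <= e * `|s - t|} ->
  exists N, [/\ measurable N, mu N = 0 &
    forall t, 0 <= t <= 1 -> ~ N t -> metric_speed c t = (m t)%:E].
Proof.
move=> [N [mN N0 HN]].
have hN : mu.-negligible N by exists N; split.
have n1 (r : R) : mu.-negligible [set r].
  exists [set r]; split => //; exact: lebesgue_measure_set1.
have mU : measurable (N `|` ([set 0 : R] `|` [set 1])) by apply: measurableU => //; exact: measurableU.
exists (N `|` ([set 0] `|` [set 1])); split => //.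
  exact: (measure_negligible mU (negligibleU hN (negligibleU (n1 0) (n1 1)))).
move=> t /andP[t0 t1] Nt.
have t0' : t != 0 by apply/eqP => h; apply: Nt; right; left.
have t1' : t != 1 by apply/eqP => h; apply: Nt; right; right.
apply: metric_speedE; first by rewrite !lt_neqAle eq_sym t0' t1' t0 t1.
by apply: contrapT => h; apply: Nt; left; apply: HN.
Qed.

(** Cauchy-Schwarz for the integral of m over [s, t], obtained by integrating Young's
    inequality and then optimizing in h. *)
Lemma energy_on_of_sqr_summable c m :
  summable_fun m -> dominated (c \o clamp) (prim m) ->
  summable_fun (fun x => m x ^+ 2 * (indI 0 1) x) ->
  energy_on 0 1 c (prim (fun x => m x ^+ 2 * (indI 0 1) x)).
Proof.
move=> sm dm sm2 s t s0 st t1.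
set F := fun x => m x ^+ 2 * (indI 0 1) x.
have := dm s t st; rewrite /= !clamp_id; [|apply/andP; split; lra|apply/andP; split; lra].
set d := mdist _ _ => dE.
have d0 : 0 <= d := mdist_ge0 _ _.
have F0 x : 0 <= F x by rewrite /F mulr_ge0 ?sqr_ge0 ?indI_ge0.
have v0 : 0 <= prim F t - prim F s by rewrite subr_ge0; exact: prim_nd.
have H h : 0 < h -> d <= (h * (prim F t - prim F s) + (t - s) / h) / 2.
  move=> h0; apply: le_trans dE _.
  have sl := summable_lin (h / 2) (h^-1 / 2) sm2 (@summable_indI R 0 1).
  apply: (@le_trans _ _ (prim (fun x => h / 2 * F x + h^-1 / 2 * (indI 0 1) x) t -
      prim (fun x => h / 2 * F x + h^-1 / 2 * (indI 0 1) x) s)).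
    apply: prim_le => // x /andP[sx xt].
    have x01 : 0 <= x <= 1 by apply/andP; split; lra.
    rewrite /F indIE x01 !mulr1.
    have := young_sqr (sqr_ge0 (m x)) ler01 (_ : 0 < h^-1).
    rewrite mulr1 invr_gt0 => /(_ (m x) h0 (lexx _)).
    by rewrite mulr1 invrK; lra.
  rewrite !prim_lin//; last 2 first.
    exact: summable_indI.
    exact: summable_indI.
  have := prim_indI s0 st t1 => E.
  by have : h^-1 / 2 * (prim (indI 0 1) t - prim (indI 0 1) s) = h^-1 / 2 * (t - s); [rewrite E|lra].
move: v0 H; set v := _ - _ => v0 H.
have u0 : 0 <= t - s by rewrite subr_ge0.
have [->|dn0] := eqVneq d 0; first by rewrite expr0n/= mulr_ge0.
have dp : 0 < d by rewrite lt_neqAle eq_sym dn0.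
have [vE|vn0] := eqVneq v 0.
  have := H ((t - s + 1) / d); rewrite vE mulr0 add0r invfM invrK divr_gt0//; last lra.
  move=> /(_ isT); rewrite mulrA.
  have : (t - s) / (t - s + 1) < 1 by rewrite ltr_pdivrMr; lra.
  move: (_ / (_ + 1)) => k k1.
  have : k * d < 1 * d by rewrite ltr_pM2r.
  lra.
have vp : 0 < v by rewrite lt_neqAle eq_sym vn0.
have := H (d / v) (divr_gt0 dp vp); rewrite mulfVK ?gt_eqF// invfM invrK mulrA.
move=> h; have {h} : d <= (t - s) * v / d.
  by rewrite [(t - s) * v / d]mulrAC; lra.
by rewrite ler_pdivlMr.
Qed.

Theorem finite_action_energy c : (action c < +oo)%E -> ac_on 0 1 c /\
  exists Phi, energy_on 0 1 c Phi /\ (((Phi 1 - Phi 0) / 2)%:E <= action c)%E.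
Proof.
rewrite /action; case: asboolP => // acc; set I := integral _ _ _ => Ioo.
split => //.
have [g [sg g0 dg _]] := ac_on_domI ler01 acc.
have [m [sm m0 dm /metric_speed_ae[N [mN N0 HN]]]] := ac_metric_derivative sg g0 dg.
have mm : measurable_fun setT m by apply/measurable_EFinP; exact: measurable_int sm.
have mI : (\int[mu]_(x in `[0%R, 1%R]) (m x ^+ 2)%:E <= I)%E.
  apply: (@integral_ge_measurable _ _ _ mu _ N) => //.
  - by move=> x _; rewrite sqre_ge0.
  - by move=> x _; rewrite lee_fin sqr_ge0.
  - by apply/measurable_EFinP; apply: measurable_funTS; exact: measurable_funX.
  - move=> x /=; rewrite in_itv/= => x01 Nx.
    by rewrite HN// EFin_expe.
have Ioo' : (I < +oo)%E.
  by rewrite ltey; apply/eqP => IE; move: Ioo; rewrite IE gt0_muley ?lte_fin ?invr_gt0.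
have I0 : (0 <= \int[mu]_(x in `[0%R, 1%R]) (m x ^+ 2)%:E)%E.
  by apply: integral_ge0 => x _; rewrite lee_fin sqr_ge0.
have E : (fun x => m x ^+ 2 * (indI 0 1) x) = (fun x => m x ^+ 2) \_ (`[0, 1]%classic : set R).
  apply/funext => x; rewrite patchE mem_setE in_itv/= indIE.
  by case: (0 <= x <= 1)%R; rewrite ?mulr1 ?mulr0.
have sm2 : summable_fun (fun x => m x ^+ 2 * (indI 0 1) x).
  rewrite E; apply: summable_restrict => //.
  apply/integrableP; split.
    by apply/measurable_EFinP; apply: measurable_funTS; exact: measurable_funX.
  apply: le_lt_trans Ioo'; apply: le_trans mI.
  apply: ge0_le_integral => //.
  - by apply: measurableT_comp => //; apply/measurable_EFinP; apply: measurable_funTS; exact: measurable_funX.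
  - by apply/measurable_EFinP; apply: measurable_funTS; exact: measurable_funX.
  - by move=> x _ /=; rewrite ger0_norm// sqr_ge0.
exists (prim (fun x => m x ^+ 2 * (indI 0 1) x)); split.
  exact: energy_on_of_sqr_summable.
rewrite [X in X%:E]mulrC EFinM; apply: lee_wpmul2l; first by rewrite lee_fin invr_ge0.
rewrite prim_subE//; apply: le_trans mI.
apply: ge0_le_integral => //.
- by move=> x _; rewrite lee_fin mulr_ge0 ?sqr_ge0 ?indI_ge0.
- by apply: measurable_funTS; exact: measurable_int sm2.
- by apply/measurable_EFinP; apply: measurable_funTS; exact: measurable_funX.
- by move=> x /=; rewrite in_itv/= => x01; rewrite lee_fin indIE x01 mulr1.
Qed.

Theorem energy_on_action c Phi : energy_on 0 1 c Phi ->
  ac_on 0 1 c /\ (action c <= ((Phi 1 - Phi 0) / 2)%:E)%E.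
Proof.
move=> eb; have [w [sw w0 dw sw2 wK]] := energy_density eb.
have acc := dom_ac_onI sw dw; split => //.
rewrite /action; case: asboolP => // _.
have [m [sm m0 dm aem]] := ac_metric_derivative sw w0 dw.
have [N [mN N0 HN]] := metric_speed_ae aem.
rewrite mulrC EFinM; apply: lee_wpmul2l; first by rewrite lee_fin invr_ge0.
apply: (@le_trans _ _ (\int[mu]_(x in `[0%R, 1%R]) (w x ^+ 2)%:E)%E); last first.
  by rewrite -prim_subE// lee_fin.
have [M [mM M0 HM]] := prim_expands sw.
have [M' [mM' M'0 HM']] := aem.
apply: (@integral_le_measurable _ _ _ mu _ (N `|` (M `|` M'))) => //.
- by apply: measurableU => //; exact: measurableU.
- have h1 : mu.-negligible N by exists N; split.
  have h2 : mu.-negligible M by exists M; split.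
  have h3 : mu.-negligible M' by exists M'; split.
  apply: measure_negligible; first by apply: measurableU => //; exact: measurableU.
  exact: (negligibleU h1 (negligibleU h2 h3)).
- by move=> x _; rewrite sqre_ge0.
- by move=> x _; rewrite lee_fin sqr_ge0.
- by apply: measurable_funTS; exact: measurable_int sw2.
move=> x /=; rewrite in_itv/= => x01 Nx.
rewrite HN//; last by move=> h; apply: Nx; left.
rewrite -EFinM lee_fin -expr2 lerXn2r ?nnegrE//.
have Ex : expands (prim w) x (w x).
  by apply: contrapT => h; apply: Nx; right; left; apply: HM.
have Dx : forall e, 0 < e -> \forall s \near x,
    `|mdist (c (clamp x)) (c (clamp s)) - m x * `|s - x| | <= e * `|s - x|.
  by apply: contrapT => h; apply: Nx; right; right; apply: HM'.
apply/ler_addgt0Pr => e e0.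
have e20 : 0 < e / 2 by lra.
have [k _ /(_ k (leqnn k)) [/= h1 h2]] := filterI (near_step (normr1 R) (Ex _ e20)) (near_step (normr1 R) (Dx _ e20)).
move: h1 h2; set q := k.+1%:R^-1.
have q0 : 0 < q by rewrite invr_gt0.
rewrite mul1r [x + q - x]addrAC subrr add0r (ger0_norm (ltW q0)).
have := dw x (x + q); rewrite lerDl => /(_ (ltW q0)) /=.
rewrite !ler_norml => h0 /andP[h1 h2] /andP[h3 h4].
rewrite -(ler_pM2r q0); lra.
Qed.

End action_energy.

(** * Integration of the evolution variational inequality *)

(** One-sided version of (a - b)(a + b) <= 2 a d; b may exceed a. *)
Lemma sqr_diff_le (R : realFieldType) (a b d : R) : 0 <= a -> 0 <= b -> 0 <= d ->
  a - b <= d -> a ^+ 2 - b ^+ 2 <= 2 * a * d.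
Proof.
move=> a0 b0 d0 abd; rewrite subr_sqr; have [h|h] := leP 0 (a - b).
  by rewrite mulrC; apply: ler_pM; lra.
have : (a - b) * (a + b) <= 0 by apply: mulr_le0_ge0; lra.
by have : 0 <= 2 * a * d by [rewrite !mulr_ge0|]; lra.
Qed.

Section evi.
Context {R : realType} {X : metricType R}.
Local Notation mu := (@lebesgue_measure R).
Variable E : X -> \bar R.
Hypothesis E_gtNy : forall x : X, (-oo < E x)%E.
Hypothesis E_lsc : lower_semicontinuous E.
Implicit Types (c : R -> X) (x y z : X) (a b s t k : R) (N : set R).

Lemma fin_E x : (E x < +oo)%E -> (fine (E x))%:E = E x.
Proof. by move=> Ex; rewrite fineK// fin_numE gt_eqF ?lt_eqF. Qed.

Lemma negligible_itv N a b : mu.-negligible N -> a < b -> exists2 s, a < s < b & ~ N s.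
Proof.
move=> [A [mA A0 NA]] ab; apply: contrapT => /forall2NP H.
have sub : `]a, b[%classic `<=` A.
  move=> s /=; rewrite in_itv/= => sab; apply: NA.
  by have [//|/contrapT] := H s.
have : (mu `]a, b[%classic <= mu A)%E by apply: le_measure => //; rewrite inE.
by rewrite [X in (_ <= X)%E]A0 lebesgue_measure_itv/= lte_fin ab -EFinD lee_fin; lra.
Qed.

(** The flow is only given for t > 0; this is its continuous extension to time 0. *)
Definition extend0 x c t : X := if t <= 0 then x else c t.

Lemma expRN_le1 k s : 0 <= k -> 0 <= s -> expR (- k * s) <= 1.
Proof. by move=> k0 s0; rewrite -expR0 ler_expR mulNr oppr_le0 mulr_ge0. Qed.

Lemma expRN_lip k s t : 0 <= k -> 0 <= s -> s <= t ->
  expR (- k * s) - expR (- k * t) <= k * (t - s).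
Proof.
move=> k0 s0 st.
have -> : - k * t = - k * s + - (k * (t - s)) by ring.
rewrite expRD; set p := expR (- k * s); set q := expR _.
have p0 : 0 <= p by exact: expR_ge0.
have p1 : p <= 1 by exact: expRN_le1.
have q1 : 1 + - (k * (t - s)) <= q := expR_ge1Dx _.
have kts : 0 <= k * (t - s) by rewrite mulr_ge0// subr_ge0.
have : p * (1 - q) <= p * (k * (t - s)) by apply: ler_wpM2l => //; lra.
have : p * (k * (t - s)) <= 1 * (k * (t - s)) by apply: ler_wpM2r.
lra.
Qed.

(** Gronwall's inequality with the integrating factor exp(- k t), for a curve that is
    only absolutely continuous: at almost every time the weighted quantity has nonpositive
    derivative, and at the remaining times its growth is at most a constant times that of
    the density of c. *)
Lemma evi_weighted (k A : R) c z a b N : 0 < k -> 0 < a -> a <= b ->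
  ac_on a b c -> mu.-negligible N ->
  (forall t, a < t < b -> ~ N t -> derivable (fun s => mdist (c s) z ^+ 2) t 1 /\
     derive1 (fun s => mdist (c s) z ^+ 2) t <= k * (mdist (c t) z ^+ 2 + A)) ->
  expR (- k * b) * (mdist (c b) z ^+ 2 + A) <= expR (- k * a) * (mdist (c a) z ^+ 2 + A).
Proof.
move=> k0 a0 ab acc nN HN.
have [g [sg g0 dg ig]] := ac_on_domI ab acc.
pose C := c \o clampI a b.
have Cid t : a <= t <= b -> C t = c t by move=> h; rewrite /C /= clampI_id.
have cC : continuous C by apply: dom_cont dg; exact: prim_cont.
pose D t := expR (- k * t) * (mdist (C t) z ^+ 2 + A).
have cD : continuous D.
  move=> t; apply: cvgM.
    apply: continuous_comp; last exact: continuous_expR.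
    by apply: cvgM; [exact: cvg_cst|exact: cvg_id].
  apply: cvgD; last exact: cvg_cst.
  have := @mdist_cont _ _ C z cC; rewrite (_ : (fun t => mdist z (C t)) = (fun t => mdist (C t) z)).
    by move=> H; apply: cvgM; exact: H.
  by apply/funext => s; rewrite metric_sym.
suff : D b - D a <= 0 - 0.
  by rewrite subr0 /D !Cid ?lexx ?ab// subr_le0.
have [N' [mN' N'0 NN']] : mu.-negligible (N `|` [set a]).
  apply: negligibleU => //; exists [set a]; split => //; exact: lebesgue_measure_set1.
have nN' : mu.-negligible N' by exists N'; split.
apply: (@ae_growth_right _ D (fun=> 0) a b N') => //.
- move=> t /andP[at_ tb] Nt e e0.
  have ta : a < t.
    rewrite lt_neqAle at_ andbT; apply/eqP => h; apply: Nt; apply: NN'; right.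
    by rewrite h.
  have [|df f'] := HN t _ (fun h => Nt (NN' _ (or_introl h))); first by rewrite ta.
  pose f s := mdist (c s) z ^+ 2.
  have Df : is_derive t (1 : R) f (derive1 f t) by rewrite derive1E; exact: derivableP.
  pose p s := expR (- k * s).
  have Dp : is_derive t (1 : R) p (expR (- k * t) * - k).
    apply: (@is_derive1_comp _ expR (fun s => - k * s)).
    by apply: is_derive_eq; rewrite ?mulr0 ?addr0 ?scaler0 ?add0r /GRing.scale/= ?mulr1.
  have DfA : is_derive t (1 : R) (f + cst A) (derive1 f t + 0) by exact: is_deriveD.
  have DG := is_deriveM Dp DfA.
  have EG := derivable_expands (@ex_derive _ _ _ _ _ _ _ DG) e0.
  have l0 : derive1 (p * (f + cst A)) t <= 0.
    rewrite derive1E (@derive_val _ _ _ _ _ _ _ DG) /GRing.scale /= addr0.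
    have -> : p t * derive1 f t + (f + cst A) t * (expR (- k * t) * - k) =
       expR (- k * t) * (derive1 f t - k * (f t + A)) by rewrite /p !fctE; ring.
    by rewrite pmulr_rle0 ?expR_gt0// subr_le0.
  move: (derive1 (p * (f + cst A)) t : R) l0 EG => l l0 EG.
  have [d d0 Hd] := near_ball EG.
  pose s := Num.min b (t + d / 2).
  have ts : t < s by rewrite lt_min tb /=; lra.
  have sb : s <= b by rewrite ge_min lexx.
  have sd : s <= t + d / 2 by rewrite ge_min lexx orbT.
  exists s; first by rewrite ts.
  rewrite subrr add0r /D !Cid; [|apply/andP; split; lra|apply/andP; split; lra].
  have {Hd} := Hd s; rewrite ger0_norm ?subr_ge0 ?(ltW ts)// => /(_ _)/wrap[]; first lra.
  rewrite ler_norml => /andP[_]; rewrite /= !fctE /p /f.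
  have : l * (s - t) <= 0 by rewrite mulr_le0_ge0// subr_ge0 ltW.
  lra.
- move=> e e0.
  pose M := mdist (C a) z + (prim g b - prim g a).
  have ndg := prim_nd sg g0.
  have M0 : 0 <= M by rewrite addr_ge0 ?mdist_ge0// subr_ge0 ndg.
  have CM s : a <= s -> s <= b -> mdist (C s) z <= M.
    move=> as_ sb; apply: le_trans (metric_triangle _ (C a) _) _.
    rewrite addrC lerD2l metric_sym; apply: le_trans (dg _ _ as_) _.
    by rewrite lerB// ndg.
  pose B := 2 * M + k * `|A|.
  have B0 : 0 <= B by rewrite addr_ge0 ?mulr_ge0// ltW.
  have eB0 : 0 < e / (B + 1) by rewrite divr_gt0//; lra.
  have [Psi [mPsi Psie PsiM]] := null_control nN' sg g0 eB0.
  exists (fun t => B * Psi t); split.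
  + by move=> s t st; apply: ler_wpM2l => //; exact: mPsi.
  + have := Psie _ _ ab; rewrite ler_pdivlMr; last lra.
    have : 0 <= Psi b - Psi a by rewrite subr_ge0 mPsi.
    lra.
  move=> t /andP[at_ tb] Nt; have [d d0 Hd] := near_ball (PsiM t Nt).
  pose s := Num.min b (t + d / 2).
  have ts : t < s by rewrite lt_min tb /=; lra.
  have sb : s <= b by rewrite ge_min lexx.
  have sd : s <= t + d / 2 by rewrite ge_min lexx orbT.
  exists s; first by rewrite ts.
  have [|/(_ (ltW ts)) H _] := Hd s; first by rewrite ger0_norm; lra.
  rewrite subrr add0r -mulrBr; apply: (@le_trans _ _ (B * (prim g s - prim g t))); last first.
    exact: ler_wpM2l.
  have as_ : a <= s by lra.
  have := ig t s at_ (ltW ts) sb; have := dg t s (ltW ts).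
  have := mdist_lip (C s) (C t) z; have := CM _ as_ sb; have := CM _ at_ (ltW tb).
  rewrite /D; move: (mdist_ge0 (C t) z) (mdist_ge0 (C s) z).
  rewrite (metric_sym (C s) (C t)).
  have ps1 : expR (- k * s) <= 1 by apply: expRN_le1; lra.
  have pts : expR (- k * t) - expR (- k * s) <= k * (s - t) by apply: expRN_lip; lra.
  have pts0 : expR (- k * s) <= expR (- k * t).
    by rewrite ler_expR !mulNr lerN2 ler_pM2l// ltW.
  have p0 : 0 <= expR (- k * s) by exact: expR_ge0.
  move: (mdist (C t) z) (mdist (C s) z) => ft fs ft0 fs0 ftM fsM.
  rewrite -/(C t) -/(C s) => /(le_trans (ler_norm _)) lip dst ist.
  set P := prim g s - prim g t in dst ist *.
  have fP : fs - ft <= P by apply: le_trans lip _; exact: dst.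
  have P0 : 0 <= P by lra.
  have MP0 : 0 <= 2 * M * P by rewrite !mulr_ge0.
  have f2 : expR (- k * s) * (fs ^+ 2 - ft ^+ 2) <= 2 * M * P.
    have : fs ^+ 2 - ft ^+ 2 <= 2 * M * P.
      apply: le_trans (sqr_diff_le fs0 ft0 P0 fP) _.
      by rewrite ler_wpM2r// ler_pM2l.
    move=> h; have : expR (- k * s) * (fs ^+ 2 - ft ^+ 2) <= expR (- k * s) * (2 * M * P).
      exact: ler_wpM2l.
    have : expR (- k * s) * (2 * M * P) <= 1 * (2 * M * P).
      exact: ler_wpM2r.
    lra.
  have f3 : (expR (- k * s) - expR (- k * t)) * (ft ^+ 2 + A) <= k * `|A| * P.
    have h1 : (expR (- k * s) - expR (- k * t)) * (ft ^+ 2 + A) <=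
       (expR (- k * t) - expR (- k * s)) * `|A|.
      rewrite -[leLHS]mulrNN opprB; apply: ler_wpM2l; first lra.
      by have := sqr_ge0 ft; have := ler_norm (- A); rewrite normrN; lra.
    have h2 : (expR (- k * t) - expR (- k * s)) * `|A| <= k * (s - t) * `|A|.
      by apply: ler_wpM2r.
    have h3 : k * (s - t) * `|A| <= k * P * `|A|.
      by apply: ler_wpM2r => //; rewrite ler_pM2l.
    lra.
  rewrite /B; lra.
Qed.

Lemma extend0_pos x c t : 0 < t -> extend0 x c t = c t.
Proof. by move=> t0; rewrite /extend0 leNgt t0. Qed.

Lemma extend0_0 x c : extend0 x c 0 = x.
Proof. by rewrite /extend0 lexx. Qed.

Section flow.
Variables (lambda k : R) (x0 : X) (c : R -> X).
Hypotheses (k0 : 0 < k) (kl : - lambda <= k) (flow : evi_gradient_flow E lambda x0 c).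
Local Notation C := (extend0 x0 c).

Lemma extend0_cont : continuous C.
Proof.
case: flow => acc c0 _ t; apply/metricType_numDomainType.cvgrPdist_lt => e e0.
have [t0|t0|->] := ltgtP t 0.
- exists (- t); first by rewrite /= oppr_gt0.
  move=> s /=; rewrite ltr_norml => /andP[h _].
  by rewrite /extend0 (ltW t0) (_ : s <= 0) ?mdistxx//; lra.
- have t2 : t / 2 <= 2 * t by lra.
  have [|g [sg g0 dg _]] := ac_on_domI t2 (acc (t / 2) (2 * t) _ t2); first by lra.
  have cC : continuous (c \o clampI (t / 2) (2 * t)).
    by apply: dom_cont dg; exact: prim_cont.
  have /metricType_numDomainType.cvgrPdist_lt/(_ _ e0) := cC t.
  have h1 : t / 2 < t by lra.
  have h2 : t < 2 * t by lra.
  move: (lt_nbhsr h1) (lt_nbhsl h2); apply: filterS3 => s s1 s2 /=.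
  rewrite !clampI_id; [|apply/andP; split; lra|apply/andP; split; lra].
  by rewrite !extend0_pos//; lra.
- rewrite extend0_0.
  have /metricType_numDomainType.cvgrPdist_lt/(_ _ e0) [d /= d0 Hd] := c0.
  exists d => //= s sd; rewrite /extend0.
  by have [s0|s0] := leP s 0; [rewrite mdistxx|exact: Hd].
Qed.

(** If E stays above e along the flow, the differential inequality reads
    f' <= k (f + A) for f the squared distance to z and A = (2 / k)(E z - e).  The case a = 0
    follows by continuity. *)
Lemma flow_weighted z (e a b A : R) : A = 2 / k * (fine (E z) - e) -> (E z < +oo)%E -> 0 <= a -> a < b ->
  (forall t, a < t -> t < b -> (e%:E <= E (c t))%E) ->
  expR (- k * b) * (mdist (C b) z ^+ 2 + A) <= expR (- k * a) * (mdist (C a) z ^+ 2 + A).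
Proof.
move=> AE Ez a0 ab Ee.
have [acc _ /(_ z) [N [mN N0 HN]]] := flow.
have nN : mu.-negligible N by exists N; split.
have pos a' : 0 < a' -> a <= a' -> a' <= b -> expR (- k * b) * (mdist (C b) z ^+ 2 + A) <=
    expR (- k * a') * (mdist (C a') z ^+ 2 + A).
  move=> a'0 aa' a'b; have b0 : 0 < b by lra.
  rewrite !extend0_pos//; apply: (evi_weighted k0 a'0 a'b (acc _ _ a'0 a'b) nN).
  move=> t /andP[at_ tb] Nt.
  have t0 : 0 < t by lra.
  have [df H] : derivable (fun s : R => mdist (c s) z ^+ 2) t 1 /\
    ((2^-1 * derive1 (fun s : R => mdist (c s) z ^+ 2) t
          + lambda / 2 * mdist (c t) z ^+ 2)%:E + E (c t) <= E z)%E.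
    apply: contrapT => h; apply: Nt; apply: HN => /= h'; apply: h; exact: (h' t0).
  split => //.
  have : (e%:E <= E (c t))%E by apply: Ee; lra.
  move: H; rewrite -(fin_E Ez); move: (derive1 _ t : R) => f'.
  case: (E (c t)) => [v| |//].
  - rewrite -EFinD !lee_fin => H ev.
    have : - lambda * mdist (c t) z ^+ 2 <= k * mdist (c t) z ^+ 2.
      by apply: ler_wpM2r => //; exact: sqr_ge0.
    have -> : k * (mdist (c t) z ^+ 2 + A) = k * mdist (c t) z ^+ 2 + 2 * (fine (E z) - e).
      by rewrite mulrDr AE; congr (_ + _); field; rewrite gt_eqF.
    lra.
  - by rewrite addey// leye_eq.
have [a_pos|] := ltP 0 a; first by apply: pos => //; exact: ltW.
move=> a_neg; have {}a_neg : a = 0 by lra.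
subst a; rewrite leNgt; apply/negP => lt.
pose G s := expR (- k * s) * (mdist (C s) z ^+ 2 + A).
have cG : continuous G.
  move=> t; apply: cvgM.
    apply: continuous_comp; last exact: continuous_expR.
    by apply: cvgM; [exact: cvg_cst|exact: cvg_id].
  apply: cvgD; last exact: cvg_cst.
  have := @mdist_cont _ _ C z extend0_cont.
  rewrite (_ : (fun t => mdist z (C t)) = (fun t => mdist (C t) z)).
    by move=> H; apply: cvgM; exact: H.
  by apply/funext => s; rewrite metric_sym.
have e0 : 0 < G b - G 0 by rewrite subr_gt0.
have /cvgrPdist_lt/(_ _ e0) /near_ball[d d0 Hd] := cG 0.
pose s := Num.min b (d / 2).
have s0 : 0 < s by rewrite lt_min ab /=; lra.
have sb : s <= b by rewrite ge_min lexx.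
have sd : s <= d / 2 by rewrite ge_min lexx orbT.
have := Hd s; rewrite subr0 ger0_norm ?(ltW s0)// => /(_ _)/wrap[]; first lra.
rewrite ltr_norml => /andP[h _].
have := pos s s0 (ltW s0) sb; rewrite -/(G s) -/(G b); lra.
Qed.

(** Let r0 be the last time in [s, t] at which the energy is at most its value at s; it
    exists by lower semicontinuity.  If r0 < t, the energy exceeds that value on ]r0, t], and
    [flow_weighted] with z = c(r0) forces c t = c(r0), a contradiction. *)
Lemma flow_nonincreasing s t : 0 <= s -> s < t -> (E (C s) < +oo)%E ->
  (E (C t) <= E (C s))%E.
Proof.
move=> s0 st Es; rewrite leNgt; apply/negP => Est.
pose al := fine (E (C s)).
have alE : al%:E = E (C s) by exact: fin_E.
rewrite -alE in Est.
pose S := [set r | s <= r <= t /\ (E (C r) <= al%:E)%E].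
have Ss : S s by split; [rewrite lexx ltW|rewrite alE].
have Sub : ubound S t by move=> r [/andP[]].
have hS : has_sup S by split; [exists s|exists t].
pose r0 := sup S.
have sr0 : s <= r0 by apply: ub_le_sup => //; exists t.
have r0t : r0 <= t by apply: ge_sup => //; exists s.
have Er0 : (E (C r0) <= al%:E)%E.
  rewrite leNgt; apply/negP => h.
  have [V nV HV] := E_lsc h.
  have [d d0 Hd] := near_ball (extend0_cont nV).
  have [r [/andP[h1 h2] h3] h4] := sup_adherent d0 hS.
  have rr0 : r <= r0 by apply: ub_le_sup; [exists t|split; [rewrite h1 h2|]].
  have rV : V (C r).
    by rewrite -/r0 in h4; apply: Hd; rewrite distrC ger0_norm; lra.
  by have := HV _ rV; rewrite ltNge => /negP; apply.
have r0t' : r0 < t.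
  rewrite lt_neqAle r0t andbT; apply/eqP => h.
  by move: Est; rewrite -h ltNge Er0.
have Er0f : (E (C r0) < +oo)%E by apply: le_lt_trans Er0 _; rewrite ltry.
have r00 : 0 <= r0 by lra.
have := @flow_weighted (C r0) al r0 t _ erefl Er0f r00 r0t' => /(_ _)/wrap[].
  move=> r r1 r2; rewrite leNgt; apply/negP => h.
  have : r <= r0.
    apply: ub_le_sup; first by exists t.
    split; first by apply/andP; split; lra.
    by rewrite extend0_pos ?ltW//; lra.
  lra.
rewrite mdistxx expr0n /= add0r; set A := 2 / k * _.
have A0 : A <= 0.
  rewrite /A pmulr_rle0 ?divr_gt0// subr_le0 -lee_fin fin_E//.
have lt : expR (- k * t) < expR (- k * r0) by rewrite ltr_expR !mulNr ltrN2 ltr_pM2l.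
move=> H.
have : expR (- k * t) * mdist (C t) (C r0) ^+ 2 <= 0.
  have : (expR (- k * r0) - expR (- k * t)) * A <= 0.
    by apply: mulr_ge0_le0 => //; lra.
  lra.
rewrite pmulr_rle0 ?expR_gt0// => h.
have : mdist (C t) (C r0) ^+ 2 = 0 by apply/eqP; rewrite eq_le h sqr_ge0.
move/eqP; rewrite sqrf_eq0 => /eqP/mdist_positivity h'.
by move: Est; rewrite h' ltNge Er0.
Qed.

(** The variational inequality holds at some time before t and makes the energy finite
    there. *)
Lemma flow_fin z t : (E z < +oo)%E -> 0 < t -> (E (C t) < +oo)%E.
Proof.
move=> Ez t0; have [acc _ /(_ z) [N [mN N0 HN]]] := flow.
have nN : mu.-negligible N by exists N; split.
have [s /andP[s0 st] Ns] := negligible_itv nN t0.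
have [_ H] : derivable (fun s : R => mdist (c s) z ^+ 2) s 1 /\
    ((2^-1 * derive1 (fun s : R => mdist (c s) z ^+ 2) s
          + lambda / 2 * mdist (c s) z ^+ 2)%:E + E (c s) <= E z)%E.
  apply: contrapT => h; apply: Ns; apply: HN => /= h'; apply: h; exact: (h' s0).
have Es : (E (C s) < +oo)%E.
  rewrite extend0_pos// ltey; apply/eqP => h.
  by move: H; rewrite h addey// leye_eq => /eqP h2; rewrite h2 in Ez.
by apply: le_lt_trans (flow_nonincreasing (ltW s0) st Es) Es.
Qed.

(** By monotonicity E is at least E (c t) on [s, t], so [flow_weighted] applies with
    e = E (c t). *)
Lemma flow_discrete s t z : 0 <= s -> s < t -> (E z < +oo)%E ->
  expR (- k * (t - s)) * mdist (C t) z ^+ 2 <= mdist (C s) z ^+ 2 +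
    2 * ((1 - expR (- k * (t - s))) / k) * (fine (E z) - fine (E (C t))).
Proof.
move=> s0 st Ez; have t0 : 0 < t by lra.
have Et := flow_fin Ez t0.
have := @flow_weighted z (fine (E (C t))) s t _ erefl Ez s0 st => /(_ _)/wrap[].
  move=> r sr rt; have r0 : 0 < r by lra.
  have := flow_fin Ez r0 => Er.
  rewrite fin_E// -(extend0_pos x0 c r0); exact: flow_nonincreasing (ltW r0) rt Er.
have -> : - k * t = - k * s + - k * (t - s) by ring.
rewrite expRD -mulrA ler_pM2l ?expR_gt0//.
set p := expR _; set e := fine (E z) - _.
have -> : 2 * ((1 - p) / k) * e = 2 / k * e - p * (2 / k * e).
  by rewrite -mulrA; field; rewrite gt_eqF.
lra.
Qed.

End flow.

End evi.

(** * Contraction and slope estimates *)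

Section discrete_evi.
Context {R : realType} {X : metricType R}.
Variable E : X -> \bar R.
Hypothesis E_gtNy : forall x : X, (-oo < E x)%E.
Hypothesis E_lsc : lower_semicontinuous E.
Variable k : R.
Hypothesis k0 : 0 < k.
Implicit Types (c b : R -> X) (x y z : X) (s t : R).
Local Notation e x := (fine (E x)).

(** Integrated form of the evolution variational inequality.  The factor
    (1 - exp(- k r)) / k is the integral of exp(- k u) over [0, r]; it lies between
    exp(- k r) r and r. *)
Definition evi_discrete c := forall s t z, 0 <= s -> s < t -> (E z < +oo)%E ->
  (E (c t) < +oo)%E /\
  expR (- k * (t - s)) * mdist (c t) z ^+ 2 <= mdist (c s) z ^+ 2 +
    2 * ((1 - expR (- k * (t - s))) / k) * (e z - e (c t)).

Lemma evi_discrete_shift c h : 0 <= h -> evi_discrete c -> evi_discrete (fun t => c (t + h)).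
Proof.
move=> h0 dc s t z s0 st Ez; have := dc (s + h) (t + h) z _ _ Ez.
by rewrite opprD addrACA subrr addr0; apply; lra.
Qed.

Lemma step_le (r : R) : (1 - expR (- k * r)) / k <= r.
Proof.
rewrite ler_pdivrMr//; have := expR_ge1Dx (- k * r); lra.
Qed.

Lemma step_ge (r : R) : expR (- k * r) * r <= (1 - expR (- k * r)) / k.
Proof.
rewrite ler_pdivlMr//; set p := expR (- k * r).
have p0 : 0 < p by exact: expR_gt0.
have pq : p * expR (k * r) = 1 by rewrite -expRD mulNr addNr expR0.
have : p * (1 + k * r) <= p * expR (k * r) by rewrite ler_pM2l// expR_ge1Dx.
lra.
Qed.

Lemma expRN_ge r : r <= 1 -> expR (- k) <= expR (- k * r).
Proof. by move=> r1; rewrite ler_expR !mulNr lerN2 ler_piMr// ltW. Qed.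

Lemma evi_nonincreasing c s t : evi_discrete c -> 0 <= s -> s <= t ->
  (E (c s) < +oo)%E -> e (c t) <= e (c s).
Proof.
move=> dc s0; rewrite le_eqVlt => /predU1P[->//|st] Es.
have [_] := dc s t (c s) s0 st Es; rewrite mdistxx expr0n /= add0r.
set L := _ / k => H.
have L0 : 0 < L.
  apply: lt_le_trans (step_ge _); rewrite mulr_gt0 ?expR_gt0//; lra.
have : 0 <= 2 * L * (e (c s) - e (c t)).
  by apply: le_trans H; rewrite mulr_ge0 ?expR_ge0 ?sqr_ge0.
by rewrite pmulr_rge0 ?subr_ge0// mulr_gt0.
Qed.

(** The integrated inequality from s to t with z = c s. *)
Lemma evi_energy c s t : evi_discrete c -> 0 <= s -> s <= t -> t <= 1 ->
  (E (c s) < +oo)%E ->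
  mdist (c s) (c t) ^+ 2 <= (t - s) * (2 * expR k * (e (c s) - e (c t))).
Proof.
move=> dc s0 st t1 Es.
have es := evi_nonincreasing dc s0 st Es.
have [->|st'] := eqVneq s t; first by rewrite mdistxx expr0n /= [t - t]subrr mul0r.
have {}st : s < t by rewrite lt_neqAle st'.
have [_] := dc s t (c s) s0 st Es; rewrite mdistxx expr0n /= add0r metric_sym.
set p := expR _; set D := mdist _ _ ^+ 2 => H.
have pk : expR (- k) <= p by apply: expRN_ge; lra.
have h1 : expR (- k) * D <= 2 * (t - s) * (e (c s) - e (c t)).
  apply: (@le_trans _ _ (p * D)); first by rewrite ler_wpM2r ?sqr_ge0.
  apply: le_trans H _; rewrite ler_wpM2r ?subr_ge0// ler_pM2l//.
  exact: step_le.
have : expR k * (expR (- k) * D) <= expR k * (2 * (t - s) * (e (c s) - e (c t))).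
  by rewrite ler_pM2l ?expR_gt0.
rewrite mulrA -expRD subrr expR0 mul1r; lra.
Qed.

Lemma le_of_inv_nat (x y K : R) : (forall n : nat, x <= y + K / n.+1%:R) -> x <= y.
Proof.
move=> H; apply/ler_addgt0Pr => r r0.
have [n nK] : exists n : nat, K / r < n.+1%:R.
  exists (Num.truncn `|K / r|); apply: le_lt_trans (ler_norm _) _.
  by have /andP[] := truncn_itv (normr_ge0 (K / r)).
apply: le_trans (H n) _; rewrite lerD2l ler_pdivrMr// mulrC -ler_pdivrMr//.
exact: ltW.
Qed.

(** On a short step [u, v], test the inequality for c with b u, the one for b with c v,
    and add: the energies cancel up to E (b u) - E (b v), which telescopes, and an error of
    order (v - u)^2.  Subdividing [s, T] into n + 1 steps leaves an error of order
    1 / (n + 1). *)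
Lemma evi_contraction_fin c b s T : evi_discrete c -> evi_discrete b ->
  0 <= s -> s <= T -> (E (c s) < +oo)%E -> (E (b s) < +oo)%E ->
  expR (- (2 * k * (T - s))) * mdist (c T) (b T) ^+ 2 <= mdist (c s) (b s) ^+ 2.
Proof.
move=> dc db s0; rewrite le_eqVlt => /predU1P[-> _ _|sT Ecs Ebs].
  by rewrite subrr mulr0 oppr0 expR0 mul1r.
have fin (f : R -> X) t : evi_discrete f -> (E (f s) < +oo)%E -> s <= t -> (E (f t) < +oo)%E.
  move=> df Ef; rewrite le_eqVlt => /predU1P[<-//|st].
  by have [] := df s t (f s) s0 st Ef.
(* The energies are monotone, so their values at s and T bound them in between. *)
pose B := `|e (b s)| + `|e (b T)| + `|e (c s)| + `|e (c T)|.
have bnd v : s <= v -> v <= T -> e (b v) - e (c v) <= B.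
  move=> sv vT.
  have := evi_nonincreasing db s0 sv Ebs.
  have := evi_nonincreasing dc (le_trans s0 sv) vT (fin c v dc Ecs sv).
  have := ler_norm (e (b s)); have := ler_norm (- e (c T)).
  have := normr_ge0 (e (b T)); have := normr_ge0 (e (c s)).
  rewrite normrN /B; lra.
have step u v : s <= u -> u < v -> v <= T ->
  expR (- (2 * k * (v - u))) * mdist (c v) (b v) ^+ 2 <= mdist (c u) (b u) ^+ 2 +
    2 * (v - u) * (e (b u) - e (b v)) + 2 * k * (v - u) ^+ 2 * B.
  move=> su uv vT.
  have u0 : 0 <= u by lra.
  have Ebu := fin b u db Ebs su.
  have [Ecv H1] := dc u v (b u) u0 uv Ebu.
  have [Ebv H2] := db u v (c v) u0 uv Ecv.
  rewrite (metric_sym (b v)) (metric_sym (b u) (c v)) in H2.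
  have mb := evi_nonincreasing db u0 (ltW uv) Ebu.
  have bv := bnd v (ltW (le_lt_trans su uv)) vT.
  have -> : - (2 * k * (v - u)) = - k * (v - u) + - k * (v - u) by ring.
  rewrite expRD.
  have L1 := step_le (v - u); have L2 := step_ge (v - u).
  move: L1 L2 H1 H2; set p := expR _; set L := _ / k => L1 L2 H1 H2.
  have pk : p = 1 - k * L by rewrite /L mulrCA divff ?gt_eqF// mulr1; lra.
  have p0 : 0 <= p by exact: expR_ge0.
  clearbody L p.
  have L0 : 0 <= L by apply: le_trans L2; rewrite mulr_ge0//; lra.
  have H3 : p * (p * mdist (c v) (b v) ^+ 2) <= p * (mdist (c v) (b u) ^+ 2 + 2 * L * (e (c v) - e (b v))).
    by rewrite ler_wpM2l.
  have B0 : 0 <= B by rewrite /B !addr_ge0.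
  have h1 : L * (e (b u) - e (b v)) <= (v - u) * (e (b u) - e (b v)).
    by rewrite ler_wpM2r// subr_ge0.
  have h2 : k * L * L * (e (b v) - e (c v)) <= k * (v - u) ^+ 2 * B.
    apply: (@le_trans _ _ (k * L * L * B)).
      by apply: ler_wpM2l => //; rewrite !mulr_ge0 ?(ltW k0).
    rewrite ler_wpM2r// -mulrA ler_pM2l// expr2.
    by apply: ler_pM.
  rewrite -mulrA; apply: le_trans H3 _.
  move: H1 h1 h2; rewrite pk; lra.
apply: (@le_of_inv_nat _ _ (2 * (T - s) * (e (b s) - e (b T)) + 2 * k * (T - s) ^+ 2 * B)) => n.
have [h hE] : exists h, h = (T - s) / n.+1%:R by eexists.
have h0 : 0 < h by rewrite hE divr_gt0// subr_gt0.
have hn : h * n.+1%:R = T - s by rewrite hE mulfVK// pnatr_eq0.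
have ind i : (i <= n.+1)%N ->
  expR (- (2 * k * (h * i%:R))) * mdist (c (s + h * i%:R)) (b (s + h * i%:R)) ^+ 2 <=
  mdist (c s) (b s) ^+ 2 + 2 * h * (e (b s) - e (b (s + h * i%:R))) + 2 * k * h ^+ 2 * B * i%:R.
  elim: i => [_|i IH iN].
    by rewrite !mulr0 oppr0 expR0 mul1r !addr0 subrr mulr0 addr0.
  have {IH} := IH (ltnW iN).
  have -> : h * i.+1%:R = h * i%:R + h by rewrite -natr1; ring.
  set u := s + h * i%:R; rewrite addrA -/u => IH.
  have su : s <= u by rewrite lerDl mulr_ge0// ltW.
  have uT : u + h <= T.
    have : h * i.+1%:R <= h * n.+1%:R by rewrite ler_pM2l// ler_nat.
    by rewrite hn -natr1 /u; lra.
  have := step u (u + h) su (_ : u < u + h) uT; rewrite ltrDl => /(_ h0).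
  rewrite [u + h - u]addrAC subrr add0r => S.
  have -> : - (2 * k * (h * i%:R + h)) = - (2 * k * (h * i%:R)) + - (2 * k * h) by ring.
  rewrite expRD -mulrA.
  set q := expR (- (2 * k * (h * i%:R))) in IH *.
  have q1 : q <= 1.
    by rewrite /q -expR0 ler_expR oppr_le0 !mulr_ge0 ?(ltW k0) ?(ltW h0).
  have q0 : 0 <= q by exact: expR_ge0.
  have B0 : 0 <= B by rewrite /B !addr_ge0.
  have r0 : 0 <= 2 * h * (e (b u) - e (b (u + h))) + 2 * k * h ^+ 2 * B.
    apply: addr_ge0; last by rewrite !mulr_ge0 ?sqr_ge0 ?(ltW k0) ?(ltW h0).
    apply: mulr_ge0; first lra.
    have u00 : 0 <= u by lra.
    have uh : u <= u + h by lra.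
    by rewrite subr_ge0; exact: evi_nonincreasing db u00 uh (fin b u db Ebs su).
  have h1 : q * (2 * h * (e (b u) - e (b (u + h))) + 2 * k * h ^+ 2 * B) <=
      1 * (2 * h * (e (b u) - e (b (u + h))) + 2 * k * h ^+ 2 * B).
    by rewrite ler_wpM2r.
  have := ler_wpM2l q0 S; rewrite -natr1; lra.
have := ind n.+1 (leqnn _); rewrite hn subrKC => H.
apply: le_trans H _.
have nn : n.+1%:R != 0 :> R by rewrite pnatr_eq0.
rewrite -addrA lerD2l hE le_eqVlt; apply/orP; left; apply/eqP.
by field; rewrite addrC natr1.
Qed.

(** Positive times have finite energy, which [evi_contraction_fin] requires; time 0 is
    reached by continuity. *)
Lemma evi_contraction c b T : continuous c -> continuous b ->
  evi_discrete c -> evi_discrete b -> (exists z, (E z < +oo)%E) -> 0 < T ->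
  mdist (c T) (b T) <= expR (k * T) * mdist (c 0) (b 0).
Proof.
move=> cc cb dc db [z Ez] T0.
have cD : continuous (fun s => mdist (c s) (b s)).
  move=> t; apply/cvgrPdist_lt => r r0.
  have r20 : 0 < r / 2 by lra.
  have /metricType_numDomainType.cvgrPdist_lt/(_ _ r20) H1 := cc t.
  have /metricType_numDomainType.cvgrPdist_lt/(_ _ r20) H2 := cb t.
  move: H1 H2; apply: filterS2 => u h1 h2.
  by apply: le_lt_trans (mdist_lip2 _ _ _ _) _; lra.
have pos s : 0 < s -> s <= T -> mdist (c T) (b T) <= expR (k * T) * mdist (c s) (b s).
  move=> s0 sT.
  have [Ec _] := dc 0 s z (lexx _) s0 Ez; have [Eb _] := db 0 s z (lexx _) s0 Ez.
  have := evi_contraction_fin dc db (ltW s0) sT Ec Eb => H.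
  rewrite -ler_sqr ?nnegrE ?mulr_ge0 ?expR_ge0 ?mdist_ge0//.
  rewrite exprMn; apply: (@le_trans _ _ (expR (2 * k * (T - s)) * mdist (c s) (b s) ^+ 2)).
    have := ler_wpM2l (expR_ge0 (2 * k * (T - s))) H.
    by rewrite mulrA -expRD subrr expR0 mul1r.
  rewrite ler_wpM2r ?sqr_ge0// expr2 -expRD ler_expR.
  have : 0 <= k * s by rewrite mulr_ge0// ltW.
  lra.
rewrite leNgt; apply/negP => lt.
have ek : 0 < expR (k * T) by exact: expR_gt0.
pose r := mdist (c T) (b T) / expR (k * T) - mdist (c 0) (b 0).
have r0 : 0 < r by rewrite subr_gt0 ltr_pdivlMr// mulrC.
have /cvgrPdist_lt/(_ _ r0)/near_ball[d d0 Hd] := cD 0.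
pose s := Num.min T (d / 2).
have s0 : 0 < s by rewrite lt_min T0 /=; lra.
have sT : s <= T by rewrite ge_min lexx.
have sd : s <= d / 2 by rewrite ge_min lexx orbT.
have := Hd s; rewrite subr0 ger0_norm ?(ltW s0)// => /(_ _)/wrap[]; first lra.
rewrite ltr_norml => /andP[h _].
have := pos s s0 sT; rewrite mulrC -ler_pdivrMr// /r in h *; lra.
Qed.

Lemma slope_le x (M K : R) : 0 <= M -> 0 <= K -> (E x < +oo)%E ->
  (forall z, (E z < +oo)%E -> e x - e z <= M * mdist x z + K * mdist x z ^+ 2) ->
  (slope E x <= M%:E)%E.
Proof.
move=> M0 K0 Ex H; rewrite /slope asboolT//.
case: asboolP => // _.
apply/lee_addgt0Pr => r r0.
pose V := [set z | z != x /\ K * mdist x z < r].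
have nV : dnbhs x V.
  have : \forall z \near x, K * mdist x z < r.
    have rK : 0 < r / (K + 1) by rewrite divr_gt0//; lra.
    have /metricType_numDomainType.cvgrPdist_lt/(_ _ rK) := @cvg_id _ (nbhs x).
    apply: filterS => z; rewrite ltr_pdivlMr; last lra.
    by have := mdist_ge0 x z; lra.
  by apply: filterS => z h zx; split.
rewrite limf_esupE; apply: le_trans (ereal_inf_lbound _) _; first by exists V.
apply: ge_ereal_sup => _ [z [zx Kz] <-].
have d0 : 0 < mdist x z by rewrite mdist_gt0 eq_sym.
have [Ez|Ez] := ltP (E z) +oo%E; last first.
  have -> : E z = +oo%E by apply/eqP; rewrite -leye_eq.
  rewrite -(fin_E E_gtNy Ex) /= max_r ?leNye// mul0e -EFinD lee_fin; lra.
rewrite -(fin_E E_gtNy Ex) -(fin_E E_gtNy Ez) -EFinB -EFin_max -EFinM -EFinD lee_fin.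
rewrite ler_pdivrMr// ge_max; apply/andP; split; last by rewrite mulr_ge0//; lra.
apply: le_trans (H z Ez) _; rewrite mulrDl lerD2l expr2 mulrA ler_pM2r//.
exact: ltW.
Qed.

(** For a short step u = t - s, replacing d(c s, z) by d(c t, z) + M u in the integrated
    inequality gives E (c t) - E z <= exp(k) M d + (k / 2) d^2 up to an error of order u; then
    [slope_le] applies. *)
Lemma slope_left_quotient c t (M : R) : evi_discrete c -> 0 < t -> t <= 1 -> 0 <= M ->
  (exists z, (E z < +oo)%E) ->
  (forall d, 0 < d -> exists s, [/\ 0 <= s, s < t, t - s < d &
      mdist (c s) (c t) <= M * (t - s)]) ->
  (slope E (c t) <= (expR k * M)%:E)%E.
Proof.
move=> dc t0 t1 M0 [z0 Ez0] H.
have [Ect _] := dc 0 t z0 (lexx _) t0 Ez0.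
have k20 : 0 <= k / 2 by rewrite divr_ge0 ?(ltW k0).
apply: (@slope_le _ _ (k / 2)) => //; first by rewrite mulr_ge0// expR_ge0.
move=> z Ez; set D := mdist (c t) z.
have D0 : 0 <= D by exact: mdist_ge0.
have ek0 : 0 < expR k by exact: expR_gt0.
apply/ler_addgt0Pr => r r0.
pose d := r / (expR k * M ^+ 2 + 1).
have eM : 0 <= expR k * M ^+ 2 by rewrite mulr_ge0 ?sqr_ge0// ltW.
have d0 : 0 < d by rewrite divr_gt0//; lra.
have [s [s0 st std dst]] := H d d0.
pose u := t - s; rewrite -/u in std dst.
have u0 : 0 < u by rewrite /u; lra.
have u1 : u <= 1 by rewrite /u; lra.
have [_ dE] := dc s t z s0 st Ez; rewrite -/u -/D in dE.
have L2 := step_ge u.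
have pk := expRN_ge u1.
have pE : k * ((1 - expR (- k * u)) / k) = 1 - expR (- k * u).
  by rewrite mulrC mulfVK// gt_eqF.
move: (expR (- k * u)) ((_ - _) / k) L2 pk dE pE => p L L2 pk dE pE.
have uL : u <= expR k * L.
  have : expR (- k) * u <= L by apply: le_trans L2; rewrite ler_pM2r.
  move=> h; have : expR k * (expR (- k) * u) <= expR k * L by rewrite ler_pM2l.
  by rewrite mulrA -expRD subrr expR0 mul1r.
have L0 : 0 < L by rewrite -(pmulr_rgt0 _ ek0); exact: lt_le_trans uL.
have h1 : mdist (c s) z <= D + M * u.
  by apply: le_trans (metric_triangle _ (c t) _) _; rewrite addrC lerD2l.
have h2 : mdist (c s) z ^+ 2 <= (D + M * u) ^+ 2.
  by rewrite lerXn2r ?nnegrE ?mdist_ge0// addr_ge0// mulr_ge0// ltW.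
have h3 : 2 * L * (e (c t) - e z) <= 2 * L * (expR k * M * D + k / 2 * D ^+ 2 + r).
  have e1 : u * (2 * M * D) <= expR k * L * (2 * M * D).
    by rewrite ler_wpM2r// !mulr_ge0.
  have e2 : u * (M ^+ 2 * u) <= expR k * L * (M ^+ 2 * u).
    by rewrite ler_wpM2r// mulr_ge0 ?sqr_ge0// ltW.
  have e3 : expR k * M ^+ 2 * u <= r.
    apply: (@le_trans _ _ (expR k * M ^+ 2 * d)).
      by rewrite ler_wpM2l// ltW.
    rewrite /d mulrA ler_pdivrMr; last lra.
    by rewrite mulrC ler_pM2l//; lra.
  have e4 : L * (expR k * M ^+ 2 * u) <= L * r by rewrite ler_pM2l.
  have e5 : 0 <= L * r by rewrite mulr_ge0 ?ltW.
  have pE' : p = 1 - k * L by rewrite pE; ring.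
  by rewrite pE' in dE; lra.
by rewrite ler_pM2l in h3; [lra|rewrite mulr_gt0].
Qed.

Lemma slope_lt x (M : R) : 0 < M -> (slope E x < M%:E)%E ->
  (E x < +oo)%E /\ \forall w \near x, ((E w < +oo)%E -> e x - e w <= M * mdist x w).
Proof.
move=> M0; rewrite /slope; case: asboolP => // Ex; case: asboolP => [[_ [V nV VE]] _|_].
  split => //; apply: (@filterS _ (nbhs x) (nbhs_filter x) V _ _ nV) => w Vw _.
  have : (V `&` setT) w by [].
  by rewrite VE => ->; rewrite subrr mulr_ge0 ?mdist_ge0// ltW.
rewrite limf_esupE => /ereal_inf_lt[_ [V nV <-] VM].
split => //; apply: (@filterS _ (nbhs x) (nbhs_filter x) _ _ _ nV) => w Vw Ew.
have [->|wx] := eqVneq w x; first by rewrite subrr mulr_ge0 ?mdist_ge0// ltW.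
have d0 : 0 < mdist x w by rewrite mdist_gt0 eq_sym.
have : (Order.max (E x - E w) 0 * ((mdist x w)^-1)%:E < M%:E)%E.
  apply: le_lt_trans VM; apply: ereal_sup_ubound; exists w => //; exact: Vw.
rewrite -(fin_E E_gtNy Ex) -(fin_E E_gtNy Ew) -EFinB -EFin_max -EFinM lte_fin.
by rewrite ltr_pdivrMr// gt_max => /andP[/ltW].
Qed.

(** Run the flow from x for a short time u.  The slope bounds the energy it loses by M
    times its displacement, so the displacement is at most of order M u; inserting both
    bounds in the integrated inequality with test point z, and dividing by u, gives a bound
    on E x - E z itself. *)
Lemma slope_upper_gradient x c z (M : R) : evi_discrete c -> continuous c -> c 0 = x ->
  0 < M -> (slope E x < M%:E)%E -> (E z < +oo)%E ->
  e x - e z <= 2 * expR k ^+ 2 * M * mdist x z + k / 2 * mdist x z ^+ 2.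
Proof.
move=> dc cc c0 M0 /(slope_lt M0)[Ex nE] Ez.
set D := mdist x z; have D0 : 0 <= D by exact: mdist_ge0.
apply/ler_addgt0Pr => r r0.
have r20 : 0 < r / 2 by lra.
have kD : 0 <= k * (2 * D + 1) by rewrite mulr_ge0 ?(ltW k0)//; lra.
pose d := Num.min 1 (r / (k * (2 * D + 1) + 1)).
have d0 : 0 < d by rewrite lt_min ltr01 divr_gt0//; lra.
have d1 : d <= 1 by rewrite ge_min lexx.
have dr : k * (2 * D + 1) * d <= r.
  have : d <= r / (k * (2 * D + 1) + 1) by rewrite ge_min lexx orbT.
  by rewrite ler_pdivlMr; lra.
have nl : \forall w \near x, ((e x - r / 2)%:E < E w)%E.
  have [|V nV HV] := @E_lsc x (e x - r / 2).
    by rewrite -(fin_E E_gtNy Ex) lte_fin; lra.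
  by apply: (@filterS _ (nbhs x) (nbhs_filter x) V _ _ nV) => w; exact: HV.
have nd : \forall w \near x, mdist x w < d.
  by have /metricType_numDomainType.cvgrPdist_lt := @cvg_id _ (nbhs x); apply.
have c0' : c s @[s --> 0] --> x by rewrite -c0; exact: cc.
have [d' d'0 Hd'] := near_ball (c0' _ (filterI nE (filterI nl nd))).
pose u := Num.min 1 (d' / 2).
have u0 : 0 < u by rewrite lt_min ltr01 /=; lra.
have u1 : u <= 1 by rewrite ge_min lexx.
have ud : u <= d' / 2 by rewrite ge_min lexx orbT.
have [h1 [h2 h3]] : [set w | (E w < +oo)%E -> e x - e w <= M * mdist x w] (c u) /\
    ((e x - r / 2)%:E < E (c u))%E /\ mdist x (c u) < d.
  by apply: Hd'; rewrite subr0 ger0_norm ?(ltW u0)//; lra.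
have [Eu H1] := dc 0 u x (lexx _) u0 Ex.
have [_ H2] := dc 0 u z (lexx _) u0 Ez.
have {}h1 := h1 Eu.
rewrite -(fin_E E_gtNy Eu) lte_fin in h2.
rewrite subr0 c0 in H1 H2; rewrite mdistxx expr0n /= add0r (metric_sym (c u)) in H1.
rewrite -/D in H2.
have L1 := step_le u; have L2 := step_ge u; have pk := expRN_ge u1.
have pE : k * ((1 - expR (- k * u)) / k) = 1 - expR (- k * u).
  by rewrite mulrC mulfVK// gt_eqF.
have ek0 : 0 < expR k by exact: expR_gt0.
have p0 : 0 < expR (- k * u) by exact: expR_gt0.
move: (expR (- k * u)) ((_ - _) / k) p0 L1 L2 pk H1 H2 pE => p L p0 L1 L2 pk H1 H2 pE.
have uL : u <= expR k * L.
  have : expR (- k) * u <= L by apply: le_trans L2; rewrite ler_pM2r.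
  move=> h; have : expR k * (expR (- k) * u) <= expR k * L by rewrite ler_pM2l.
  by rewrite mulrA -expRD subrr expR0 mul1r.
have L0 : 0 < L by rewrite -(pmulr_rgt0 _ ek0); exact: lt_le_trans uL.
set del := mdist x (c u) in h1 h3 H1.
have del0 : 0 <= del by exact: mdist_ge0.
have delu : del <= 2 * expR k * M * u.
  have [->|dn0] := eqVneq del 0; first by rewrite !mulr_ge0 ?ltW.
  have delp : 0 < del by rewrite lt_neqAle eq_sym dn0.
  have a1 : expR (- k) * del ^+ 2 <= 2 * L * (M * del).
    apply: (@le_trans _ _ (p * del ^+ 2)); first by rewrite ler_wpM2r ?sqr_ge0.
    by apply: le_trans H1 _; rewrite ler_wpM2l// mulr_ge0// ltW.
  have a2 : 2 * L * (M * del) <= 2 * u * (M * del).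
    by rewrite ler_wpM2r ?mulr_ge0 ?(ltW M0)// ler_pM2l.
  have a3 : expR k * (expR (- k) * del ^+ 2) <= expR k * (2 * u * (M * del)).
    by rewrite ler_pM2l//; exact: le_trans a1 a2.
  rewrite mulrA -expRD subrr expR0 mul1r expr2 in a3.
  by rewrite -(ler_pM2r delp); lra.
have tr1 : mdist (c u) z <= D + del.
  by apply: le_trans (metric_triangle _ x _) _; rewrite addrC lerD2l metric_sym.
have tr2 : D <= mdist (c u) z + del.
  by apply: le_trans (metric_triangle _ (c u) _) _; rewrite addrC.
set d2 := mdist (c u) z in H2 tr1 tr2.
have d20 : 0 <= d2 by exact: mdist_ge0.
have b1 : D ^+ 2 - d2 ^+ 2 <= 2 * D * del.
  by apply: sqr_diff_le => //; rewrite lerBlDl.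
have b2 : d2 ^+ 2 <= (D + del) ^+ 2 by rewrite lerXn2r ?nnegrE// addr_ge0.
have b3 : k * ((D + del) ^+ 2) <= k * D ^+ 2 + r.
  have : k * (del * (2 * D + del)) <= k * ((2 * D + 1) * d).
    rewrite ler_pM2l// mulrC; apply: ler_pM => //; [by rewrite addr_ge0 ?mulr_ge0| |exact: ltW].
    by rewrite lerD2l (le_trans (ltW h3)).
  by rewrite sqrrD expr2; lra.
have b4 : 2 * D * del <= 2 * D * (2 * expR k * M * (expR k * L)).
  rewrite ler_wpM2l ?mulr_ge0//; apply: le_trans delu _.
  by rewrite ler_pM2l// !mulr_gt0.
have b5 : 2 * L * (e (c u) - e z) <= 2 * L * (2 * expR k ^+ 2 * M * D + k / 2 * D ^+ 2 + r / 2).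
  have c1 : L * (k * d2 ^+ 2) <= L * (k * (D + del) ^+ 2) by rewrite ler_pM2l// ler_pM2l.
  have c2 : L * (k * (D + del) ^+ 2) <= L * (k * D ^+ 2 + r) by rewrite ler_pM2l.
  have pE' : p = 1 - k * L by rewrite pE; ring.
  rewrite pE' in H2; rewrite expr2; lra.
rewrite ler_pM2l in b5; last by rewrite mulr_gt0.
lra.
Qed.

(** Let h be a small step.  Contraction makes the distance between c and its shift by h
    almost nonincreasing, so d(c (d - h), c d) is bounded, up to a factor exp(k), by each of
    the n + 1 displacements over the steps of length h that fill [d / 2, d].  Summing their
    squares, which the energy loss controls, bounds (n + 1) d(c (d - h), c d)^2, and
    [slope_left_quotient] concludes. *)
Lemma slope_regularized c (d : R) : evi_discrete c -> 0 < d -> d <= 1 ->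
  (E (c (d / 2)%R) < +oo)%E ->
  (slope E (c d) <= (expR k *
     Num.sqrt (4 * expR k ^+ 3 * (e (c (d / 2)) - e (c d)) / d))%R%:E)%E.
Proof.
move=> dc d0 d1 Ed.
have d20 : 0 <= d / 2 by lra.
have fin t : d / 2 <= t -> (E (c t) < +oo)%E.
  rewrite le_eqVlt => /predU1P[<-//|dt].
  by have [] := dc _ t (c (d / 2)) d20 dt Ed.
set De := e _ - e (c d).
have De0 : 0 <= De by rewrite subr_ge0; apply: evi_nonincreasing => //; lra.
have ek0 : 0 < expR k by exact: expR_gt0.
apply: (slope_left_quotient dc d0 d1 (sqrtr_ge0 _)); first by exists (c (d / 2)).
move=> r r0.
pose n := Num.truncn (d / r).
have n1 : d / r < n.+1%:R.
  by have /andP[] := truncn_itv (divr_ge0 (ltW d0) (ltW r0)).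
have [h hE] : exists h, h = d / 2 / n.+1%:R by eexists.
have h0 : 0 < h by rewrite hE !divr_gt0.
have hn : h * n.+1%:R = d / 2 by rewrite hE mulfVK// pnatr_eq0.
have hr : h < r.
  rewrite hE ltr_pdivrMr//; rewrite ltr_pdivrMr// mulrC in n1; lra.
have hd : h <= d / 2 by rewrite -hn -natr1 mulrDr mulr1 lerDr mulr_ge0// ltW.
exists (d - h); split; try lra.
have -> : d - (d - h) = h by ring.
set D := mdist _ _.
have key i : (i < n.+1)%N -> D ^+ 2 <= expR k ^+ 2 * (h * (2 * expR k *
    (e (c (d / 2 + h * i%:R)) - e (c (d / 2 + h * i.+1%:R))))).
  move=> iN.
  have i0 : 0 <= h * i%:R by rewrite mulr_ge0// ltW.
  have iS : h * i.+1%:R = h * i%:R + h by rewrite -natr1; ring.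
  have iN' : h * i.+1%:R <= d / 2 by rewrite -hn ler_pM2l// ler_nat.
  set s := d / 2 + h * i%:R.
  have sE : d / 2 + h * i.+1%:R = s + h by rewrite iS /s; ring.
  have s0 : 0 <= s by rewrite /s; lra.
  have sd : s <= d - h by rewrite /s; lra.
  have Es : (E (c s) < +oo)%E by apply: fin; rewrite /s; lra.
  have Esh : (E (c (s + h)%R) < +oo)%E by apply: fin; rewrite /s; lra.
  have := evi_contraction_fin dc (evi_discrete_shift (ltW h0) dc) s0 sd Es Esh.
  rewrite subrK -/D => H.
  have h1 : mdist (c s) (c (s + h)) ^+ 2 <= (s + h - s) * (2 * expR k * (e (c s) - e (c (s + h)))).
    apply: evi_energy => //; lra.
  rewrite sE; have hh : s + h - s = h by ring.
  rewrite hh in h1.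
  set Q := expR (- _) in H.
  have q : 1 <= expR k ^+ 2 * Q.
    rewrite expr2 /Q -!expRD -[leLHS]expR0 ler_expR.
    have : k * (d - h - s) <= k * 1 by rewrite ler_pM2l//; lra.
    lra.
  apply: (@le_trans _ _ (expR k ^+ 2 * (Q * D ^+ 2))).
    by rewrite mulrA ler_peMl// sqr_ge0.
  by rewrite ler_wpM2l ?sqr_ge0//; exact: le_trans H h1.
have sum i : (i <= n.+1)%N -> i%:R * D ^+ 2 <= expR k ^+ 2 * (h * (2 * expR k *
    (e (c (d / 2)) - e (c (d / 2 + h * i%:R))))).
  elim: i => [_|i IH iN]; first by rewrite mulr0 addr0 subrr !mulr0 mul0r.
  have := IH (ltnW iN); have := key i iN; rewrite -natr1; lra.
have := sum n.+1 (leqnn _); rewrite hn -splitr -/De => H.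
rewrite -(ger0_norm (ltW h0)) -sqrtr_sqr -sqrtrM; last first.
  by rewrite divr_ge0 ?(ltW d0)// !mulr_ge0 ?exprn_ge0// ltW.
rewrite -[D]ger0_norm ?mdist_ge0// -sqrtr_sqr ler_wsqrtr//.
have hdn : h * (2 * n.+1%:R) = d by lra.
have nn : 0 < n.+1%:R :> R by [].
rewrite -(ler_pM2l nn); apply: le_trans H _.
rewrite le_eqVlt; apply/orP; left; apply/eqP.
rewrite -{1}hdn; field.
by rewrite (gt_eqF h0) nat1r pnatr_eq0.
Qed.

End discrete_evi.

(** * Finiteness of the energy at the endpoints *)

Section good_points.
Context {R : realType}.
Local Notation mu := (@lebesgue_measure R).

(** A function somewhere does not exceed its mean.  Adding t to the primitive gives strict
    room, so that no null set can spoil the choice. *)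
Lemma integrable_good_points (G : R -> \bar R) : measurable_fun setT G ->
  (forall t, 0 <= G t)%E -> (\int[mu]_(t in `[0%R, 1%R]) G t < +oo)%E ->
  exists Theta : R -> R, forall a b, 0 <= a -> a < b -> b <= 1 ->
    exists t, [/\ a <= t <= b, (G t < +oo)%E & (b - a) * fine (G t) <= Theta b - Theta a].
Proof.
move=> mG G0 Goo.
have mGI : measurable_fun (`[0, 1]%classic : set R) G by exact: measurable_funTS.
have iG : mu.-integrable `[0, 1] G.
  apply/integrableP; split => //; apply: le_lt_trans Goo.
  by apply: ge0_le_integral => // [|x _]; [exact: measurableT_comp|rewrite gee0_abs].
pose F := (fine \o G) \_ (`[0, 1]%classic : set R).
have sF : summable_fun F.
  apply: summable_restrict => //.
  apply: (@le_integrable _ _ _ mu _ _ _ G) => //.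
    by apply/measurable_EFinP; apply: measurableT_comp.
  move=> x _ /=; rewrite ger0_norm ?fine_ge0// gee0_abs//.
  by have := G0 x; case: (G x) => //= *; rewrite leey.
have F0 x : 0 <= F x by rewrite /F patchE; case: ifP => //= _; rewrite fine_ge0.
(* The summand t makes the inequality between the two integrals below strict. *)
exists (fun t => prim F t + t) => a b a0 ab b1.
apply: contrapT => /forallNP H.
have [N [mN N0 HN]] := @integrable_ae _ _ _ mu _ (measurable_itv _) _ iG.
have sub : `[a, b]%classic `<=` (`[0, 1]%classic : set R).
  by move=> x /=; rewrite !in_itv/= => /andP[h1 h2]; apply/andP; split; lra.
have ba0 : 0 < b - a by lra.
pose V := prim F b - prim F a + (b - a).
have lo : (V%:E <= \int[mu]_(x in `[a, b]) G x)%E.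
  have -> : V%:E = (\int[mu]_(x in `[a, b]) cst (V / (b - a))%:E x)%E.
    rewrite integral_cst//= lebesgue_measure_itv/= lte_fin ab -EFinB -EFinM.
    by rewrite mulfVK// gt_eqF.
  have V0 : 0 <= V / (b - a).
    rewrite divr_ge0// ?(ltW ba0)// /V addr_ge0 ?(ltW ba0)// subr_ge0.
    by apply: prim_nd => //; exact: ltW.
  apply: ge0_le_integral => //.
  - by apply: measurable_funTS.
  - move=> x /=; rewrite in_itv/= => xab.
    have [Gx|Gx] := ltP (G x) +oo%E; last first.
      by apply: le_trans Gx; rewrite leey.
    have Gf : G x = (fine (G x))%:E by rewrite fineK// ge0_fin_numE.
    rewrite Gf lee_fin ler_pdivrMr//.
    have := H x => /not_and3P[//|//|/negP]; rewrite -ltNge => h.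
    by rewrite [leRHS]mulrC; apply/ltW; move: h; rewrite /V; lra.
have hi : (\int[mu]_(x in `[a, b]) G x <= (prim F b - prim F a)%:E)%E.
  rewrite prim_subE ?(ltW ab)//.
  apply: (@integral_le_measurable _ _ _ mu _ N) => //.
  - by move=> x _; rewrite lee_fin.
  - by apply: measurable_funTS; exact: measurable_int sF.
  move=> x xab Nx; rewrite /F patchE mem_set; last exact: sub.
  rewrite /= fineK//; apply: contrapT => h; apply: Nx; apply: HN => /= h'; apply: h; apply: h'.
  exact: sub.
have := le_trans lo hi; rewrite lee_fin /V; lra.
Qed.

End good_points.

Section endpoint.
Context {R : realType} {X : metricType R}.
Variable E : X -> \bar R.
Hypothesis E_gtNy : forall x : X, (-oo < E x)%E.
Hypothesis E_lsc : lower_semicontinuous E.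
Implicit Types (c : R -> X) (Phi Theta : R -> R).
Local Notation e x := (fine (E x)).

(** Every subinterval contains a time at which the squared slope is at most its mean.  The
    slope enters only through the global inequality that it implies, with s in its
    place. *)
Definition good_points c Theta (A K : R) := forall a b : R, 0 <= a -> a < b -> b <= 1 ->
  exists t s, [/\ a <= t <= b, (E (c t) < +oo)%E, 0 <= s, (b - a) * s ^+ 2 <= Theta b - Theta a &
    forall z, (E z < +oo)%E -> e (c t) - e z <= A * s * mdist (c t) z + K * mdist (c t) z ^+ 2].

(** With t n in the n-th dyadic interval, [step] bounds the increase of the energy from
    t n to t n.+1 through Young's inequality, and [sum] telescopes these bounds; lower
    semicontinuity at c 0 concludes. *)
Lemma endpoint_energy c Phi Theta (A K : R) : 0 <= A -> 0 <= K ->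
  energy_on 0 1 c Phi -> good_points c Theta A K -> (E (c 0%R) < +oo)%E.
Proof.
move=> A0 K0 eb gp.
pose q n : R := 2^-1 ^+ n.
have q0 n : 0 < q n by rewrite exprn_gt0.
have qS n : q n.+1 = q n / 2 by rewrite /q exprSr.
have q1 n : q n <= 1 by rewrite /q exprn_ile1//; lra.
pose P n (ts : R * R) := [/\ q n.+1 <= ts.1 <= q n,
    (E (c ts.1) < +oo)%E, 0 <= ts.2, q n.+1 * ts.2 ^+ 2 <= Theta (q n) - Theta (q n.+1) &
    forall z, (E z < +oo)%E -> e (c ts.1) - e z <= A * ts.2 * mdist (c ts.1) z
       + K * mdist (c ts.1) z ^+ 2].
have /choice[ts Hts] : forall n, exists ts, P n ts.
  move=> n; have [|t [s [h1 h2 h3 h4 h5]]] := gp (q n.+1) (q n) (ltW (q0 _)) _ (q1 n).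
    by rewrite qS; have := q0 n; lra.
  exists (t, s); split => //=.
  by move: h4; rewrite (_ : q n - q n.+1 = q n.+1)// qS; lra.
pose t n := (ts n).1.
have tq n : q n.+1 <= t n <= q n by have [] := Hts n.
have t0 n : 0 < t n by have /andP[h _] := tq n; exact: lt_le_trans h.
have t1 n : t n <= 1 by have /andP[_ h] := tq n; exact: le_trans h (q1 n).
have tS n : t n.+1 <= t n.
  by have /andP[_ h1] := tq n.+1; have /andP[h2 _] := tq n; exact: le_trans h1 h2.
have Th n : 0 <= Theta (q n) - Theta (q n.+1).
  by have [_ _ h1 h2 _] := Hts n; apply: le_trans h2; rewrite mulr_ge0 ?sqr_ge0// ltW.
have ThM a b : 0 <= a -> a <= b -> b <= 1 -> Theta a <= Theta b.
  move=> a0 + b1; rewrite le_eqVlt => /predU1P[->//|ab].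
  have [u [s [_ _ _ h _]]] := gp a b a0 ab b1.
  by rewrite -subr_ge0; apply: le_trans h; rewrite mulr_ge0 ?sqr_ge0//; lra.
have PhM := energy_on_nd eb.
have step n : e (c (t n.+1)) <= e (c (t n)) + A / 2 * (Theta (q n.+1) - Theta (q n.+2)) +
    (2 * A + K) * (Phi (t n) - Phi (t n.+1)).
  have [_ _ s0 sT H] := Hts n.+1; rewrite -/(t n.+1) in H.
  have [_ En _ _ _] := Hts n.
  have {H} := H _ En; rewrite -/(t n).
  have := eb _ _ (ltW (t0 n.+1)) (tS n) (t1 n).
  set d := mdist _ _; set s := (ts n.+1).2 in s0 sT *.
  set dP := Phi (t n) - _ => dE H.
  have dP0 : 0 <= dP by rewrite subr_ge0; apply: PhM => //; exact: ltW.
  have d2 : d ^+ 2 <= dP.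
    apply: le_trans dE _; rewrite ler_piMl//.
    by have := t1 n; have := t0 n.+1; lra.
  pose l := q n.+2.
  have l0 : 0 < l by exact: q0.
  have d2l : d ^+ 2 <= 4 * l * dP.
    apply: le_trans dE _; rewrite ler_wpM2r//.
    have /andP[_ h] := tq n; have := t0 n.+1.
    by rewrite /l !qS; lra.
  have sd : s * d <= (l * s ^+ 2 + 4 * dP) / 2.
    have := @young_sqr R (s * d) (l * s ^+ 2) (4 * dP) 1 _ _ ltr01.
    rewrite mul1r divr1 addrC; apply.
    - by rewrite mulr_ge0 ?sqr_ge0// ltW.
    - by rewrite mulr_ge0.
    rewrite exprMn mulrC [l * _]mulrC mulrAC -mulrA [leRHS]mulrC.
    have := ler_wpM2l (sqr_ge0 s) d2l; lra.
  have : A * (s * d) <= A * ((l * s ^+ 2 + 4 * dP) / 2) by rewrite ler_wpM2l.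
  have : K * d ^+ 2 <= K * dP by rewrite ler_wpM2l.
  have : A * (l * s ^+ 2) <= A * (Theta (q n.+1) - Theta (q n.+2)) by rewrite ler_wpM2l.
  lra.
have sum n : e (c (t n)) <= e (c (t 0%N)) + A / 2 * (Theta (q 1%N) - Theta (q n.+1)) +
    (2 * A + K) * (Phi (t 0%N) - Phi (t n)).
  elim: n => [|n IH]; first by rewrite !subrr !mulr0 !addr0.
  by have := step n; lra.
pose B := e (c (t 0%N)) + A / 2 * (Theta 1 - Theta 0) + (2 * A + K) * (Phi 1 - Phi 0).
have bnd n : (E (c (t n)) <= B%:E)%E.
  have [_ En _ _ _] := Hts n.
  rewrite -(fin_E E_gtNy En) lee_fin; apply: le_trans (sum n) _.
  have h1 : Theta (q 1%N) - Theta (q n.+1) <= Theta 1 - Theta 0.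
    by apply: lerB; apply: ThM => //; exact: ltW.
  have h2 : Phi (t 0%N) - Phi (t n) <= Phi 1 - Phi 0.
    by apply: lerB; apply: PhM => //; exact: ltW.
  have AK : 0 <= 2 * A + K by lra.
  have A2 : 0 <= A / 2 by lra.
  by rewrite /B !lerD// ler_wpM2l.
suff : (E (c 0%R) <= B%:E)%E by move=> h; apply: le_lt_trans h _; rewrite ltry.
rewrite leNgt; apply/negP => lt.
have [V nV HV] := E_lsc lt.
pose dP := Phi 1 - Phi 0.
have P0 : 0 <= dP by rewrite subr_ge0; exact: PhM.
have [r r0 rV] : exists2 r : R, 0 < r & forall w, mdist (c 0) w < r -> V w.
  by move: nV; rewrite -metricType_numDomainType.filter_from_mdist_nbhs => -[r /= r0 H]; exists r.
have rP : 0 < r ^+ 2 / (dP + 1) by rewrite divr_gt0 ?exprn_gt0//; lra.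
have [n nP] : exists n, q n < r ^+ 2 / (dP + 1).
  have h : `|2^-1 : R| < 1 by rewrite ger0_norm; lra.
  have /cvgrPdist_lt/(_ _ rP)[n _ Hn] := cvg_expr h.
  by exists n; have := Hn n (leqnn _); rewrite /= sub0r normrN (ger0_norm (ltW (q0 n))).
have : mdist (c 0) (c (t n)) < r.
  rewrite -(ltr_pXn2r (_ : (0 < 2)%N)) ?nnegrE ?mdist_ge0 ?(ltW r0)//.
  apply: le_lt_trans (eb _ _ (lexx 0) (ltW (t0 n)) (t1 n)) _; rewrite subr0.
  have h : t n * (Phi (t n) - Phi 0) <= q n * dP.
    apply: ler_pM.
    - exact: ltW.
    - by rewrite subr_ge0; apply: PhM => //; exact: ltW.
    - by have /andP[] := tq n.
    - by rewrite lerB//; apply: PhM => //; exact: ltW.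
  rewrite ltr_pdivlMr in nP; last lra.
  apply: le_lt_trans h _; apply: le_lt_trans nP.
  by rewrite ler_wpM2l ?(ltW (q0 n))//; lra.
by move=> /rV/HV; rewrite ltNge bnd.
Qed.

Lemma endpoint_energy_rev c Phi Theta (A K : R) : 0 <= A -> 0 <= K ->
  energy_on 0 1 c Phi -> good_points c Theta A K -> (E (c 1%R) < +oo)%E.
Proof.
move=> A0 K0 eb gp.
pose c' t := c (1 - t).
suff : (E (c' 0%R) < +oo)%E by rewrite /c' subr0.
apply: (@endpoint_energy c' (fun t => - Phi (1 - t)) (fun t => - Theta (1 - t)) A K A0 K0).
- move=> s t s0 st t1; have := eb (1 - t) (1 - s).
  rewrite metric_sym => h; rewrite /c'; apply: le_trans (h _ _ _) _; try lra.
- move=> a b a0 ab b1; have [|||t [s [h1 h2 h3 h4 h5]]] := gp (1 - b) (1 - a); try lra.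
  exists (1 - t), s; rewrite /c' /= subKr; split => //.
  + by case/andP: h1 => ? ?; apply/andP; split; lra.
  + lra.
Qed.

End endpoint.

(** * Subsequences *)

Section subsequences.

Definition extraction (phi : nat -> nat) := {homo phi : m n / (m < n)%N}.

Lemma extraction_comp phi psi : extraction phi -> extraction psi -> extraction (phi \o psi).
Proof. by move=> hp hq m n /hq/hp. Qed.

Lemma extraction_ge phi n : extraction phi -> (n <= phi n)%N.
Proof.
move=> hp; elim: n => // n IH; apply: leq_ltn_trans IH _; exact: hp.
Qed.

Lemma extraction_step phi : (forall n, phi n < phi n.+1)%N -> extraction phi.
Proof. by move=> h; apply: homo_ltn => //; exact: ltn_trans. Qed.

Lemma frequently_extraction (P : nat -> Prop) :
  (forall n, exists2 k, (n <= k)%N & P k) -> exists2 phi, extraction phi & forall n, P (phi n).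
Proof.
move=> H; have /choice[f Hf] : forall n, exists k, (n <= k)%N /\ P k.
  by move=> n; have [k] := H n; exists k.
pose phi := fix phi n := if n is m.+1 then f (phi m).+1 else f 0%N.
have hphi n : (phi n < phi n.+1)%N by have [] := Hf (phi n).+1.
exists phi; first exact: extraction_step hphi.
by case=> [|n] /=; [have [] := Hf 0%N|have [] := Hf (phi n).+1].
Qed.

Lemma not_near_extraction (P : nat -> Prop) : ~ (\forall n \near \oo, P n) ->
  exists2 phi, extraction phi & forall n, ~ P (phi n).
Proof.
move=> H; have h0 : forall n, exists2 k, (n <= k)%N & ~ P k; last exact: frequently_extraction h0.
move=> n.
apply: contrapT => /forall2NP h; apply: H; exists n => // k /= nk.
by have [//|/contrapT] := h k.
Qed.

End subsequences.

(** * Sequential convergence along subsequences *)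

Section sigma.
Context {R : realType} {X : metricType R}.
Variable E : X -> \bar R.
Variable scvg : (nat -> X) -> X -> Prop.

(** What is used of the topology sigma, as properties of a relation between sequences and
    points. *)
Definition scvg_spec := [/\ (forall x, scvg (fun=> x) x),
  (forall u l phi, scvg u l -> extraction phi -> scvg (u \o phi) l),
  (forall u, metric_bounded (range u) ->
     exists2 phi, extraction phi & exists l, scvg (u \o phi) l),
  (forall u v l m, scvg u l -> scvg v m ->
    ((mdist l m)%:E <= limn_einf (fun n => (mdist (u n) (v n))%:E))%E) &
  (forall u l, scvg u l -> (slope E l <= limn_einf (fun n => slope E (u n)))%E)].

Hypothesis spec : scvg_spec.
Let scvg_cst := let: And5 h _ _ _ _ := spec in h.
Let scvg_sub := let: And5 _ h _ _ _ := spec in h.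
Let scvg_cpt := let: And5 _ _ h _ _ := spec in h.
Let scvg_dist := let: And5 _ _ _ h _ := spec in h.
Let scvg_slope := let: And5 _ _ _ _ h := spec in h.

(** Subsequential convergence is what compactness yields at times outside the countable
    set of the diagonal argument; lower semicontinuity along the whole sequence survives it. *)
Definition sub_scvg (u : nat -> X) l := forall phi, extraction phi ->
  exists2 psi, extraction psi & scvg (u \o phi \o psi) l.

Lemma sub_scvg_of u l : scvg u l -> sub_scvg u l.
Proof.
move=> ul phi hp; exists id => //.
by have := scvg_sub ul hp.
Qed.

Lemma sub_scvg_dist u v l m (a : R) : sub_scvg u l -> sub_scvg v m -> a < mdist l m ->
  \forall n \near \oo, a < mdist (u n) (v n).
Proof.
move=> ul vm alm; apply: contrapT => /not_near_extraction[phi hphi H].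
have [psi hpsi us] := ul phi hphi.
have [chi hchi vs] := vm _ (extraction_comp hphi hpsi).
have us' := scvg_sub us hchi.
have := scvg_dist us' vs; apply/negP; rewrite -ltNge.
apply: le_lt_trans (_ : (_ <= a%:E)%E) _; last by rewrite lte_fin.
apply: limn_einf_le_freq => n; exists n => //; rewrite lee_fin /= leNgt; apply/negP; exact: H.
Qed.

Lemma sub_scvg_slope u l (a : \bar R) : sub_scvg u l -> (a < slope E l)%E ->
  \forall n \near \oo, (a < slope E (u n))%E.
Proof.
move=> ul al; apply: contrapT => /not_near_extraction[phi hphi H].
have [psi hpsi us] := ul phi hphi.
have := scvg_slope us; apply/negP; rewrite -ltNge; apply: le_lt_trans al.
by apply: limn_einf_le_freq => n; exists n => //; rewrite /= leNgt; apply/negP; exact: H.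
Qed.

(** The upper limit over the punctured neighbourhood could be -oo only if that
    neighbourhood filter were degenerate, that is, if x were isolated. *)
Lemma slope_ge0 x : (0 <= slope E x)%E.
Proof.
rewrite /slope; case: asboolP => // _; case: asboolP => // nis.
apply: limf_esup_ge0; last first.
  by move=> y; rewrite mule_ge0 ?lee_fin ?invr_ge0 ?mdist_ge0// le_max lexx orbT.
move=> h; apply: nis; split; first by rewrite inE.
exists [set x]; last by rewrite setIT.
by apply: (@filterS _ (nbhs x) (nbhs_filter x) _ _ _ h) => y /= hy; apply: contrapT => /eqP.
Qed.

(** A convergent sequence is bounded, so subsequences converge in the weak sense, and the
    joint lower semicontinuity of the distance identifies their limits. *)
Lemma cvg_sub_scvg (u : nat -> X) x : u @ \oo --> x -> sub_scvg u x.
Proof.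
move=> /metricType_numDomainType.cvgrPdist_lt ux phi hphi.
have [psi hpsi [l ul]] : exists2 psi, extraction psi & exists l, scvg (u \o phi \o psi) l.
  apply: scvg_cpt.
  have [N _ HN] := ux 1 ltr01.
  pose M := \sum_(i < N) mdist x (u i) + 1.
  have uM n : mdist x (u n) <= M.
    have [nN|Nn] := ltnP n N.
      rewrite /M (bigD1 (Ordinal nN))//= -addrA lerDl addr_ge0// sumr_ge0// => i _.
      exact: mdist_ge0.
    apply: le_trans (ltW (HN n Nn)) _; rewrite lerDr sumr_ge0// => i _.
    exact: mdist_ge0.
  exists (M + M) => _ _ [n _ <-] [m _ <-].
  apply: (@mdist_le_trans _ _ x); last exact: uM.
  by rewrite metric_sym; exact: uM.
exists psi => //; suff -> : x = l by [].
apply: mdist_positivity; apply/eqP; rewrite eq_le mdist_ge0 andbT leNgt; apply/negP => xl.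
have hh := extraction_comp hphi hpsi.
have xl2 : mdist x l / 2 < mdist x l by lra.
have xl0 : 0 < mdist x l / 2 by lra.
have [N _ HN] := sub_scvg_dist (sub_scvg_of (scvg_cst x)) (sub_scvg_of ul) xl2.
have [M _ HM] := ux _ xl0.
have := HN (maxn N M) (leq_maxl _ _) => /=; rewrite ltNge => /negP; apply.
apply/ltW/HM => /=; apply: leq_trans (leq_maxr N M) _.
exact: (extraction_ge _ hh).
Qed.

(** Weak lower semicontinuity implies lower semicontinuity for the metric, which makes
    the slope measurable along continuous curves. *)
Lemma slope_lsc : lower_semicontinuous (slope E).
Proof.
move=> x a ax; apply: contrapT => H.
have /choice[u Hu] : forall n : nat, exists y, mdist x y < n.+1%:R^-1 /\ (slope E y <= a%:E)%E.
  move=> n; apply: contrapT => /forallNP h; apply: H.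
  exists [set y | mdist x y < n.+1%:R^-1].
    rewrite -metricType_numDomainType.filter_from_mdist_nbhs.
    by exists n.+1%:R^-1 => //=; rewrite invr_gt0.
  by move=> y /= xy; have /not_andP[//|/negP] := h y; rewrite -ltNge.
have ux : u @ \oo --> x.
  apply/metricType_numDomainType.cvgrPdist_lt => r r0.
  have := near_infty_natSinv_lt (PosNum r0); apply: filterS => n /= nr.
  by have [h _] := Hu n; exact: lt_trans h nr.
have [N _ HN] := sub_scvg_slope (cvg_sub_scvg ux) ax.
by have [_] := Hu N; rewrite leNgt HN//=.
Qed.

Lemma measurable_slope (c : R -> X) : continuous c ->
  measurable_fun setT (fun t => (slope E (c t) ^+ 2)%E).
Proof.
move=> cc.
suff ms : measurable_fun setT (fun t => slope E (c t)).
  rewrite (_ : (fun t => _) = (fun t => slope E (c t) * slope E (c t))%E).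
    exact: emeasurable_funM.
  by apply/funext => t; rewrite expe2.
apply: lower_semicontinuous_measurable => t a at_.
have [V nV HV] := slope_lsc at_.
exists (c @^-1` V); first exact: cc nV.
by move=> s /HV.
Qed.

Section diagonal.
Variable u : nat -> nat -> X.
Hypothesis u_bounded : forall k, metric_bounded (range (u k)).

(** From rank k on, the diagonal sequence is a subsequence of the k-th extraction. *)
Lemma diagonal_extraction : exists2 D, extraction D &
  forall k, exists l, sub_scvg (u k \o D) l.
Proof.
have /choice[ext Hext] : forall p : nat * (nat -> nat), exists psi, extraction psi /\
    exists l, scvg (u p.1 \o p.2 \o psi) l.
  move=> [k phi] /=; have [psi hpsi [l ul]] : exists2 psi, extraction psi &
      exists l, scvg (u k \o phi \o psi) l.
    apply: scvg_cpt; have [M HM] := u_bounded k; exists M.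
    by move=> _ _ [n _ <-] [m _ <-]; apply: HM; [exists (phi n)|exists (phi m)].
  by exists psi; split => //; exists l.
pose Phi := fix Phi k := if k is k'.+1 then Phi k' \o ext (k', Phi k') else id.
have exte k : extraction (ext (k, Phi k)) by have [] := Hext (k, Phi k).
have hPhi k : extraction (Phi k).
  by elim: k => [|k IH] //=; exact: extraction_comp.
(* Phi (m + j) = Phi m \o tau m j: the factor by which later extractions refine the m-th one. *)
pose tau m := fix tau j := if j is j'.+1 then tau j' \o ext ((m + j')%N, Phi (m + j')%N) else id.
have tauE m j : Phi (m + j)%N = Phi m \o tau m j.
  by elim: j => [|j IH] /=; rewrite ?addn0// addnS /= IH.
have htau m j : extraction (tau m j).
  by elim: j => [|j IH] //=; exact: extraction_comp.
pose T m j := tau m j (m + j)%N.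
have hT m : extraction (T m).
  apply: (extraction_step (phi := T m)) => j; rewrite /T /= addnS; apply: htau.
  exact: (extraction_ge _ (exte _)).
pose D n := Phi n n.
have DT m j : D (m + j)%N = Phi m (T m j) by rewrite /D tauE.
have hD : extraction D.
  apply: (extraction_step (phi := D)) => n.
  have := hT n 0%N 1%N isT => /(hPhi n); rewrite -!DT addn0 addn1.
  by [].
exists D => // k.
have [_ [l ul]] := Hext (k, Phi k); exists l => phi hphi.
pose m := k.+1.
pose j n := (phi (n + m) - m)%N.
have jE n : (m + j n)%N = phi (n + m)%N.
  by rewrite /j subnKC// (leq_trans (leq_addl n m))// (extraction_ge _ hphi).
have hj : extraction j.
  move=> a b ab; rewrite -(ltn_add2l m) !jE; apply: hphi; by rewrite ltn_add2r.
exists (fun n => (n + m)%N); first by move=> a b ab; rewrite ltn_add2r.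
have := scvg_sub ul (extraction_comp (hT m) hj).
suff -> : (u k \o Phi k \o ext (k, Phi k)) \o (T m \o j) = u k \o D \o phi \o addn^~ m by [].
by apply/funext => n /=; rewrite -jE DT.
Qed.

End diagonal.

End sigma.

(** * Limits of curves of bounded energy *)

Section limit_curve.
Context {R : realType} {X : metricType R}.
Local Notation mu := (@lebesgue_measure R).
Variable E : X -> \bar R.
Variable scvg : (nat -> X) -> X -> Prop.
Hypothesis spec : scvg_spec E scvg.

Definition rat01 (n : nat) : R := clamp (ratr (odflt 0%Q (unpickle n))).

Lemma rat01_dense (t r : R) : 0 <= t <= 1 -> 0 < r -> exists n, `|t - rat01 n| < r.
Proof.
move=> t01 r0.
have [q] : exists q : rat, ratr q \in `]t, (t + r)[.
  by apply: rat_in_itvoo; lra.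
rewrite in_itv/= => /andP[h1 h2].
exists (pickle q); rewrite /rat01 pickleK /=.
have := clamp_lip (ltW h1); have := clamp_nd (ltW h1); rewrite (clamp_id t01) => h3 h4.
by rewrite distrC ger0_norm; lra.
Qed.

(** Extract along all rational times at once.  At another time t, two subsequential limits
    are both close to the limits at rational times near t, by the Hoelder estimate and the
    lower semicontinuity of the distance, so they coincide. *)
Lemma curves_compact (g : nat -> R -> X) (x : X) (K : R) : 0 <= K ->
  (forall n, g n 0 = x) ->
  (forall n s t, 0 <= s -> s <= t -> t <= 1 -> mdist (g n s) (g n t) ^+ 2 <= (t - s) * K) ->
  exists D c, extraction D /\
    forall t, 0 <= t <= 1 -> sub_scvg scvg (fun n => g (D n) t) (c t).
Proof.
move=> K0 g0 gK.
have gKr n s t : 0 <= s <= 1 -> 0 <= t <= 1 ->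
    mdist (g n s) (g n t) <= Num.sqrt (`|t - s| * K).
  move=> /andP[s0 s1] /andP[t0 t1].
  rewrite -[leLHS]ger0_norm ?mdist_ge0// -sqrtr_sqr ler_wsqrtr//.
  have [st|/ltW ts] := leP s t; first by rewrite ger0_norm ?subr_ge0//; exact: gK.
  by rewrite metric_sym distrC ger0_norm ?subr_ge0//; exact: gK.
have bnd t : 0 <= t <= 1 -> forall n, mdist x (g n t) <= Num.sqrt K.
  move=> t01 n; rewrite -(g0 n); apply: le_trans (gKr n 0 t _ t01) _.
    by rewrite lexx ler01.
  apply: ler_wsqrtr; rewrite subr0; case/andP: t01 => h1 h2.
  by rewrite ger0_norm// ler_piMl.
have mb t : 0 <= t <= 1 -> forall phi : nat -> nat, metric_bounded (range (fun n => g (phi n) t)).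
  move=> t01 phi; exists (Num.sqrt K + Num.sqrt K) => _ _ [n _ <-] [m _ <-].
  apply: (@mdist_le_trans _ _ x); last exact: bnd.
  by rewrite metric_sym; exact: bnd.
have [D hD HD] := @diagonal_extraction _ _ _ _ spec (fun k n => g n (rat01 k))
  (fun k => mb (rat01 k) (clamp_in _) id).
have /choice[l Hl] := HD.
have lim_dist t phi y : 0 <= t <= 1 -> extraction phi ->
    scvg (fun n => g (D (phi n)) t) y -> forall k, mdist y (l k) <= Num.sqrt (`|t - rat01 k| * K).
  move=> t01 hphi gy k; rewrite leNgt; apply/negP => lt.
  have ls : sub_scvg scvg (fun n => g (D (phi n)) (rat01 k)) (l k).
    move=> psi hpsi; have [chi hchi H] := Hl k _ (extraction_comp hphi hpsi).
    by exists chi.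
  have [N _ HN] := sub_scvg_dist spec (sub_scvg_of spec gy) ls lt.
  have := HN N (leqnn N); rewrite ltNge => /negP; apply.
  rewrite distrC; apply: gKr => //; exact: clamp_in.
have lim_uniq t phi psi y z : 0 <= t <= 1 -> extraction phi -> extraction psi ->
    scvg (fun n => g (D (phi n)) t) y -> scvg (fun n => g (D (psi n)) t) z -> y = z.
  move=> t01 hphi hpsi gy gz; apply: mdist_positivity; apply/eqP.
  rewrite eq_le mdist_ge0 andbT; apply/ler_addgt0Pr => r r0; rewrite add0r.
  have r2 : 0 < (r / 2) ^+ 2 / (K + 1).
    by rewrite divr_gt0 ?exprn_gt0//; lra.
  have [k kr] := rat01_dense t01 r2.
  have sq : Num.sqrt (`|t - rat01 k| * K) <= r / 2.
    have r20 : 0 <= r / 2 by lra.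
    apply: (@le_trans _ _ (Num.sqrt ((r / 2) ^+ 2))); last by rewrite sqrtr_sqr ger0_norm.
    apply: ler_wsqrtr.
    rewrite ltr_pdivlMr in kr; last lra.
    by apply: le_trans (ltW kr); rewrite ler_wpM2l//; lra.
  have h1 := lim_dist t phi y t01 hphi gy k.
  have h2 := lim_dist t psi z t01 hpsi gz k.
  have := metric_triangle y (l k) z; rewrite (metric_sym (l k)); lra.
have [_ _ cpt _ _] := spec.
have ex_lim t phi : 0 <= t <= 1 -> exists2 psi, extraction psi &
    exists y, scvg (fun n => g (D (phi (psi n))) t) y.
  by move=> t01; exact: (cpt _ (mb t t01 (D \o phi))).
have /choice[c Hc] : forall t, exists y, 0 <= t <= 1 ->
    exists2 psi, extraction psi & scvg (fun n => g (D (psi n)) t) y.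
  move=> t; have [t01|] := boolP ((0 <= t <= 1)%R : bool); last by exists x.
  by have [psi hpsi [y gy]] := ex_lim t id t01; exists y => _; exists psi.
exists D, c; split => // t t01 phi hphi.
have [psi hpsi [y gy]] := ex_lim t phi t01.
exists psi => //; have [chi hchi gc] := Hc t t01.
by rewrite (lim_uniq t chi (phi \o psi) (c t) y t01 hchi (extraction_comp hphi hpsi) gc gy).
Qed.

(** The functions Phi n are bounded and converge pointwise along an ultrafilter, which
    replaces Helly's selection theorem. *)
Lemma limit_energy (g : nat -> R -> X) (Phi : nat -> R -> R) (c : R -> X) (K : R)
    (U : set_system nat) : UltraFilter U -> \oo `<=` U ->
  (forall n, energy_on 0 1 (g n) (Phi n)) -> (forall n, Phi n 1 - Phi n 0 <= K) ->
  (forall t, 0 <= t <= 1 -> sub_scvg scvg (fun n => g n t) (c t)) ->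
  exists2 Psi, energy_on 0 1 c Psi & (Phi n 1 - Phi n 0) @[n --> U] --> Psi 1 - Psi 0.
Proof.
move=> UU ooU eb PK gc.
have PU : ProperFilter U := @ultra_proper _ _ UU.
have bnd t : 0 <= t <= 1 -> forall n, 0 <= Phi n t - Phi n 0 <= K.
  move=> /andP[t0 t1] n; apply/andP; split.
    by rewrite subr_ge0; exact: (energy_on_nd (eb n)).
  apply: le_trans (PK n); rewrite lerB//; exact: (energy_on_nd (eb n)).
have /choice[Psi HPsi] : forall t, exists y : R, 0 <= t <= 1 ->
    (Phi n t - Phi n 0) @[n --> U] --> y.
  move=> t; have [t01|] := boolP ((0 <= t <= 1)%R : bool); last by exists 0.
  pose f n := Phi n t - Phi n 0.
  have PfU : ProperFilter (f @ U) by exact: fmap_proper_filter.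
  have [|y [_ fy]] := @segment_compact R 0 K (f @ U) PfU.
    by apply: (@filterS _ U _ setT) filterT => n _ /=; rewrite in_itv/=; exact: bnd.
  exists y => _ V nV.
  have [//|UV] := @in_ultra_setVsetC _ U (f @^-1` V) UU.
  have fV : (f @ U) (~` V) by exact: UV.
  by have [z [h1 h2]] := fy _ _ fV nV.
have cvgD s t : 0 <= s <= 1 -> 0 <= t <= 1 ->
    (Phi n t - Phi n s) @[n --> U] --> Psi t - Psi s.
  move=> s01 t01.
  have -> : (fun n => Phi n t - Phi n s) =
      ((fun n => Phi n t - Phi n 0) - (fun n => Phi n s - Phi n 0)).
    by apply/funext => n; rewrite !fctE; ring.
  exact: cvgB (HPsi t t01) (HPsi s s01).
have i0 : 0 <= (0 : R) <= 1 by rewrite lexx ler01.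
have i1 : 0 <= (1 : R) <= 1 by rewrite lexx ler01.
exists Psi; last exact: cvgD.
move=> s t s0 st t1.
have s01 : 0 <= s <= 1 by apply/andP; split; lra.
have t01 : 0 <= t <= 1 by apply/andP; split; lra.
have Pst := cvgD s t s01 t01.
have ndPsi : 0 <= Psi t - Psi s.
  rewrite leNgt; apply/negP => lt.
  have [n] := @filter_ex _ U _ _ (cvgr_lt _ Pst _ lt).
  by rewrite ltNge subr_ge0 (energy_on_nd (eb n)).
set d := mdist _ _; set L := (t - s) * _.
have L0 : 0 <= L by rewrite /L mulr_ge0 ?ndPsi// subr_ge0.
rewrite leNgt; apply/negP => lt.
pose m := (L + d ^+ 2) / 2.
have m0 : 0 <= m by rewrite /m; have := sqr_ge0 d; lra.
have md : Num.sqrt m < d.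
  have -> : d = Num.sqrt (d ^+ 2) by rewrite sqrtr_sqr ger0_norm ?mdist_ge0.
  by rewrite ltr_sqrt /m; lra.
have Lst : (t - s) * (Phi n t - Phi n s) @[n --> U] --> L by apply: cvgM => //; exact: cvg_cst.
have Lm : L < m by rewrite /m; lra.
have [n [h1 h2]] := @filter_ex _ U _ _ (filterI (ooU _ (sub_scvg_dist spec (gc s s01) (gc t t01) md))
  (cvgr_lt _ Lst _ Lm)).
have := eb n s t s0 st t1; rewrite leNgt => /negP; apply.
apply: lt_le_trans h2 _; rewrite -(sqr_sqrtr m0) lerXn2r ?nnegrE ?sqrtr_ge0 ?mdist_ge0//.
exact: ltW.
Qed.

Lemma sq_le_liminf (s : \bar R) (u : nat -> \bar R) : (0 <= s)%E -> (forall n, 0 <= u n)%E ->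
  (forall a : R, (a%:E < s)%E -> \forall n \near \oo, (a%:E < u n)%E) ->
  (s ^+ 2 <= limn_einf (fun n => u n ^+ 2))%E.
Proof.
move=> s0 u0 H.
have key a : 0 <= a -> (a%:E < s)%E -> ((a ^+ 2)%:E <= limn_einf (fun n => u n ^+ 2))%E.
  move=> a0 /H h; apply: limn_einf_ge; move: h; apply: filterS => n an.
  by rewrite EFin_expe !expe2 lee_pmul ?lee_fin// ltW.
have L0 : (0 <= limn_einf (fun n => u n ^+ 2))%E.
  by apply: limn_einf_ge; apply: nearW => n; rewrite expe2 mule_ge0.
case: s s0 H key => [s| |] //.
- rewrite lee_fin => s0 _ key.
  apply/lee_addgt0Pr => r r0.
  have [->|sn0] := eqVneq s 0.
    by rewrite expe2 mule0; apply: adde_ge0 => //; rewrite lee_fin ltW.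
  have sp : 0 < s by rewrite lt_neqAle eq_sym sn0.
  pose h := Num.min s (r / (2 * s)).
  have h0 : 0 < h by rewrite lt_min sp divr_gt0// mulr_gt0.
  have hs : h <= s by rewrite ge_min lexx.
  have hr : h * (2 * s) <= r.
    by rewrite -ler_pdivlMr ?mulr_gt0// ge_min lexx orbT.
  have := key (s - h) _ _; rewrite subr_ge0 lte_fin ltrBlDr ltrDl => /(_ hs h0) k.
  apply: (@le_trans _ _ (((s - h) ^+ 2)%:E + r%:E)%E); last by rewrite leeD2r.
  rewrite -EFin_expe -EFinD lee_fin sqrrB.
  have := sqr_ge0 h; lra.
- move=> _ _ key; suff -> : limn_einf (fun n => u n ^+ 2)%E = +oo%E by rewrite leey.
  apply: eq_infty => r.
  apply: le_trans (key (`|r| + 1) _ (ltry _)); last by rewrite addr_ge0.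
  rewrite lee_fin; apply: le_trans (ler_norm _) _.
  by have := normr_ge0 r; rewrite sqrrD1; have := sqr_ge0 `|r|; lra.
Qed.

(** Fatou's lemma bounds the integral of the lower limit of the squared slopes, which is
    measurable; the squared slope along c lies below that lower limit at every time. *)
Lemma limit_slope_energy (g : nat -> R -> X) (c : R -> X) :
  (forall n, continuous (g n \o clamp)) ->
  (forall t, 0 <= t <= 1 -> sub_scvg scvg (fun n => g n t) (c t)) ->
  (\int[mu]_(t in `[0%R, 1%R]) (slope E (c t) ^+ 2) <=
   limn_einf (fun n => \int[mu]_(t in `[0%R, 1%R]) (slope E (g n t) ^+ 2)))%E.
Proof.
move=> gc H.
have mg n : measurable_fun (`[0, 1]%classic : set R) (fun t => (slope E (g n t) ^+ 2)%E).
  have h : measurable_fun (`[0, 1]%classic : set R)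
      (fun t => (slope E ((g n \o clamp) t) ^+ 2)%E).
    by apply: measurable_funTS; exact: (measurable_slope spec (gc n)).
  apply: eq_measurable_fun h => t; rewrite inE/= in_itv/= => t01.
  by rewrite clamp_id.
apply: (@le_trans _ _ (\int[mu]_(t in `[0%R, 1%R])
    limn_einf (fun n => slope E (g n t) ^+ 2))%E); last first.
  by apply: (@fatou _ _ _ mu _ _ (fun n t => slope E (g n t) ^+ 2)%E) => // n x _;
    rewrite expe2 mule_ge0 ?(slope_ge0 E).
apply: (@integral_le_measurable _ _ _ mu _ set0) => //.
- by move=> t _; rewrite expe2 mule_ge0 ?slope_ge0.
- move=> t _; apply: limn_einf_ge; apply: nearW => n.
  by rewrite expe2 mule_ge0 ?slope_ge0.
- exact: measurable_fun_limn_einf.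
move=> t /=; rewrite in_itv/= => t01 _.
apply: sq_le_liminf; [exact: slope_ge0|by move=> n; exact: slope_ge0|].
by move=> a; exact: sub_scvg_slope (H t t01).
Qed.

End limit_curve.

(** * Concatenation and reparametrization *)

Section concatenation.
Context {R : realType} {X : metricType R}.
Implicit Types (c : R -> X) (Phi : R -> R).

(** The Cauchy-Schwarz inequality in the plane, for vectors whose squared coordinates
    are the factors. *)
Lemma cauchy_schwarz2 (d d1 d2 u1 v1 u2 v2 : R) : 0 <= d -> 0 <= d1 -> 0 <= d2 ->
  0 <= u1 -> 0 <= v1 -> 0 <= u2 -> 0 <= v2 ->
  d <= d1 + d2 -> d1 ^+ 2 <= u1 * v1 -> d2 ^+ 2 <= u2 * v2 ->
  d ^+ 2 <= (u1 + u2) * (v1 + v2).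
Proof.
move=> d0 d10 d20 u10 v10 u20 v20 dd h1 h2.
apply: (@le_trans _ _ ((d1 + d2) ^+ 2)); first by rewrite lerXn2r ?nnegrE ?addr_ge0.
have : 2 * (d1 * d2) <= u1 * v2 + u2 * v1.
  rewrite -ler_sqr ?nnegrE ?addr_ge0 ?mulr_ge0//.
  have : (d1 * d2) ^+ 2 <= (u1 * v1) * (u2 * v2).
    by rewrite exprMn; apply: ler_pM => //; exact: sqr_ge0.
  have := sqr_ge0 (u1 * v2 - u2 * v1).
  rewrite !exprMn !expr2; lra.
rewrite sqrrD; lra.
Qed.

Lemma energy_on_cat a m b c Phi1 Phi2 : a <= m -> m <= b ->
  energy_on a m c Phi1 -> energy_on m b c Phi2 ->
  energy_on a b c (fun t => if t <= m then Phi1 t else Phi2 t - Phi2 m + Phi1 m).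
Proof.
move=> am mb e1 e2 s t as_ st tb.
have [tm|mt] := leP t m.
  by rewrite (le_trans st tm); exact: e1.
have [sm|ms] := leP s m; last first.
  by have := e2 s t (ltW ms) st tb; lra.
have h1 := e1 s m as_ sm (lexx m); have h2 := e2 m t (lexx m) (ltW mt) tb.
have -> : t - s = (m - s) + (t - m) by ring.
have -> : Phi2 t - Phi2 m + Phi1 m - Phi1 s = (Phi1 m - Phi1 s) + (Phi2 t - Phi2 m) by ring.
apply: (cauchy_schwarz2 _ _ _ _ _ _ _ (metric_triangle _ (c m) _) h1 h2); rewrite ?mdist_ge0 ?subr_ge0//.
- exact: (energy_on_nd e1).
- exact: ltW.
- by apply: (energy_on_nd e2) => //; exact: ltW.
Qed.

(** Reparametrization by the primitive P of the density: choose times th a with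
    P(th a) = P 0 + a L.  The map th may jump where P is constant, but c does not move there,
    since the distance between c s and c t is at most |P t - P s|. *)
Lemma lipschitz_reparam c : ac_on 0 1 c -> exists c' (L : R),
  [/\ 0 <= L, c' 0 = c 0, c' 1 = c 1 & forall s t, 0 <= s -> s <= t -> t <= 1 ->
    mdist (c' s) (c' t) <= L * (t - s)].
Proof.
move=> acc; have [g [sg g0 dg _]] := ac_on_domI ler01 acc.
have cP := prim_cont sg; have nd := prim_nd sg g0.
pose L := prim g 1 - prim g 0.
have L0 : 0 <= L by rewrite subr_ge0 nd.
have d01 s t : 0 <= s <= 1 -> 0 <= t <= 1 -> mdist (c s) (c t) <= `|prim g t - prim g s|.
  move=> s01 t01; have [st|/ltW ts] := leP s t.
    rewrite ger0_norm ?subr_ge0 ?nd//; have := dg s t st.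
    by rewrite /= !clampI_id.
  rewrite metric_sym distrC ger0_norm ?subr_ge0 ?nd//; have := dg t s ts.
  by rewrite /= !clampI_id.
have /choice[th Hth] : forall a, exists t, 0 <= a <= 1 -> 0 <= t <= 1 /\ prim g t = prim g 0 + a * L.
  move=> a; have [/andP[a0 a1]|] := boolP ((0 <= a <= 1)%R : bool); last by exists 0.
  have Pc : {within `[0, 1], continuous (prim g)} by exact: continuous_subspaceT.
  have vI : Num.min (prim g 0) (prim g 1) <= prim g 0 + a * L <= Num.max (prim g 0) (prim g 1).
    rewrite min_l ?max_r ?nd//; apply/andP; split; first by rewrite lerDl mulr_ge0.
    have : a * L <= 1 * L by rewrite ler_wpM2r.
    by rewrite /L; lra.
  have [t] := IVT ler01 Pc vI.
  by rewrite in_itv/= => t01 tE; exists t.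
have same s t : 0 <= s <= 1 -> 0 <= t <= 1 -> prim g s = prim g t -> c s = c t.
  move=> s01 t01 st; apply: mdist_positivity; apply/eqP; rewrite eq_le mdist_ge0 andbT.
  by apply: le_trans (d01 _ _ s01 t01) _; rewrite st subrr normr0.
have i0 : is_true (0 <= (0:R) <= 1) by rewrite lexx ler01.
have i1 : is_true (0 <= (1:R) <= 1) by rewrite lexx ler01.
exists (c \o th), L; split => //=.
- have [t01 tE] := Hth 0 i0.
  by apply: same => //; rewrite tE mul0r addr0.
- have [t01 tE] := Hth 1 i1.
  by apply: same => //; rewrite tE mul1r /L addrC subrK.
- move=> s t s0 st t1.
  have si : is_true (0 <= s <= 1) by rewrite s0 (le_trans st).
  have ti : is_true (0 <= t <= 1) by rewrite t1 (le_trans s0).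
  have [s01 sE] := Hth s si; have [t01 tE] := Hth t ti.
  apply: le_trans (d01 _ _ s01 t01) _.
  rewrite sE tE; have -> : prim g 0 + t * L - (prim g 0 + s * L) = L * (t - s) by ring.
  by rewrite ger0_norm// mulr_ge0// subr_ge0.
Qed.

End concatenation.

(** * A curve of finite cost *)

Section bridge.
Context {R : realType} {X : metricType R}.
Variable E : X -> \bar R.
Hypothesis E_gtNy : forall x : X, (-oo < E x)%E.
Hypothesis E_lbnd : forall B : set X, metric_bounded B ->
  exists cB : R, forall x, B x -> (cB%:E <= E x)%E.
Variable k : R.
Hypothesis k0 : 0 < k.
Variable F : X -> R -> X.
Hypothesis F_cont : forall x, continuous (F x).
Hypothesis F0 : forall x, F x 0 = x.
Hypothesis F_evi : forall x, evi_discrete E k (F x).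
Local Notation mu := (@lebesgue_measure R).
Local Notation e x := (fine (E x)).
Implicit Types (c : R -> X) (x y z : X) (s t : R).

(** Two-sided, so that it can be transported through a reversal of time. *)
Definition speed_le c t (M : R) := forall eta, 0 < eta -> exists2 d, 0 < d &
  forall s, `|s - t| < d -> mdist (c s) (c t) <= (M + eta) * `|s - t|.

Lemma density_speed_le c w t : dominated c (prim w) -> expands (prim w) t (w t) -> 0 <= w t ->
  speed_le c t (w t).
Proof.
move=> dw ex w0 eta eta0.
have [d d0 H] := near_ball (ex eta eta0); exists d => // s /H h.
have {}h : `|prim w s - prim w t| <= (w t + eta) * `|s - t|.
  rewrite mulrDl -{1}(ger0_norm w0) -normrM.
  have -> : prim w s - prim w t = w t * (s - t) + (prim w s - prim w t - w t * (s - t)) by ring.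
  by apply: le_trans (ler_normD _ _) _; rewrite lerD2l.
apply: le_trans h; have [st|/ltW ts] := leP s t.
  by rewrite distrC; apply: le_trans (dw _ _ st) (ler_norm _).
by rewrite metric_sym; apply: le_trans (dw _ _ ts) (ler_norm _).
Qed.

Lemma slope_speed_le c t (M : R) : evi_discrete E k c -> 0 < t -> t <= 1 -> 0 <= M ->
  (exists z, (E z < +oo)%E) -> speed_le c t M -> (slope E (c t) <= (expR k * M)%:E)%E.
Proof.
move=> dc t0 t1 M0 Ez sp; apply/lee_addgt0Pr => r r0.
have ek : 0 < expR k by exact: expR_gt0.
pose eta := r / expR k.
have eta0 : 0 < eta by rewrite divr_gt0.
rewrite -EFinD; have -> : expR k * M + r = expR k * (M + eta).
  by rewrite /eta mulrDr; congr (_ + _); field; rewrite gt_eqF.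
apply: (slope_left_quotient E_gtNy k0) => //; first by rewrite addr_ge0// ltW.
move=> d d0; have [d' d'0 H] := sp eta eta0.
pose h := Num.min (t / 2) (Num.min (d / 2) (d' / 2)).
have h0 : 0 < h by rewrite !lt_min !divr_gt0.
have [h1 [h2 h3]] : h <= t / 2 /\ h <= d / 2 /\ h <= d' / 2.
  by rewrite !ge_min !lexx !orbT.
have nh : `|t - h - t| = h by rewrite addrAC subrr add0r normrN ger0_norm// ltW.
exists (t - h); split; try lra.
have -> : t - (t - h) = h by ring.
have := H (t - h); rewrite nh; apply; lra.
Qed.

Lemma flow_fin_energy x t : (E x < +oo)%E -> 0 <= t -> (E (F x t) < +oo)%E.
Proof.
move=> Ex; rewrite le_eqVlt => /predU1P[<-|t0]; first by rewrite F0.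
by have [] := @F_evi x 0 t x (lexx _) t0 Ex.
Qed.

Lemma flow_contraction z1 z2 t : (exists z, (E z < +oo)%E) -> 0 < t ->
  mdist (F z1 t) (F z2 t) <= expR (k * t) * mdist z1 z2.
Proof.
move=> Ez t0; have := @evi_contraction _ _ E k k0 (F z1) (F z2) t.
by rewrite !F0; apply.
Qed.

(** The slope at time t is controlled by the energy lost on [t / 2, t]: the energy at
    t / 2 is bounded above by comparison with x, and the energy at t is bounded below because
    the points reached at time t form a bounded set. *)
Lemma flow_slope_bounded x t (r : R) : (E x < +oo)%E -> 0 < t -> t <= 1 -> 0 <= r ->
  exists2 M, 0 <= M & forall z, mdist z x <= r -> (slope E (F z t) <= M%:E)%E.
Proof.
move=> Ex t0 t1 r0.
have Ez : exists z, (E z < +oo)%E by exists x.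
have t20 : 0 < t / 2 by lra.
pose B := [set F z t | z in [set z | mdist z x <= r]].
have [cB HcB] : exists cB : R, forall y, B y -> (cB%:E <= E y)%E.
  apply: E_lbnd; exists (expR (k * t) * (r + r)) => _ _ [z1 h1 <-] [z2 h2 <-].
  apply: le_trans (flow_contraction _ _ Ez t0) _; rewrite ler_wpM2l ?expR_ge0//.
  apply: le_trans (metric_triangle _ x _) _.
  by apply: lerD => //; rewrite metric_sym.
pose l := 2 * ((1 - expR (- k * (t / 2))) / k).
have l0 : 0 < l.
  rewrite mulr_gt0//; apply: lt_le_trans (step_ge k0 _); rewrite mulr_gt0 ?expR_gt0//.
pose U := e x + r ^+ 2 / l.
exists (expR k * Num.sqrt (4 * expR k ^+ 3 * (U - cB) / t)); first by rewrite mulr_ge0 ?expR_ge0 ?sqrtr_ge0.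
move=> z zx; have [Et2 H] := @F_evi z 0 (t / 2) x (lexx _) t20 Ex.
have [Et _] := @F_evi z 0 t x (lexx _) t0 Ex.
rewrite subr0 F0 -/l in H.
have cBt : cB <= e (F z t).
  by rewrite -lee_fin fin_E//; apply: HcB; exists z.
have eU : e (F z (t / 2)) <= U.
  have h : 0 <= mdist z x ^+ 2 + l * (e x - e (F z (t / 2))).
    by apply: le_trans H; rewrite mulr_ge0 ?expR_ge0 ?sqr_ge0.
  have zr : mdist z x ^+ 2 <= r ^+ 2 by rewrite lerXn2r ?nnegrE ?mdist_ge0.
  have : - (r ^+ 2 / l) <= e x - e (F z (t / 2)).
    rewrite -mulNr ler_pdivrMr//; lra.
  by rewrite /U; lra.
apply: le_trans (slope_regularized E_gtNy k0 (F_evi z) t0 t1 Et2) _.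
rewrite lee_fin ler_wpM2l ?expR_ge0// ler_wsqrtr//.
rewrite ler_wpM2r ?invr_ge0 ?(ltW t0)// ler_wpM2l ?mulr_ge0 ?exprn_ge0 ?expR_ge0//.
by apply: lerB.
Qed.

Section curve.
Variables (x y : X) (c : R -> X) (L : R).
Hypotheses (Ex : (E x < +oo)%E) (Ey : (E y < +oo)%E) (L0 : 0 <= L).
Hypotheses (c0 : c 0 = x) (c1 : c 1 = y).
Hypothesis c_lip : forall s t, 0 <= s -> s <= t -> t <= 1 -> mdist (c s) (c t) <= L * (t - s).

(** The pieces match because the middle one is the flow image of a curve from x to y. *)
Definition bridge (t : R) : X :=
  if t <= 3^-1 then F x t else if t <= 2 / 3 then F (c (3 * t - 1)) 3^-1 else F y (1 - t).

Lemma bridge1 t : t <= 3^-1 -> bridge t = F x t.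
Proof. by rewrite /bridge => ->. Qed.

Lemma bridge2 t : 3^-1 <= t -> t <= 2 / 3 -> bridge t = F (c (3 * t - 1)) 3^-1.
Proof.
move=> h1 h2; rewrite /bridge h2; case: leP => // h3.
have -> : t = 3^-1 by lra.
by rewrite mulfV// subrr c0.
Qed.

Lemma bridge3 t : 2 / 3 <= t -> bridge t = F y (1 - t).
Proof.
move=> h; rewrite /bridge ifF; last by apply/negbTE; rewrite -ltNge; lra.
case: leP => // h2; have -> : t = 2 / 3 by lra.
have -> : 3 * (2 / 3) - 1 = 1 :> R by lra.
by rewrite c1; congr F; lra.
Qed.

(** Energy loss on the outer pieces ([evi_energy]), contraction on the middle one. *)
Lemma bridge_energy : exists Phi, energy_on 0 1 bridge Phi.
Proof.
have Ez : exists z, (E z < +oo)%E by exists x.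
have ek : 0 < expR k by exact: expR_gt0.
pose L2 := expR (k * 3^-1) * (3 * L).
have L20 : 0 <= L2 by rewrite mulr_ge0 ?expR_ge0 ?mulr_ge0.
have h1 : energy_on 0 3^-1 bridge (fun t => - (2 * expR k * e (F x t))).
  move=> s t s0 st t1; rewrite !bridge1; try lra.
  apply: le_trans (evi_energy k0 (F_evi x) s0 st _ _) _; first lra.
    exact: flow_fin_energy.
  by rewrite ler_wpM2l ?subr_ge0//; lra.
have h2 : energy_on 3^-1 (2 / 3) bridge (fun t => L2 ^+ 2 * t).
  move=> s t s0 st t1; rewrite !bridge2; try lra.
  have t30 : 0 < 3^-1 :> R by lra.
  have D : mdist (F (c (3 * s - 1)) 3^-1) (F (c (3 * t - 1)) 3^-1) <= L2 * (t - s).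
    apply: le_trans (flow_contraction _ _ Ez t30) _.
    rewrite /L2 -mulrA ler_wpM2l ?expR_ge0//.
    by apply: le_trans (c_lip _ _ _) _; lra.
  apply: (@le_trans _ _ ((L2 * (t - s)) ^+ 2)).
    by rewrite lerXn2r ?nnegrE ?mdist_ge0 ?mulr_ge0 ?subr_ge0.
  by rewrite le_eqVlt; apply/orP; left; apply/eqP; ring.
have h3 : energy_on (2 / 3) 1 bridge (fun t => 2 * expR k * e (F y (1 - t))).
  move=> s t s0 st t1; rewrite !bridge3; try lra.
  rewrite metric_sym.
  have u0 : 0 <= 1 - t by lra.
  have uv : 1 - t <= 1 - s by lra.
  have v1 : 1 - s <= 1 by lra.
  apply: le_trans (evi_energy k0 (F_evi y) u0 uv v1 _) _.
    exact: flow_fin_energy.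
  have -> : 1 - s - (1 - t) = t - s by ring.
  by rewrite ler_wpM2l ?subr_ge0//; lra.
have h12 := energy_on_cat (_ : 0 <= 3^-1) (_ : 3^-1 <= 2 / 3) h1 h2.
have h123 := energy_on_cat (_ : 0 <= 2 / 3) (_ : 2 / 3 <= 1) (h12 _ _) h3.
by eexists; apply: h123; lra.
Qed.

(** At almost every time the speed of the curve is at most the square-integrable density
    of [energy_density].  On the outer pieces the curve runs along a flow, so the slope is at
    most exp(k) times the speed; the middle piece is covered by [flow_slope_bounded]. *)
Lemma bridge_slope_energy :
  (\int[mu]_(t in `[0%R, 1%R]) (slope E (bridge t) ^+ 2) < +oo)%E.
Proof.
have Ez : exists z, (E z < +oo)%E by exists x.
have [Phi eb] := bridge_energy.
have [w [sw w0 dw sw2 _]] := energy_density eb.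
have [N [mN N0 HN]] := prim_expands sw.
have t30 : 0 < 3^-1 :> R by lra.
have t31 : 3^-1 <= 1 :> R by lra.
have [M M0 HM] := flow_slope_bounded Ex t30 t31 L0.
pose G t : R := expR k ^+ 2 * (w t ^+ 2) + M ^+ 2 * indI 0 1 t.
have sG : summable_fun G by apply: summable_lin => //; exact: summable_indI.
have G0 t : 0 <= G t by rewrite addr_ge0 ?mulr_ge0 ?sqr_ge0 ?indI_ge0.
have mG : measurable_fun (`[0, 1]%classic : set R) (EFin \o G).
  by have /measurable_int := summable_funS (measurable_itv `[0%R, 1%R]) sG.
pose N' : set R := N `|` ([set 0] `|` [set 1] `|` [set 3^-1] `|` [set 2 / 3]).
have nN' : mu.-negligible N'.
  have n1 (r : R) : mu.-negligible [set r].
    by exists [set r]; split => //; exact: lebesgue_measure_set1.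
  by apply: negligibleU; [exists N; split|repeat apply: negligibleU].
have [N2 [mN2 N20 N'2]] := nN'.
apply: (@le_lt_trans _ _ (\int[mu]_(t in `[0%R, 1%R]) (G t)%:E)%E); last first.
  by rewrite -prim_subE// ltry.
apply: (@integral_le_measurable _ _ _ mu _ N2) => //.
- by move=> t _; rewrite sqre_ge0.
- by move=> t _; rewrite lee_fin.
move=> t /=; rewrite in_itv/= => /andP[t0 t1] Nt.
have {Nt} : ~ N' t by move=> h; apply: Nt; exact: N'2.
move=> /not_orP[Nt /not_orP[/not_orP[/not_orP[/eqP nt0 /eqP nt1] /eqP nt3] /eqP nt23]].
have {}t0 : 0 < t by rewrite lt_neqAle eq_sym nt0.
have {}t1 : t < 1 by rewrite lt_neqAle nt1.
have ex : expands (prim w) t (w t) by apply: contrapT => h; exact: Nt (HN _ h).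
have sp := density_speed_le dw ex (w0 t).
have finish (A : R) : 0 <= A -> A ^+ 2 <= G t -> (slope E (bridge t) <= A%:E)%E ->
    (slope E (bridge t) ^+ 2 <= (G t)%:E)%E.
  move=> A0 AG sA; apply: (@le_trans _ _ (A%:E ^+ 2)%E); last by rewrite -EFin_expe lee_fin.
  by rewrite !expe2; apply: lee_pmul => //; exact: (slope_ge0 E).
have i1 : indI 0 1 t = 1 :> R by rewrite indIE (ltW t0) (ltW t1).
have outer : (slope E (bridge t) <= (expR k * w t)%:E)%E -> (slope E (bridge t) ^+ 2 <= (G t)%:E)%E.
  apply: finish; first by rewrite mulr_ge0 ?expR_ge0.
  by rewrite exprMn /G lerDl mulr_ge0 ?sqr_ge0 ?indI_ge0.
have [tt|tt] := ltP t 3^-1.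
  apply: outer; rewrite bridge1 ?(ltW tt)//.
  apply: slope_speed_le => //; first exact: ltW.
  move=> eta eta0; have [d d0 H] := sp eta eta0.
  exists (Num.min d (Num.min t (3^-1 - t))); first by rewrite !lt_min d0 t0 subr_gt0.
  move=> s; rewrite !lt_min => /and3P[h1 h2 h3].
  move: h2 h3; rewrite !ltr_norml => /andP[h2 _] /andP[_ h3].
  have si : is_true (0 <= s <= 1) by apply/andP; split; lra.
  have ti : is_true (0 <= t <= 1) by apply/andP; split; lra.
  by have := H s h1; rewrite /= !clamp_id// !bridge1//; lra.
have {nt3}tt : 3^-1 < t by rewrite lt_neqAle eq_sym nt3.
have [tt2|tt2] := ltP t (2 / 3).
  apply: (finish M) => //; first by rewrite /G i1 mulr1 lerDr mulr_ge0 ?sqr_ge0.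
  rewrite bridge2 ?(ltW tt) ?(ltW tt2)//; apply: HM.
  rewrite -c0 metric_sym; apply: le_trans (c_lip _ _ _) _; try lra.
  by have : L * (3 * t - 1 - 0) <= L * 1; [rewrite ler_wpM2l//; lra|lra].
have {nt23}tt2 : 2 / 3 < t by rewrite lt_neqAle eq_sym nt23.
apply: outer; rewrite bridge3 ?(ltW tt2)//.
have u0 : 0 < 1 - t by lra.
have u1 : 1 - t <= 1 by lra.
apply: slope_speed_le => //.
move=> eta eta0; have [d d0 H] := sp eta eta0.
exists (Num.min d (Num.min (1 - t) (t - 2 / 3))); first by rewrite !lt_min d0 !subr_gt0 t1.
move=> s; rewrite !lt_min => /and3P[h1 h2 h3].
have sE : `|s - (1 - t)| = `|1 - s - t| by rewrite -normrN; congr `|_|; ring.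
rewrite sE in h1 h2 h3 *.
have := H (1 - s) h1; move: h2 h3; rewrite !ltr_norml => /andP[_ h2] /andP[h3 _].
have si : is_true (0 <= 1 - s <= 1) by apply/andP; split; lra.
have ti : is_true (0 <= t <= 1) by apply/andP; split; lra.
by rewrite /= !clamp_id// !bridge3 ?subKr//; lra.
Qed.

End curve.
End bridge.

(** * Consequences of the standing assumptions *)

Section reduction.
Context {R : realType} {X : metricType R}.
Variable E : X -> \bar R.
Hypothesis E_gtNy : forall x : X, (-oo < E x)%E.

Lemma scvg_of_assumptionS : assumptionS E -> exists scvg, scvg_spec E scvg.
Proof.
move=> [sigma] /= [_ cpt dist slo].
exists (fun (u : nat -> X) l => (u : nat -> Topological.Pack sigma) @ \oo --> (l : Topological.Pack sigma)).
split => //.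
- by move=> x; exact: cvg_cst.
- move=> u l phi ul hphi; apply: cvg_comp ul.
  move=> A [n _ nA]; exists n => // m /= nm; apply: nA => /=.
  exact: leq_trans nm (extraction_ge _ hphi).
Qed.

(** k = |lambda| + 1 is positive and at least - lambda, as [flow_discrete] requires. *)
Lemma discrete_flows : assumptionA2 E -> assumptionA3 E -> exists2 k : R, 0 < k &
  exists F : X -> R -> X, [/\ (forall x, continuous (F x)), (forall x, F x 0 = x) &
    (forall x, evi_discrete E k (F x))].
Proof.
move=> [lscE _ _] [lambda HF].
pose k := `|lambda| + 1.
have k0 : 0 < k by rewrite ltr_wpDl.
have kl : - lambda <= k.
  by have := ler_norm (- lambda); rewrite normrN /k; lra.
have [f Hf] := choice HF.
exists k; first exact: k0.
exists (fun x => extend0 x (f x)); split.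
- by move=> x; exact: extend0_cont (Hf x).
- by move=> x; exact: extend0_0.
- move=> x s t z s0 st Ez; split.
    by apply: (flow_fin E_gtNy lscE k0 kl (Hf x) Ez); lra.
  exact: (flow_discrete E_gtNy lscE k0 kl (Hf x) s0 st Ez).
Qed.

End reduction.

(** * The cost functional *)

Section existence.
Context {R : realType} {X : metricType R}.
Variable E : X -> \bar R.
Local Notation mu := (@lebesgue_measure R).
Implicit Types (c : R -> X) (Phi : R -> R).

Lemma clamp_in01 c t : t \in `[0%R, 1%R]%classic -> c (clamp t) = c t :> X.
Proof. by rewrite inE/= in_itv/= => t01; rewrite clamp_id. Qed.

Lemma energy_on_within c Phi : energy_on 0 1 c Phi -> {within `[0%R, 1%R], continuous c}.
Proof.
move=> eb.
apply: (@subspace_eq_continuous _ (`[0%R, 1%R]%classic : set R) _ (c \o clamp)).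
  by move=> t ht /=; exact: clamp_in01.
apply: continuous_subspaceT; exact: energy_on_cont eb.
Qed.

Lemma action_ge0 c : (0 <= action c)%E.
Proof.
rewrite /action; case: asboolP => // _; rewrite mule_ge0 ?lee_fin ?invr_ge0//.
by apply: integral_ge0 => t _; exact: sqre_ge0.
Qed.

Lemma slope_energy_ge0 c : (0 <= slope_energy E c)%E.
Proof.
rewrite /slope_energy mule_ge0 ?lee_fin ?invr_ge0//.
by apply: integral_ge0 => t _; exact: sqre_ge0.
Qed.

Lemma cost_ge0 (eps : R) c : (0 <= schrodinger_cost E eps c)%E.
Proof.
by rewrite adde_ge0 ?action_ge0// mule_ge0 ?slope_energy_ge0// lee_fin sqr_ge0.
Qed.

Lemma finite_cost (eps : R) c : 0 < eps -> (schrodinger_cost E eps c < +oo)%E ->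
  (action c < +oo)%E /\ (\int[mu]_(t in `[0%R, 1%R]) (slope E (c t) ^+ 2) < +oo)%E.
Proof.
move=> eps0 H; split.
  apply: le_lt_trans H; rewrite /schrodinger_cost leeDl// mule_ge0 ?slope_energy_ge0//.
  by rewrite lee_fin sqr_ge0.
rewrite ltey; apply/eqP => Soo; move: H; rewrite /schrodinger_cost /slope_energy Soo.
rewrite gt0_muley ?lte_fin ?invr_gt0// gt0_muley ?lte_fin ?exprn_gt0//.
by rewrite addey ?ltxx// gt_eqF// (lt_le_trans (ltNyr 0))// action_ge0.
Qed.

Lemma cost_le (eps a S : R) c : (action c <= a%:E)%E ->
  (\int[mu]_(t in `[0%R, 1%R]) (slope E (c t) ^+ 2) <= S%:E)%E ->
  (schrodinger_cost E eps c <= (a + eps ^+ 2 * (2^-1 * S))%:E)%E.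
Proof.
move=> ca cS; rewrite EFinD (EFinM (eps ^+ 2)) (EFinM 2^-1); apply: leeD => //.
apply: lee_wpmul2l; first by rewrite lee_fin sqr_ge0.
by apply: lee_wpmul2l => //; rewrite lee_fin invr_ge0.
Qed.

Lemma cost_ge (eps a S : R) c : (a%:E <= action c)%E ->
  (S%:E <= \int[mu]_(t in `[0%R, 1%R]) (slope E (c t) ^+ 2))%E ->
  ((a + eps ^+ 2 * (2^-1 * S))%:E <= schrodinger_cost E eps c)%E.
Proof.
move=> ca cS; rewrite EFinD (EFinM (eps ^+ 2)) (EFinM 2^-1); apply: leeD => //.
apply: lee_wpmul2l; first by rewrite lee_fin sqr_ge0.
by apply: lee_wpmul2l => //; rewrite lee_fin invr_ge0.
Qed.

End existence.

(** * Solvability *)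

Section solvability.
Context {R : realType} {X : metricType R}.
Variable E : X -> \bar R.
Hypothesis E_gtNy : forall x : X, (-oo < E x)%E.
Variable scvg : (nat -> X) -> X -> Prop.
Hypothesis spec : scvg_spec E scvg.
Local Notation mu := (@lebesgue_measure R).
Local Notation e x := (fine (E x)).
Implicit Types (c : R -> X) (x y z : X).

(** The slope does not exceed its root mean square at suitable times, and there
    [slope_upper_gradient] holds with the slope itself as constant, by letting M decrease
    to it. *)
Lemma finite_cost_endpoints (k : R) (F : X -> R -> X) c : lower_semicontinuous E -> 0 < k ->
  (forall x, continuous (F x)) -> (forall x, F x 0 = x) -> (forall x, evi_discrete E k (F x)) ->
  (action c < +oo)%E -> (\int[mu]_(t in `[0%R, 1%R]) (slope E (c t) ^+ 2) < +oo)%E ->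
  (E (c 0%R) < +oo)%E /\ (E (c 1%R) < +oo)%E.
Proof.
move=> lscE k0 Fc F0 Fd /finite_action_energy[_ [Phi [eb _]]] Soo.
pose G t := (slope E ((c \o clamp) t) ^+ 2)%E.
have mG : measurable_fun setT G := measurable_slope spec (energy_on_cont eb).
have Goo : (\int[mu]_(t in `[0%R, 1%R]) G t < +oo)%E.
  apply: le_lt_trans Soo; rewrite le_eqVlt; apply/orP; left; apply/eqP.
  by apply: eq_integral => t t01; rewrite /G /= clamp_in01.
have G0 t : (0 <= G t)%E by exact: sqre_ge0.
have [Th HT] := integrable_good_points mG G0 Goo.
pose A := 2 * expR k ^+ 2; pose K := k / 2.
have A0 : 0 <= A by rewrite mulr_ge0 ?sqr_ge0.
have K0 : 0 <= K by rewrite divr_ge0 ?(ltW k0).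
suff gp : good_points E c Th A K.
  by split; [exact: (endpoint_energy E_gtNy lscE A0 K0 eb gp)|exact: (endpoint_energy_rev E_gtNy lscE A0 K0 eb gp)].
move=> a b a0 ab b1; have [t [tab + +]] := HT a b a0 ab b1.
have t01 : 0 <= t <= 1 by case/andP: tab => ? ?; apply/andP; split; lra.
rewrite /G /= clamp_id//; have := slope_ge0 E (c t).
case sE : (slope E (c t)) => [s| |] //; rewrite lee_fin => s0 _ /= hs.
have key M z : s < M -> (E z < +oo)%E ->
    e (c t) - e z <= A * M * mdist (c t) z + K * mdist (c t) z ^+ 2.
  move=> sM Ez; have sM' : (slope E (c t) < M%:E)%E by rewrite sE lte_fin.
  have M0 : 0 < M by lra.
  have := slope_upper_gradient E_gtNy lscE k0 (Fd (c t)) _ (F0 (c t)) M0 sM' Ez.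
  by apply; exact: Fc.
have Ect : (E (c t) < +oo)%E.
  have s1 : 0 < s + 1 by lra.
  have s2 : (slope E (c t) < (s + 1)%:E)%E by rewrite sE lte_fin ltrDl.
  by have [] := slope_lt E_gtNy s1 s2.
exists t, s; split => //.
move=> z Ez; apply/ler_addgt0Pr => r r0.
set d := mdist _ _; have d0 : 0 <= d by exact: mdist_ge0.
have Ad : 0 <= A * d by rewrite mulr_ge0.
have Ad1 : 0 < A * d + 1 by lra.
pose eta := r / (A * d + 1).
have eta0 : 0 < eta by rewrite divr_gt0.
have etar : A * d * eta <= r.
  rewrite /eta mulrCA -[leRHS]mulr1 ler_wpM2l ?(ltW r0)// ler_pdivrMr//; lra.
have := key (s + eta) z (_ : _) Ez; rewrite -/d; lra.
Qed.

(** The direct method.  The action enters through the energy bounds of the minimizing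
    curves, whose limit along an ultrafilter bounds the action of the limit curve. *)
Lemma cost_infimum_attained x y (eps : R) c0 : 0 < eps -> admissible x y c0 ->
  (schrodinger_cost E eps c0 < +oo)%E -> schrodinger_solvable E eps x y.
Proof.
move=> eps0 adm0 c0oo; rewrite /schrodinger_solvable /=.
set S := [set _ | _ in _]; set m := ereal_inf S.
have m0 : (0 <= m)%E by apply: le_ereal_inf_tmp => _ [c _ <-]; exact: cost_ge0.
have moo : (m < +oo)%E by apply: le_lt_trans c0oo; apply: ereal_inf_lbound; exists c0.
have mfin : m \is a fin_num by rewrite fin_numE gt_eqF ?lt_eqF// (lt_le_trans _ m0).
split => //; pose r := fine m.
have mE : m = r%:E by rewrite /r fineK.
clearbody r.
have /choice[g Hg] : forall n : nat, exists c, admissible x y c /\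
    (schrodinger_cost E eps c < (r + n.+1%:R^-1)%:E)%E.
  move=> n; have [|_ [c ca <-] clt] := @ereal_inf_lt _ S (r + n.+1%:R^-1)%:E.
    by rewrite -/m mE lte_fin ltrDl invr_gt0.
  by exists c.
have goo n : (schrodinger_cost E eps (g n) < +oo)%E.
  by apply: lt_trans (Hg n).2 _; rewrite ltry.
have /choice[Phi HPhi] : forall n, exists Phi, energy_on 0 1 (g n) Phi /\
    (((Phi 1 - Phi 0) / 2)%:E <= action (g n))%E.
  by move=> n; have [/finite_action_energy[]] := finite_cost eps0 (goo n).
pose K := 2 * (r + 1).
have PK n : Phi n 1 - Phi n 0 <= K.
  have : (((Phi n 1 - Phi n 0) / 2)%R%:E <= (r + n.+1%:R^-1)%R%:E)%E.
    apply: le_trans (HPhi n).2 _; apply: le_trans (ltW (Hg n).2).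
    rewrite /schrodinger_cost leeDl// mule_ge0 ?slope_energy_ge0//.
    by rewrite lee_fin sqr_ge0.
  have : n.+1%:R^-1 <= 1 :> R by rewrite invf_le1// ler1n.
  by rewrite lee_fin /K; move: (n.+1%:R^-1) => p; lra.
have nd n s t : 0 <= s -> s <= t -> t <= 1 -> Phi n s <= Phi n t.
  exact: (energy_on_nd (HPhi n).1).
have K0 : 0 <= K by apply: le_trans (PK 0%N); rewrite subr_ge0 nd.
have g0 n : g n 0 = x by have [[]] := Hg n.
have g1 n : g n 1 = y by have [[]] := Hg n.
have [|D [c [hD Hc]]] := @curves_compact _ _ _ _ spec g x K K0 g0.
  move=> n s t s0 st t1; apply: le_trans ((HPhi n).1 s t s0 st t1) _.
  rewrite ler_wpM2l ?subr_ge0//; apply: le_trans (PK n).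
  by apply: lerB; apply: nd => //; [exact: (le_trans s0 st)|exact: (le_trans st t1)].
(* Any ultrafilter finer than the neighbourhoods of infinity will do. *)
have [U [UU ooU]] := ultraFilterLemma (_ : ProperFilter \oo).
have [Psi eb lim] := limit_energy spec UU ooU (fun n => (HPhi (D n)).1) (fun n => PK (D n)) Hc.
have PU : ProperFilter U := @ultra_proper _ _ UU.
have Slim := limit_slope_energy spec (fun n => energy_on_cont (HPhi (D n)).1) Hc.
set Sc := (\int[mu]_(t in _) _)%E in Slim.
have bound q : (q%:E < Sc)%E -> (Psi 1 - Psi 0) / 2 + eps ^+ 2 * (2^-1 * q) <= r.
  move=> qS; have ev := limn_einf_gt (lt_le_trans qS Slim).
  apply/ler_addgt0Pr => eta eta0.
  suff : Psi 1 - Psi 0 <= 2 * (r + eta - eps ^+ 2 * (2^-1 * q)) by lra.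
  apply: (cvgr_to_le lim); apply: ooU.
  move: ev (near_infty_natSinv_lt (PosNum eta0)); apply: filterS2 => n qn ne.
  have := lt_le_trans (le_lt_trans (cost_ge eps (HPhi (D n)).2 (ltW qn)) (Hg (D n)).2).
  move=> /(_ (r + eta)%:E); rewrite lee_fin lte_fin => h.
  have : (D n).+1%:R^-1 <= eta.
    apply: le_trans (ltW ne); rewrite lef_pV2 ?posrE// ler_nat ltnS.
    exact: extraction_ge.
  by move=> h2; have := h (_ : r + _ <= r + eta); rewrite lerD2l => /(_ h2); lra.
have [acc actc] := energy_on_action eb.
pose a := (Psi 1 - Psi 0) / 2; rewrite -/a in bound actc.
pose kap := eps ^+ 2 * 2^-1.
have kap0 : 0 < kap by rewrite mulr_gt0 ?exprn_gt0// invr_gt0.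
have {}bound q : (q%:E < Sc)%E -> a + kap * q <= r by move/bound; rewrite mulrA.
have Sc0 : (0 <= Sc)%E by apply: integral_ge0 => t _; exact: sqre_ge0.
have cost_c : (schrodinger_cost E eps c <= r%:E)%E.
  case ScE : Sc => [sg| |]; last by move: Sc0; rewrite ScE.
  - have h1 : (Sc <= sg%:E)%E by rewrite ScE.
    apply: le_trans (cost_le eps actc h1) _; rewrite lee_fin mulrA -/kap.
    apply/ler_addgt0Pr => eta eta0.
    have h2 : ((sg - eta / kap)%R%:E < Sc)%E by rewrite ScE lte_fin ltrBlDr ltrDl divr_gt0.
    have := bound _ h2; rewrite mulrBr [kap * (eta / kap)]mulrC divfK ?gt_eqF//; lra.
  - have h2 : (((r - a) / kap + 1)%R%:E < Sc)%E by rewrite ScE ltry.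
    by exfalso; have := bound _ h2; rewrite mulrDr [kap * (_ / kap)]mulrC divfK ?gt_eqF// mulr1; lra.
have same u l : (forall n, u n = l) -> forall z, sub_scvg scvg u z -> z = l.
  move=> ul z uz; apply: contrapT => /eqP zl.
  have zl0 : 0 < mdist z l by rewrite mdist_gt0.
  have ll : sub_scvg scvg (fun=> l) l.
    by apply: sub_scvg_of; [exact: spec|have [] := spec].
  have [N _ HN] := sub_scvg_dist spec uz ll zl0.
  by have := HN N (leqnn _); rewrite /= ul mdistxx ltxx.
have cx : c 0 = x.
  by apply: (same (fun n => g (D n) 0)); [move=> n; exact: g0|apply: Hc; rewrite lexx ler01].
have cy : c 1 = y.
  by apply: (same (fun n => g (D n) 1)); [move=> n; exact: g1|apply: Hc; rewrite lexx ler01].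
have cadm : admissible x y c by split => //; exact: energy_on_within eb.
exists c => //; apply/eqP; rewrite eq_le mE cost_c /= -mE.
by apply: ereal_inf_lbound; exists c.
Qed.

Lemma solvable_endpoints x y (eps k : R) (F : X -> R -> X) : 0 < eps ->
  lower_semicontinuous E -> 0 < k ->
  (forall x, continuous (F x)) -> (forall x, F x 0 = x) -> (forall x, evi_discrete E k (F x)) ->
  schrodinger_solvable E eps x y -> [/\ (E x < +oo)%E, (E y < +oo)%E &
    exists c, [/\ ac_on 0 1 c, c 0 = x & c 1 = y]].
Proof.
move=> eps0 lscE k0 Fc F0 Fd [mfin [c [_ cx cy] cm]].
have coo : (schrodinger_cost E eps c < +oo)%E by rewrite cm ltey_eq mfin.
have [aoo Soo] := finite_cost eps0 coo.
have [E0 E1] := finite_cost_endpoints lscE k0 Fc F0 Fd aoo Soo.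
rewrite -cx -cy; split => //.
by have [acc _] := finite_action_energy aoo; exists c.
Qed.

Lemma endpoints_solvable x y (eps k : R) (F : X -> R -> X) : 0 < eps ->
  (forall B : set X, metric_bounded B -> exists cB : R, forall x, B x -> (cB%:E <= E x)%E) ->
  0 < k ->
  (forall x, continuous (F x)) -> (forall x, F x 0 = x) -> (forall x, evi_discrete E k (F x)) ->
  (E x < +oo)%E -> (E y < +oo)%E -> (exists c, [/\ ac_on 0 1 c, c 0 = x & c 1 = y]) ->
  schrodinger_solvable E eps x y.
Proof.
move=> eps0 lbnd k0 Fc F0 Fd Ex Ey [c0 [acc c0x c0y]].
have [c [L [L0 cx cy cL]]] := lipschitz_reparam acc.
rewrite c0x in cx; rewrite c0y in cy.
have [Phi eb] := bridge_energy k0 Fc F0 Fd Ex Ey L0 cx cy cL.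
have Soo := bridge_slope_energy E_gtNy lbnd k0 Fc F0 Fd Ex Ey L0 cx cy cL.
have [_ aPhi] := energy_on_action eb.
apply: (@cost_infimum_attained _ _ _ (bridge F x y c)) => //.
  split; first exact: energy_on_within eb.
    by rewrite bridge1 ?F0// invr_ge0.
  by rewrite (bridge3 _ _ cy) ?subrr ?F0//; lra.
have Sfin : (\int[mu]_(t in `[0%R, 1%R]) (slope E (bridge F x y c t) ^+ 2))%E \is a fin_num.
  rewrite ge0_fin_numE//; apply: integral_ge0 => t _; exact: sqre_ge0.
by apply: le_lt_trans (cost_le eps aPhi (_ : (_ <= (fine _)%:E)%E)) (ltry _); rewrite fineK.
Qed.

End solvability.

Unset Implicit Arguments.

Theorem proposition4p2 (R : realType) (X : metricType R) (E : X -> \bar R)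
  (E_gtNy : forall x : X, (-oo < E x)%E)
  (hA1 : assumptionA1 X) (hA2 : assumptionA2 E) (hA3 : assumptionA3 E)
  (hS : assumptionS E)
  (x y : X) (eps : R) (eps_gt0 : 0 < eps) :
  schrodinger_solvable E eps x y <->
  [/\ (E x < +oo)%E, (E y < +oo)%E &
      exists c : R -> X, [/\ ac_on 0 1 c, c 0 = x & c 1 = y]].
Proof.
have [scvg spec] := scvg_of_assumptionS hS.
have [k k0 [F [Fc F0 Fd]]] := discrete_flows E_gtNy hA2 hA3.
have [lscE _ lbnd] := hA2; split.
  exact: (solvable_endpoints E_gtNy spec eps_gt0 lscE k0 Fc F0 Fd).
by move=> [Ex Ey acc]; exact: (endpoints_solvable E_gtNy spec eps_gt0 lbnd k0 Fc F0 Fd).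
Qed.
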